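(* For all $\theta\in[0,1]$ and $n\in\mathbb N$: (1) $\kappa_n((R,C)_\theta)=n^{\theta/2}$; (2) $\kappa_n((\min(\ell_2),\max(\ell_2))_\theta)=n^{\theta/2}$.
   Context: Operator spaces are complex: closed linear subspaces $X\subseteq \mathcal B(H)$ (or given by matrix norms satisfying Ruan's axioms), with $\mathrm M_n(X)$ normed through $\mathrm M_n(X)\subseteq \mathrm M_n(\mathcal B(H))\cong\mathcal B(H^{\oplus n})$. An operator space $X$ is Hilbertian if it is linearly isometric to a Hilbert space, and homogeneous if $\|u\|_{\rm cb}=\|u\|$ for every bounded linear $u\colon X\to X$, where $\|u\|_{\rm cb}=\sup_n\|u_n\|$, $u_n([x_{ij}])=[u(x_{ij})]$. For a homogeneous Hilbertian operator space $X$ with $\dim X\ge n$, $\kappa_n(X)$ is the norm in $\mathrm M_n(X)$ of the matrix whose first column is $(e_1,\dots,e_n)^T$ and whose other entries are $0$, where $\{e_1,\dots,e_n\}$ is any orthonormal set in $X$ (the value does not depend on the choice). With $e_{i,j}\in\mathcal B(\ell_2)$ the matrix units, $R=\overline{\rm span}\{e_{1,j}:j\in\mathbb N\}$ and $C=\overline{\rm span}\{e_{i,1}:i\in\mathbb N\}$. $\min(\ell_2)$ and $\max(\ell_2)$ are $\ell_2$ with $\|[x_{ij}]\|_{\mathrm M_n(\min(\ell_2))}=\sup\{\|[\varphi(x_{ij})]\|_{\mathrm M_n(\mathbb C)}:\varphi\in B_{\ell_2^*}\}$ and $\|[x_{ij}]\|_{\mathrm M_n(\max(\ell_2))}=\sup\{\|[u(x_{ij})]\|_{\mathrm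 M_n(\mathcal B(H))}:H\text{ a Hilbert space}, u\colon\ell_2\to\mathcal B(H)\text{ linear},\|u\|\le1\}$. All four are homogeneous and isometric to $\ell_2$. For two such spaces $X_0,X_1$, identified as Banach spaces through a linear isometry (the choice is irrelevant), $(X_0,X_1)_\theta$ is the complex interpolation space with the operator space structure $\mathrm M_n((X_0,X_1)_\theta)=(\mathrm M_n(X_0),\mathrm M_n(X_1))_\theta$, with $(X_0,X_1)_0=X_0$ and $(X_0,X_1)_1=X_1$; it is again homogeneous Hilbertian. *)

(* Defs.v *)
From Stdlib Require Import Reals Lra ProofIrrelevance FunctionalExtensionality.
From Stdlib Require Import PropExtensionality ClassicalEpsilon.
From mathcomp Require Import ssreflect ssrbool ssrfun eqtype ssrnat fintype bigop.
From Coquelicot Require Import Coquelicot.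

Set Implicit Arguments.
Unset Strict Implicit.
Unset Printing Implicit Defensive.

Local Open Scope R_scope.

(* Infinite values are sent to 0; below, [Sup] is only applied to nonempty sets
   bounded above, and [Inf] to nonempty sets bounded below. *)
Definition Sup (E : R -> Prop) : R := real (Lub_Rbar E).
Definition Inf (E : R -> Prop) : R := real (Glb_Rbar E).

Section Functions.
Variables (K : Ring) (T : Type) (V : ModuleSpace K).

Definition funs_AbelianMonoid_mixin : AbelianMonoid.mixin_of (T -> V).
Proof.
apply: (@AbelianMonoid.Mixin _ (fun f g t => plus (f t) (g t)) (fun=> zero)).
- by move=> f g; apply: functional_extensionality => t; exact: plus_comm.
- by move=> f g h; apply: functional_extensionality => t; exact: plus_assoc.
- by move=> f; apply: functional_extensionality => t; exact: plus_zero_r.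
Defined.

Definition funs_AbelianGroup_mixin :
  AbelianGroup.mixin_of
    (AbelianMonoid.Pack (T -> V) funs_AbelianMonoid_mixin (T -> V)).
Proof.
apply: (@AbelianGroup.Mixin (AbelianMonoid.Pack (T -> V) _ _)
  (fun f t => opp (f t))).
by move=> f; apply: functional_extensionality => t; exact: plus_opp_r.
Defined.

Definition funs_AbelianGroup : AbelianGroup :=
  AbelianGroup.Pack (T -> V)
    (AbelianGroup.Class (T -> V) funs_AbelianMonoid_mixin
       funs_AbelianGroup_mixin) (T -> V).

Definition funs_ModuleSpace_mixin : ModuleSpace.mixin_of K funs_AbelianGroup.
Proof.
apply: (@ModuleSpace.Mixin K funs_AbelianGroup (fun k f t => scal k (f t))).
- by move=> x y f; apply: functional_extensionality => t; exact: scal_assoc.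
- by move=> f; apply: functional_extensionality => t; exact: scal_one.
- by move=> x f g; apply: functional_extensionality => t; exact: scal_distr_l.
- by move=> x y f; apply: functional_extensionality => t; exact: scal_distr_r.
Defined.

Definition funs : ModuleSpace K :=
  ModuleSpace.Pack K (T -> V)
    (ModuleSpace.Class K (T -> V) (AbelianGroup.class funs_AbelianGroup)
       funs_ModuleSpace_mixin) (T -> V).

End Functions.
Arguments funs {K} T V.

Record is_subspace (K : Ring) (V : ModuleSpace K) (P : V -> Prop) : Prop :=
  IsSubspace {
    subspace_zero : P zero;
    subspace_plus : forall x y, P x -> P y -> P (plus x y);
    subspace_scal : forall k x, P x -> P (scal k x) }.

Section Subspaces.
Variables (K : Ring) (V : ModuleSpace K) (P : V -> Prop) (hP : is_subspace P).

Definition subspace_carrier : Type := {v : V | P v}.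

Lemma subspace_eq (x y : subspace_carrier) : proj1_sig x = proj1_sig y -> x = y.
Proof. exact: eq_sig_hprop (fun _ => proof_irrelevance _) _ _. Qed.

Lemma subspace_opp x : P x -> P (opp x).
Proof. by move=> hx; rewrite -scal_opp_one; exact: subspace_scal. Qed.

Definition subspace_AbelianMonoid_mixin : AbelianMonoid.mixin_of subspace_carrier.
Proof.
apply: (@AbelianMonoid.Mixin _
  (fun x y => exist P _ (subspace_plus hP (proj2_sig x) (proj2_sig y)))
  (exist P _ (subspace_zero hP))).
- by move=> x y; apply: subspace_eq; exact: plus_comm.
- by move=> x y z; apply: subspace_eq; exact: plus_assoc.
- by move=> x; apply: subspace_eq; exact: plus_zero_r.
Defined.

Definition subspace_AbelianGroup_mixin :
  AbelianGroup.mixin_of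
    (AbelianMonoid.Pack subspace_carrier subspace_AbelianMonoid_mixin
       subspace_carrier).
Proof.
apply: (@AbelianGroup.Mixin (AbelianMonoid.Pack subspace_carrier _ _)
  (fun x : subspace_carrier => exist P _ (subspace_opp (proj2_sig x)))).
by move=> x; apply: subspace_eq; exact: plus_opp_r.
Defined.

Definition subspace_AbelianGroup : AbelianGroup :=
  AbelianGroup.Pack subspace_carrier
    (AbelianGroup.Class subspace_carrier subspace_AbelianMonoid_mixin
       subspace_AbelianGroup_mixin) subspace_carrier.

Definition subspace_ModuleSpace_mixin :
  ModuleSpace.mixin_of K subspace_AbelianGroup.
Proof.
apply: (@ModuleSpace.Mixin K subspace_AbelianGroup
  (fun k x => exist P _ (subspace_scal hP k (proj2_sig x)))).
- by move=> x y f; apply: subspace_eq; exact: scal_assoc.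
- by move=> f; apply: subspace_eq; exact: scal_one.
- by move=> x f g; apply: subspace_eq; exact: scal_distr_l.
- by move=> x y f; apply: subspace_eq; exact: scal_distr_r.
Defined.

Definition subspace : ModuleSpace K :=
  ModuleSpace.Pack K subspace_carrier
    (ModuleSpace.Class K subspace_carrier
       (AbelianGroup.class subspace_AbelianGroup)
       subspace_ModuleSpace_mixin) subspace_carrier.

End Subspaces.

(* Linear in the first variable. *)
Record HilbertSpace := MkHilbertSpace {
  hilbert_car :> CompleteNormedModule C_AbsRing;
  inner : hilbert_car -> hilbert_car -> C;
  inner_plus_l : forall x y z, inner (plus x y) z = Cplus (inner x z) (inner y z);
  inner_scal_l : forall k x z, inner (scal k x) z = Cmult k (inner x z);
  inner_conj : forall x y, inner y x = Cconj (inner x y);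
  inner_norm : forall x, inner x x = RtoC (norm x ^ 2) }.
Arguments inner {h} x y.

Section NormToModule.
Variables (V : ModuleSpace C_AbsRing) (nrm : V -> R).
Hypothesis nrm_triangle : forall x y, nrm (plus x y) <= nrm x + nrm y.
Hypothesis nrm_scal : forall (k : C) x, nrm (scal (k : C_AbsRing) x) <= Cmod k * nrm x.
Hypothesis nrm_eq0 : forall x, nrm x = 0 -> x = zero.

Lemma nrm_zero : nrm zero = 0.
Proof.
have h0 := nrm_scal (RtoC 0) zero.
rewrite Cmod_0 Rmult_0_l scal_zero_r in h0.
have h1 := nrm_triangle zero zero; rewrite plus_zero_r in h1.
lra.
Qed.

Lemma nrm_opp x : nrm (opp x) <= nrm x.
Proof.
rewrite -scal_opp_one; apply: Rle_trans (nrm_scal _ _) _.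
have -> : Cmod (opp one : C_AbsRing) = 1 by exact: Cmod_m1.
lra.
Qed.

Definition nrm_Uniform_mixin : UniformSpace.mixin_of V.
Proof.
apply: (@UniformSpace.Mixin V zero (fun x e y => nrm (minus y x) < e)).
- by move=> x e; rewrite /minus plus_opp_r nrm_zero; exact: cond_pos.
- move=> x y e h; rewrite -opp_minus; exact: Rle_lt_trans (nrm_opp _) h.
- move=> x y z e1 e2 h1 h2.
  rewrite (minus_trans y); apply: Rle_lt_trans (nrm_triangle _ _) _.
  lra.
Defined.

Definition nrm_NormedModuleAux : NormedModuleAux C_AbsRing :=
  NormedModuleAux.Pack C_AbsRing V
    (NormedModuleAux.Class C_AbsRing V (ModuleSpace.class _ V)
       nrm_Uniform_mixin) V.

Definition nrm_NormedModule_mixin :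
  NormedModule.mixin_of C_AbsRing nrm_NormedModuleAux.
Proof.
apply: (@NormedModule.Mixin C_AbsRing nrm_NormedModuleAux nrm 1).
- exact: nrm_triangle.
- exact: nrm_scal.
- by [].
- by move=> x y e; rewrite Rmult_1_l.
- exact: nrm_eq0.
Defined.

Definition nrm_NormedModule : NormedModule C_AbsRing :=
  NormedModule.Pack C_AbsRing V
    (NormedModule.Class C_AbsRing V (NormedModuleAux.class _ nrm_NormedModuleAux)
       nrm_NormedModule_mixin) V.

Hypothesis nrm_complete : forall F : (nrm_NormedModule -> Prop) -> Prop,
  ProperFilter F -> cauchy F ->
  exists x : nrm_NormedModule, forall eps : posreal, F (ball x eps).

Definition nrm_CompleteSpace_mixin :
  CompleteSpace.mixin_of (NormedModule.UniformSpace _ nrm_NormedModule).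
Proof.
apply: (@CompleteSpace.Mixin _ (fun F =>
  epsilon (inhabits (zero : nrm_NormedModule))
    (fun x => forall eps : posreal, F (ball x eps)))).
- by move=> F hF hc; exact: (epsilon_spec _ _ (nrm_complete hF hc)).
- move=> F1 F2 h12 h21.
  have -> : F1 = F2.
    apply: functional_extensionality => A; apply: propositional_extensionality.
    by split; [exact: h21 | exact: h12].
  by move=> e; exact: ball_center.
Defined.

Definition nrm_CompleteNormedModule : CompleteNormedModule C_AbsRing :=
  CompleteNormedModule.Pack C_AbsRing V
    (CompleteNormedModule.Class C_AbsRing V (NormedModule.class _ nrm_NormedModule)
       nrm_CompleteSpace_mixin) V.

End NormToModule.

Definition square_summable (x : nat -> C) : Prop :=
  ex_series (fun k => Cmod (x k) ^ 2).

Definition seqC : ModuleSpace C_AbsRing := funs nat (C_ModuleSpace : ModuleSpace C_AbsRing).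

Lemma Cmod_plus_sq (a b : C) : Cmod (Cplus a b) ^ 2 <= 2 * Cmod a ^ 2 + 2 * Cmod b ^ 2.
Proof.
have h := Cmod_triangle a b; have h0 := Cmod_ge_0 (Cplus a b).
have h1 : Cmod (Cplus a b) ^ 2 <= (Cmod a + Cmod b) ^ 2 by apply: pow_incr; lra.
apply: Rle_trans h1 _; have := pow2_ge_0 (Cmod a - Cmod b); lra.
Qed.

Lemma square_summable_subspace : is_subspace (square_summable : seqC -> Prop).
Proof.
split.
- apply: (ex_series_ext (fun _ => 0 * 0)).
    move=> k; change (0 * 0 = Cmod (RtoC 0) ^ 2); rewrite Cmod_0; ring.
  apply: (ex_series_scal_l 0 (fun _ => 0)); exists 0.
  apply: (filterlim_ext (fun _ => 0)); last exact: filterlim_const.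
  by elim=> [|n IH]; rewrite ?sum_O // sum_Sn -IH /plus /= Rplus_0_l.
- move=> x y hx hy.
  apply: (ex_series_le _ (fun k => 2 * Cmod (x k) ^ 2 + 2 * Cmod (y k) ^ 2)).
    move=> k; rewrite /norm /= /abs /= Rabs_pos_eq; last by apply: pow2_ge_0.
    exact: Cmod_plus_sq.
  by apply: ex_series_plus; apply: ex_series_scal_l.
- move=> k x hx.
  apply: (ex_series_ext (fun j => Cmod k ^ 2 * Cmod (x j) ^ 2)).
    by move=> j; rewrite -Rpow_mult_distr -Cmod_mult.
  exact: ex_series_scal_l.
Qed.

Definition ell2_module : ModuleSpace C_AbsRing := subspace square_summable_subspace.

Definition ell2_coord (x : ell2_module) (k : nat) : C := proj1_sig x k.

Definition ell2_norm (x : ell2_module) : R :=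
  sqrt (Series (fun k => Cmod (ell2_coord x k) ^ 2)).

Definition ell2_inner (x y : ell2_module) : C :=
  (Series (fun k => Re (Cmult (ell2_coord x k) (Cconj (ell2_coord y k)))),
   Series (fun k => Im (Cmult (ell2_coord x k) (Cconj (ell2_coord y k))))).

Lemma ell2_summable (x : ell2_module) : ex_series (fun k => Cmod (ell2_coord x k) ^ 2).
Proof. exact: (proj2_sig x). Qed.

Lemma Series_nonneg (a : nat -> R) : (forall k, 0 <= a k) -> ex_series a -> 0 <= Series a.
Proof.
move=> h0 ha; have <- : Series (fun k => 0 * a k) = 0 by rewrite Series_scal_l; ring.
by apply: Series_le => // k; split; have := h0 k; lra.
Qed.

Lemma ell2_norm_sq x : ell2_norm x ^ 2 = Series (fun k => Cmod (ell2_coord x k) ^ 2).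
Proof.
rewrite /ell2_norm pow2_sqrt //; apply: Series_nonneg (ell2_summable x) => k.
exact: pow2_ge_0.
Qed.

Lemma ell2_norm_ge0 x : 0 <= ell2_norm x.
Proof. exact: sqrt_pos. Qed.

Lemma ell2_ex_prod (x y : ell2_module) :
  ex_series (fun k => Cmod (ell2_coord x k) * Cmod (ell2_coord y k)).
Proof.
apply: (ex_series_le _ (fun k => Cmod (ell2_coord x k) ^ 2 + Cmod (ell2_coord y k) ^ 2)).
  move=> k; have hx := Cmod_ge_0 (ell2_coord x k); have hy := Cmod_ge_0 (ell2_coord y k).
  rewrite /norm /= /abs /= Rabs_pos_eq; last exact: Rmult_le_pos.
  have := pow2_ge_0 (Cmod (ell2_coord x k) - Cmod (ell2_coord y k)).
  have := Rmult_le_pos _ _ hx hy; nra.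
exact: (ex_series_plus _ _ (ell2_summable x) (ell2_summable y)).
Qed.

Lemma ell2_cauchy_schwarz (x y : ell2_module) :
  Series (fun k => Cmod (ell2_coord x k) * Cmod (ell2_coord y k))
    <= ell2_norm x * ell2_norm y.
Proof.
set s := Series _; have hs := ell2_ex_prod x y.
have key t : 0 <= ell2_norm x ^ 2 - 2 * t * s + t ^ 2 * ell2_norm y ^ 2.
  have hx := ell2_summable x; have hy := ell2_summable y.
  have -> : ell2_norm x ^ 2 - 2 * t * s + t ^ 2 * ell2_norm y ^ 2 =
    Series (fun k => (Cmod (ell2_coord x k) ^ 2
      + (- 2 * t) * (Cmod (ell2_coord x k) * Cmod (ell2_coord y k)))
      + t ^ 2 * Cmod (ell2_coord y k) ^ 2).
    rewrite Series_plus; [|apply: ex_series_plus => //|]; try exact: ex_series_scal_l.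
    rewrite Series_plus //; last exact: ex_series_scal_l.
    by rewrite !Series_scal_l !ell2_norm_sq /s; ring.
  apply: Series_nonneg.
    move=> k; have := pow2_ge_0 (Cmod (ell2_coord x k) - t * Cmod (ell2_coord y k)); lra.
  by apply: ex_series_plus; [apply: ex_series_plus => //|]; exact: ex_series_scal_l.
have hx0 := ell2_norm_ge0 x; have hy0 := ell2_norm_ge0 y.
case: (Rle_lt_dec s (ell2_norm x * ell2_norm y)) => // hlt; exfalso.
case: (Req_dec (ell2_norm y) 0) => [y0|y0].
  rewrite y0 Rmult_0_r in hlt.
  have := key ((ell2_norm x ^ 2 + 1) / (2 * s)); rewrite y0.
  have -> : 2 * ((ell2_norm x ^ 2 + 1) / (2 * s)) * s = ell2_norm x ^ 2 + 1 by field; lra.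
  lra.
have hk := key (s / ell2_norm y ^ 2).
have hy2 : 0 < ell2_norm y ^ 2 by apply: pow_lt; lra.
have e : ell2_norm x ^ 2 - 2 * (s / ell2_norm y ^ 2) * s
   + (s / ell2_norm y ^ 2) ^ 2 * ell2_norm y ^ 2 =
   ell2_norm x ^ 2 - s ^ 2 / ell2_norm y ^ 2 by field.
rewrite e in hk.
have h2 : s ^ 2 <= (ell2_norm x * ell2_norm y) ^ 2.
  have -> : s ^ 2 = s ^ 2 / ell2_norm y ^ 2 * ell2_norm y ^ 2 by field.
  rewrite Rpow_mult_distr; apply: Rmult_le_compat_r; lra.
have h3 := Rmult_le_pos _ _ hx0 hy0; nra.
Qed.

Lemma ell2_triangle (x y : ell2_module) :
  ell2_norm (plus x y) <= ell2_norm x + ell2_norm y.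
Proof.
have hx0 := ell2_norm_ge0 x; have hy0 := ell2_norm_ge0 y.
apply: Rsqr_incr_0_var; last lra.
rewrite !Rsqr_pow2 ell2_norm_sq.
have hx := ell2_summable x; have hy := ell2_summable y; have hxy := ell2_ex_prod x y.
have hex : ex_series (fun k => (Cmod (ell2_coord x k) ^ 2
  + 2 * (Cmod (ell2_coord x k) * Cmod (ell2_coord y k))) + Cmod (ell2_coord y k) ^ 2).
  apply: ex_series_plus => //; apply: ex_series_plus => //; exact: ex_series_scal_l.
apply: Rle_trans.
  apply: (Series_le _ (fun k => (Cmod (ell2_coord x k) ^ 2
    + 2 * (Cmod (ell2_coord x k) * Cmod (ell2_coord y k))) + Cmod (ell2_coord y k) ^ 2)) => //.
  move=> k; split; first exact: pow2_ge_0.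
  have h := Cmod_triangle (ell2_coord x k) (ell2_coord y k).
  have h0 := Cmod_ge_0 (Cplus (ell2_coord x k) (ell2_coord y k)).
  have : Cmod (Cplus (ell2_coord x k) (ell2_coord y k)) ^ 2
    <= (Cmod (ell2_coord x k) + Cmod (ell2_coord y k)) ^ 2 by apply: pow_incr; lra.
  change (ell2_coord (plus x y) k) with (Cplus (ell2_coord x k) (ell2_coord y k)); lra.
rewrite Series_plus //; last by apply: ex_series_plus => //; exact: ex_series_scal_l.
rewrite Series_plus //; last exact: ex_series_scal_l.
rewrite Series_scal_l -!ell2_norm_sq.
have := ell2_cauchy_schwarz x y; lra.
Qed.

Lemma ell2_norm_scal (k : C) (x : ell2_module) :
  ell2_norm (scal (k : C_AbsRing) x) <= Cmod k * ell2_norm x.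
Proof.
have hk := Cmod_ge_0 k; have hx0 := ell2_norm_ge0 x.
apply: Rsqr_incr_0_var; last exact: Rmult_le_pos.
rewrite !Rsqr_pow2 Rpow_mult_distr !ell2_norm_sq -Series_scal_l; right.
by apply: Series_ext => j; rewrite -Rpow_mult_distr -Cmod_mult.
Qed.

Lemma Series_ge_term (a : nat -> R) k : (forall k, 0 <= a k) -> ex_series a -> a k <= Series a.
Proof.
elim: k a => [|k IH] a h0 ha; rewrite Series_incr_1 //.
  by have := Series_nonneg (fun k => h0 k.+1) (proj1 (ex_series_incr_1 a) ha); lra.
have := IH (fun j => a j.+1) (fun j => h0 j.+1) (proj1 (ex_series_incr_1 a) ha).
by have := h0 0%N; lra.
Qed.

Lemma ell2_coord_le x k : Cmod (ell2_coord x k) <= ell2_norm x.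
Proof.
apply: Rsqr_incr_0_var; last exact: ell2_norm_ge0.
rewrite !Rsqr_pow2 ell2_norm_sq.
by apply: (Series_ge_term (a := fun k => Cmod (ell2_coord x k) ^ 2)) => [j|];
  [exact: pow2_ge_0 | exact: ell2_summable].
Qed.

Lemma ell2_norm_eq0 x : ell2_norm x = 0 -> x = zero.
Proof.
move=> h; apply: subspace_eq; apply: functional_extensionality => k.
apply: Cmod_eq_0; have := ell2_coord_le x k; rewrite h.
have := Cmod_ge_0 (ell2_coord x k); rewrite /ell2_coord /=; lra.
Qed.

Definition ell2_NormedModule : NormedModule C_AbsRing :=
  nrm_NormedModule ell2_triangle ell2_norm_scal ell2_norm_eq0.

Lemma ex_series_of_bounded (a : nat -> R) M :
  (forall k, 0 <= a k) -> (forall n, sum_n a n <= M) -> ex_series a /\ Series a <= M.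
Proof.
move=> h0 hM.
have hincr n : sum_n a n <= sum_n a n.+1.
  by rewrite sum_Sn /plus /=; have := h0 n.+1; lra.
have [l hl] : ex_finite_lim_seq (sum_n a) by exact: (ex_finite_lim_seq_incr _ M).
have hs : is_series a l by exact: hl.
split; first by exists l.
rewrite (is_series_unique _ _ hs).
exact: (is_lim_seq_le _ _ l M hM hl (is_lim_seq_const M)).
Qed.

Lemma ell2_complete (F : (ell2_NormedModule -> Prop) -> Prop) :
  ProperFilter F -> cauchy F ->
  exists x : ell2_NormedModule, forall eps : posreal, F (ball x eps).
Proof.
move=> hF hc.
pose co k (z : ell2_NormedModule) : C_CompleteNormedModule := ell2_coord z k.
have hcc k : cauchy (filtermap (co k) F).
  move=> e; have [y hy] := hc e; exists (co k y).
  apply: (filter_imp (F := F) (ball y e) _ _ hy) => z hz.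
  apply: (C_NormedModule_mixin_compat1 (co k y) (co k z)).
  apply: Rle_lt_trans hz; exact: (ell2_coord_le (minus z y) k).
pose l k : C := lim (filtermap (co k) F).
have hl k (e : posreal) : F (fun z => Cmod (Cminus (ell2_coord z k) (l k)) < e).
  have h2 : 0 < e / sqrt 2 by apply: Rdiv_lt_0_compat; [exact: cond_pos | exact: Rlt_sqrt2_0].
  have hb := complete_cauchy (filtermap (co k) F) (filtermap_proper_filter _ _ (co k) F hF)
    (hcc k) (mkposreal _ h2).
  apply: (filter_imp (F := F) _ _ _ hb) => z hz.
  have := C_NormedModule_mixin_compat2 _ _ _ hz.
  have -> : sqrt 2 * {| pos := e / sqrt 2; cond_pos := h2 |} = e.
    by rewrite /=; field; have := Rlt_sqrt2_0; lra.
  by [].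
have bound (d : posreal) (y z : ell2_NormedModule) :
    F (ball y d) -> ball y d z -> forall n,
    sum_n (fun k => Cmod (Cminus (ell2_coord z k) (l k)) ^ 2) n <= 18 * d ^ 2.
  move=> hy hz n.
  have hd := cond_pos d.
  have hn : 0 < d / (INR n + 1) by apply: Rdiv_lt_0_compat => //; have := pos_INR n; lra.
  have hall m : F (fun w => forall k, (k <= m)%coq_nat ->
      Cmod (Cminus (ell2_coord w k) (l k)) < d / (INR n + 1)).
    elim: m => [|m IH].
      apply: filter_imp (hl 0%N (mkposreal _ hn)) => w hw k hk.
      by have -> : k = 0%N by move: hk => /leP; case: k.
    apply: filter_imp (filter_and _ _ IH (hl m.+1 (mkposreal _ hn))) => w [h1 h2] k hk.
    case: (Nat.eq_dec k m.+1) => [->|hne]; first exact: h2.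
    by apply: h1; apply: PeanoNat.lt_n_Sm_le; apply/PeanoNat.Nat.le_neq.
  have [w [hw1 hw2]] := filter_ex _ (filter_and _ _ hy (hall n)).
  have hzw : ell2_norm (minus z w) < 2 * d.
    have -> : minus z w = plus (minus z y) (minus y w) by exact: (minus_trans y z w).
    apply: Rle_lt_trans (ell2_triangle _ _) _.
    have h1 : ell2_norm (minus z y) < d by exact: hz.
    have h2 : ell2_norm (minus y w) < d by exact: (ball_sym _ _ _ hw1).
    lra.
  have hterm k : (k <= n)%coq_nat -> Cmod (Cminus (ell2_coord z k) (l k)) ^ 2
      <= 2 * Cmod (ell2_coord (minus z w) k) ^ 2 + 2 * (d / (INR n + 1)) ^ 2.
    move=> hk.
    have -> : Cminus (ell2_coord z k) (l k) =
       Cplus (ell2_coord (minus z w) k) (Cminus (ell2_coord w k) (l k)).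
      change (ell2_coord (minus z w) k) with (Cminus (ell2_coord z k) (ell2_coord w k)).
      by rewrite /Cminus; ring.
    apply: Rle_trans (Cmod_plus_sq _ _) _.
    have h := hw2 k hk; have h0 := Cmod_ge_0 (Cminus (ell2_coord w k) (l k)).
    have : Cmod (Cminus (ell2_coord w k) (l k)) ^ 2 <= (d / (INR n + 1)) ^ 2.
      by apply: pow_incr; lra.
    lra.
  have hsum : sum_n (fun k => Cmod (Cminus (ell2_coord z k) (l k)) ^ 2) n <=
      sum_n (fun k => 2 * Cmod (ell2_coord (minus z w) k) ^ 2
                      + 2 * (d / (INR n + 1)) ^ 2) n.
    rewrite !sum_n_Reals; apply: sum_Rle => k hk; exact: hterm.
  apply: Rle_trans hsum _.
  have -> : sum_n (fun k => 2 * Cmod (ell2_coord (minus z w) k) ^ 2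
                      + 2 * (d / (INR n + 1)) ^ 2) n =
     2 * sum_n (fun k => Cmod (ell2_coord (minus z w) k) ^ 2) n
       + (INR n + 1) * (2 * (d / (INR n + 1)) ^ 2).
    rewrite (sum_n_plus (fun k => 2 * Cmod (ell2_coord (minus z w) k) ^ 2)
      (fun _ => 2 * (d / (INR n + 1)) ^ 2)) sum_n_const S_INR.
    by rewrite (sum_n_mult_l (2 : R_Ring) (fun k => Cmod (ell2_coord (minus z w) k) ^ 2)).
  have h1 : sum_n (fun k => Cmod (ell2_coord (minus z w) k) ^ 2) n
       <= ell2_norm (minus z w) ^ 2.
    rewrite ell2_norm_sq sum_n_Reals.
    apply: (sum_incr _ _ _ _ (fun k => pow2_ge_0 _)).
    have := Series_correct _ (ell2_summable (minus z w)).
    by move/is_series_Reals.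
  have h2 : ell2_norm (minus z w) ^ 2 <= (2 * d) ^ 2.
    by apply: pow_incr; have := ell2_norm_ge0 (minus z w); lra.
  have h3 : (INR n + 1) * (2 * (d / (INR n + 1)) ^ 2) <= 2 * d ^ 2.
    have hI := pos_INR n.
    have -> : (INR n + 1) * (2 * (d / (INR n + 1)) ^ 2) = 2 * d ^ 2 * / (INR n + 1).
      by field; lra.
    rewrite -{2}(Rmult_1_r (2 * d ^ 2)); apply: Rmult_le_compat_l.
      by have := pow2_ge_0 d; lra.
    by rewrite -Rinv_1; apply: Rinv_le_contravar; lra.
  have -> : 18 * d ^ 2 = 2 * ((2 * d) ^ 2) + 2 * d ^ 2 + 8 * d ^ 2 by ring.
  have := pow2_ge_0 d; lra.
have ssl : square_summable l.
  have [y hy] := hc (mkposreal 1 Rlt_0_1).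
  have [h _] := ex_series_of_bounded (a := fun k => Cmod (Cminus (ell2_coord y k) (l k)) ^ 2)
    (fun k => pow2_ge_0 _) (bound (mkposreal 1 Rlt_0_1) y y hy (ball_center _ _)).
  apply: (ex_series_le _ (fun k => 2 * Cmod (ell2_coord y k) ^ 2
     + 2 * Cmod (Cminus (ell2_coord y k) (l k)) ^ 2)).
    move=> k; rewrite /norm /= /abs /= Rabs_pos_eq; last exact: pow2_ge_0.
    have := Cmod_plus_sq (ell2_coord y k) (Copp (Cminus (ell2_coord y k) (l k))).
    rewrite Cmod_opp.
    by have -> : Cplus (ell2_coord y k) (Copp (Cminus (ell2_coord y k) (l k))) = l k by ring.
  apply: ex_series_plus; apply: ex_series_scal_l => //; exact: ell2_summable.
exists (exist _ l ssl : ell2_module) => e.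
have he : 0 < e / 5 by have := cond_pos e; lra.
have [y hy] := hc (mkposreal _ he).
apply: filter_imp (hy) => z hz.
have [h1 h2] := ex_series_of_bounded (a := fun k => Cmod (Cminus (ell2_coord z k) (l k)) ^ 2)
    (fun k => pow2_ge_0 _) (bound _ y z hy hz).
set x : ell2_module := exist _ _ _.
suff : ell2_norm (minus z x) < e by [].
apply: Rsqr_incrst_0; [|exact: ell2_norm_ge0|by have := cond_pos e; lra].
rewrite !Rsqr_pow2 ell2_norm_sq.
apply: Rle_lt_trans h2 _; rewrite /=.
have := pow_lt e 2 (cond_pos e); lra.
Qed.

Definition ell2_CompleteNormedModule : CompleteNormedModule C_AbsRing :=
  nrm_CompleteNormedModule ell2_complete.

Lemma ell2_ex_Re (x y : ell2_module) :
  ex_series (fun k => Re (Cmult (ell2_coord x k) (Cconj (ell2_coord y k)))).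
Proof.
apply: (ex_series_le _ (fun k => Cmod (ell2_coord x k) * Cmod (ell2_coord y k))).
  by move=> k; rewrite -(Cmod_conj (ell2_coord y k)) -Cmod_mult; exact: re_le_Cmod.
exact: ell2_ex_prod.
Qed.

Lemma ell2_ex_Im (x y : ell2_module) :
  ex_series (fun k => Im (Cmult (ell2_coord x k) (Cconj (ell2_coord y k)))).
Proof.
apply: (ex_series_le _ (fun k => Cmod (ell2_coord x k) * Cmod (ell2_coord y k))).
  move=> k; rewrite -(Cmod_conj (ell2_coord y k)) -Cmod_mult.
  exact: Rle_trans (Rmax_r _ _) (Rmax_Cmod _).
exact: ell2_ex_prod.
Qed.

Definition ell2 : HilbertSpace.
Proof.
apply: (@MkHilbertSpace ell2_CompleteNormedModule ell2_inner).
- move=> x y z; rewrite /ell2_inner.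
  have e1 : forall k, Re (Cmult (ell2_coord (plus x y) k) (Cconj (ell2_coord z k))) =
     Re (Cmult (ell2_coord x k) (Cconj (ell2_coord z k)))
     + Re (Cmult (ell2_coord y k) (Cconj (ell2_coord z k))).
    move=> k; change (ell2_coord (plus x y) k) with (Cplus (ell2_coord x k) (ell2_coord y k)).
    by rewrite Cmult_plus_distr_r.
  have e2 : forall k, Im (Cmult (ell2_coord (plus x y) k) (Cconj (ell2_coord z k))) =
     Im (Cmult (ell2_coord x k) (Cconj (ell2_coord z k)))
     + Im (Cmult (ell2_coord y k) (Cconj (ell2_coord z k))).
    move=> k; change (ell2_coord (plus x y) k) with (Cplus (ell2_coord x k) (ell2_coord y k)).
    by rewrite Cmult_plus_distr_r.
  by rewrite (Series_ext _ _ e1) (Series_ext _ _ e2)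
    (Series_plus _ _ (ell2_ex_Re x z) (ell2_ex_Re y z))
    (Series_plus _ _ (ell2_ex_Im x z) (ell2_ex_Im y z)).
- move=> k x z; rewrite /ell2_inner.
  have e1 : forall j, Re (Cmult (ell2_coord (scal k x) j) (Cconj (ell2_coord z j))) =
     Re k * Re (Cmult (ell2_coord x j) (Cconj (ell2_coord z j)))
     - Im k * Im (Cmult (ell2_coord x j) (Cconj (ell2_coord z j))).
    move=> j; change (ell2_coord (scal k x) j) with (Cmult k (ell2_coord x j)).
    by rewrite -Cmult_assoc.
  have e2 : forall j, Im (Cmult (ell2_coord (scal k x) j) (Cconj (ell2_coord z j))) =
     Re k * Im (Cmult (ell2_coord x j) (Cconj (ell2_coord z j)))
     + Im k * Re (Cmult (ell2_coord x j) (Cconj (ell2_coord z j))).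
    move=> j; change (ell2_coord (scal k x) j) with (Cmult k (ell2_coord x j)).
    by rewrite -Cmult_assoc.
  have hr := ell2_ex_Re x z; have hi := ell2_ex_Im x z.
  rewrite (Series_ext _ _ e1) (Series_ext _ _ e2).
  rewrite Series_minus; try exact: ex_series_scal_l.
  by rewrite Series_plus; try exact: ex_series_scal_l; rewrite !Series_scal_l.
- move=> x y; rewrite /ell2_inner /Cconj /=; congr pair.
    apply: Series_ext => k; ring.
  rewrite -Series_opp; apply: Series_ext => k; ring.
- move=> x; rewrite /ell2_inner.
  have -> : norm (x : ell2_CompleteNormedModule) = ell2_norm x by [].
  rewrite ell2_norm_sq /RtoC; congr pair.
    apply: Series_ext => k; rewrite Cmod2_alt /Cconj /Re /Im /=; ring.
  rewrite -(Rmult_0_l (Series (fun k => Cmod (ell2_coord x k) ^ 2))) -Series_scal_l.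
  apply: Series_ext => k; rewrite /Cconj /Im /=; ring.
Defined.

Definition opnorm (U V : NormedModule C_AbsRing) (T : U -> V) : R :=
  Sup (fun r => exists x, norm x <= 1 /\ r = norm (T x)).

(* The norm on V^n is the Hilbertian direct sum norm, so that for a Hilbert space
   H this is the norm of M_n(B(H)) = B(H^n). *)
Definition mx_opnorm (V : NormedModule C_AbsRing) (n : nat)
    (T : 'I_n -> 'I_n -> V -> V) : R :=
  Sup (fun r => exists h : 'I_n -> V,
    \big[Rplus/0]_(j < n) norm (h j) ^ 2 <= 1 /\
    r = sqrt (\big[Rplus/0]_(i < n)
                norm (\big[plus/zero]_(j < n) T i j (h j)) ^ 2)).

(* [is_linear] includes boundedness. *)
Lemma is_linear_subspace (H : HilbertSpace) :
  is_subspace (is_linear : funs H H -> Prop).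
Proof.
split.
- split=> [x y|k x|]; [by rewrite plus_zero_r | by rewrite scal_zero_r |].
  exists 1; split=> [|x]; first lra.
  by rewrite norm_zero Rmult_1_l; exact: norm_ge_0.
- move=> S T [Sp Ss [M [M0 hM]]] [Tp Ts [N [N0 hN]]]; split=> [x y|k x|].
  + change (plus (S (plus x y)) (T (plus x y))
      = plus (plus (S x) (T x)) (plus (S y) (T y))).
    rewrite Sp Tp -!plus_assoc; congr plus; rewrite !plus_assoc; congr plus.
    exact: plus_comm.
  + change (plus (S (scal k x)) (T (scal k x)) = scal k (plus (S x) (T x))).
    by rewrite Ss Ts scal_distr_l.
  + exists (M + N); split=> [|x]; first lra.
    change (norm (plus (S x) (T x)) <= (M + N) * norm x).
    apply: Rle_trans (norm_triangle _ _) _.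
    by have := hM x; have := hN x; lra.
- move=> k T [Tp Ts [M [M0 hM]]]; split=> [x y|l x|].
  + change (scal k (T (plus x y)) = plus (scal k (T x)) (scal k (T y))).
    by rewrite Tp scal_distr_l.
  + change (scal k (T (scal l x)) = scal l (scal k (T x))).
    rewrite Ts !scal_assoc; congr scal; exact: Cmult_comm.
  + exists ((Cmod k + 1) * M); split=> [|x].
      by apply: Rmult_lt_0_compat => //; have := Cmod_ge_0 k; lra.
    change (norm (scal k (T x)) <= (Cmod k + 1) * M * norm x).
    apply: Rle_trans (norm_scal _ _) _.
    have h1 := hM x; have h2 := Cmod_ge_0 k; have h3 := norm_ge_0 (T x).
    rewrite Rmult_assoc; apply: Rmult_le_compat => //; change (Cmod k <= Cmod k + 1); lra.
Qed.

Definition bounded_op (H : HilbertSpace) : ModuleSpace C_AbsRing :=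
  subspace (is_linear_subspace H).

Definition op_fun (H : HilbertSpace) (T : bounded_op H) : H -> H := proj1_sig T.

Lemma opnorm_ub (H : HilbertSpace) (T : bounded_op H) x :
  norm x <= 1 -> norm (op_fun T x) <= opnorm (op_fun T).
Proof.
have [_ _ [M [M0 hM]]] := proj2_sig T; move=> hx; rewrite /opnorm /Sup.
set E := fun r => _.
have [hub hlub] := Lub_Rbar_correct E.
have hEx : E (norm (op_fun T x)) by exists x.
have h1 := hub _ hEx.
have h2 : Rbar_le (Lub_Rbar E) M.
  apply: hlub => r [y [hy ->]] /=; apply: Rle_trans (hM y) _.
  by rewrite -{2}(Rmult_1_r M); apply: Rmult_le_compat_l; lra.
by case: (Lub_Rbar E) h1 h2.
Qed.

Lemma opnorm_lub (H : HilbertSpace) (T : bounded_op H) M :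
  (forall x, norm x <= 1 -> norm (op_fun T x) <= M) -> opnorm (op_fun T) <= M.
Proof.
move=> hM; rewrite /opnorm /Sup; set E := fun r => _.
have [hub hlub] := Lub_Rbar_correct E.
have hE0 : E (norm (op_fun T zero)) by exists zero; rewrite norm_zero; split; [lra|].
have h1 := hub _ hE0.
have h2 : Rbar_le (Lub_Rbar E) M by apply: hlub => r [y [hy ->]] /=; exact: hM.
by case: (Lub_Rbar E) h1 h2.
Qed.

Inductive lin_span (K : Ring) (V : ModuleSpace K) (S : V -> Prop) : V -> Prop :=
| span_gen x : S x -> lin_span S x
| span_zero : lin_span S zero
| span_plus x y : lin_span S x -> lin_span S y -> lin_span S (plus x y)
| span_scal k x : lin_span S x -> lin_span S (scal k x).

Definition closed_span (H : HilbertSpace) (S : bounded_op H -> Prop)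
    (T : bounded_op H) : Prop :=
  forall eps : posreal,
    exists T', lin_span S T' /\ opnorm (op_fun (minus T T')) < eps.

Lemma closed_span_subspace (H : HilbertSpace) (S : bounded_op H -> Prop) :
  is_subspace (closed_span S).
Proof.
split.
- move=> e; exists zero; split; first exact: span_zero.
  apply: Rle_lt_trans (cond_pos e); apply: opnorm_lub => x _.
  rewrite /minus plus_opp_r; change (norm (zero : H) <= 0).
  by rewrite norm_zero; lra.
- move=> T1 T2 h1 h2 e.
  have he : 0 < e / 2 by have := cond_pos e; lra.
  have [S1 [hS1 n1]] := h1 (mkposreal _ he).
  have [S2 [hS2 n2]] := h2 (mkposreal _ he).
  exists (plus S1 S2); split; first exact: span_plus.
  apply: (Rle_lt_trans _
    (opnorm (op_fun (minus T1 S1)) + opnorm (op_fun (minus T2 S2)))).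
    apply: opnorm_lub => x hx.
    have -> : minus (plus T1 T2) (plus S1 S2) = plus (minus T1 S1) (minus T2 S2).
      rewrite /minus opp_plus -!plus_assoc; congr plus.
      rewrite !plus_assoc; congr plus; exact: plus_comm.
    apply: Rle_trans
      (norm_triangle (op_fun (minus T1 S1) x) (op_fun (minus T2 S2) x)) _.
    by apply: Rplus_le_compat; exact: opnorm_ub.
  by move: n1 n2 => /=; lra.
- move=> k T h e.
  have hk : 0 < Cmod k + 1 by have := Cmod_ge_0 k; lra.
  have he : 0 < e / (Cmod k + 1) by apply: Rdiv_lt_0_compat => //; exact: cond_pos.
  have [T' [hT' n1]] := h (mkposreal _ he).
  exists (scal k T'); split; first exact: span_scal.
  apply: (Rle_lt_trans _ (Cmod k * opnorm (op_fun (minus T T')))).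
    apply: opnorm_lub => x hx; rewrite -scal_minus_distr_l.
    apply: Rle_trans (norm_scal k (op_fun (minus T T') x)) _.
    by apply: Rmult_le_compat_l; [exact: Cmod_ge_0 | exact: opnorm_ub].
  have hp : 0 <= opnorm (op_fun (minus T T')).
    apply: Rle_trans (opnorm_ub (minus T T') (x := zero) _); first exact: norm_ge_0.
    by rewrite norm_zero; lra.
  apply: (Rle_lt_trans _ ((Cmod k + 1) * opnorm (op_fun (minus T T')))); first nra.
  have -> : (e : R) = (Cmod k + 1) * (e / (Cmod k + 1)) by field; lra.
  exact: Rmult_lt_compat_l.
Qed.

Definition Mn (n : nat) (V : ModuleSpace C_AbsRing) : ModuleSpace C_AbsRing :=
  funs 'I_n (funs 'I_n V).

(* Only the data of an operator space: a complex vector space and the norms of its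
   matrix spaces M_n. Ruan's axioms are not fields, as every operator space below is
   given explicitly. *)
Record OpSpace := MkOpSpace {
  os_car :> ModuleSpace C_AbsRing;
  os_mnorm : forall n : nat, Mn n os_car -> R }.
Arguments os_mnorm : clear implicits.

Definition os_norm (X : OpSpace) (x : X) : R := os_mnorm X 1 (fun _ _ => x).

Definition concrete_os (H : HilbertSpace) (P : bounded_op H -> Prop)
    (hP : is_subspace P) : OpSpace :=
  @MkOpSpace (subspace hP)
    (fun n x => mx_opnorm (fun i j => op_fun (proj1_sig (x i j)))).

Definition ell2_delta_seq (i : nat) : nat -> C :=
  fun k => if k == i then RtoC 1 else RtoC 0.

Lemma ell2_delta_summable i : square_summable (ell2_delta_seq i).
Proof.
apply: (ex_series_ext (fun k => if k == i then 1 else 0)).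
  move=> k; rewrite /ell2_delta_seq; case: ifP => _.
    by change (1 = Cmod (RtoC 1) ^ 2); rewrite Cmod_1; ring.
  by change (0 = Cmod (RtoC 0) ^ 2); rewrite Cmod_0; ring.
have h0 k : 0 <= (if k == i then 1 else 0) by case: ifP => _; lra.
have hs n : sum_n (fun k => if k == i then 1 else 0) n = if (i <= n)%N then 1 else 0.
  elim: n => [|n IH]; first by rewrite sum_O leqn0 eq_sym.
  rewrite sum_Sn IH /plus /= [(i <= n.+1)%N]leq_eqVlt ltnS (eq_sym i).
  by case: eqP => [<-|_]; rewrite ?ltnn /=; [|case: ifP => _]; ring.
have hM n : sum_n (fun k => if k == i then 1 else 0) n <= 1.
  by rewrite hs; case: ifP => _; lra.
by have [] := ex_series_of_bounded h0 hM.
Qed.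

Definition ell2_delta (i : nat) : ell2 := exist _ _ (ell2_delta_summable i) : ell2_module.

Definition mat_unit_fun (i j : nat) (h : ell2) : ell2 :=
  scal (ell2_coord h j : C_AbsRing) (ell2_delta i).

Lemma mat_unit_linear i j : is_linear (mat_unit_fun i j).
Proof.
split=> [x y|k x|].
- exact: scal_distr_r.
- exact: (esym (scal_assoc _ _ _)).
- exists (norm (ell2_delta i) + 1); split=> [|x].
    by have := norm_ge_0 (ell2_delta i); lra.
  apply: Rle_trans (norm_scal _ _) _.
  have h1 : Cmod (ell2_coord x j) <= norm x by exact: ell2_coord_le.
  have h2 := Cmod_ge_0 (ell2_coord x j); have h3 := norm_ge_0 (ell2_delta i).
  change (Cmod (ell2_coord x j) * norm (ell2_delta i) <= (norm (ell2_delta i) + 1) * norm x).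
  nra.
Qed.

(* The matrix unit e_{i+1,j+1} in B(ell2): indices start at 0 here. *)
Definition mat_unit (i j : nat) : bounded_op ell2 := exist _ _ (mat_unit_linear i j).

Definition row_os : OpSpace :=
  concrete_os (closed_span_subspace (fun T => exists j, T = mat_unit 0 j)).

Definition col_os : OpSpace :=
  concrete_os (closed_span_subspace (fun T => exists i, T = mat_unit i 0)).

(* M_n(C) is normed as B(C^n). *)
Definition min_os (E : NormedModule C_AbsRing) : OpSpace :=
  @MkOpSpace E (fun n x => Sup (fun r =>
    exists phi : E -> C_NormedModule, is_linear phi /\ opnorm phi <= 1 /\
      r = @mx_opnorm C_NormedModule n (fun i j c => Cmult (phi (x i j)) c))).

Definition max_os (E : NormedModule C_AbsRing) : OpSpace :=
  @MkOpSpace E (fun n x => Sup (fun r =>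
    exists (H : HilbertSpace) (u : E -> bounded_op H),
      (forall a b, u (plus a b) = plus (u a) (u b)) /\
      (forall (k : C_AbsRing) a, u (scal k a) = scal k (u a)) /\
      (forall a, opnorm (op_fun (u a)) <= norm a) /\
      r = mx_opnorm (fun i j => op_fun (u (x i j))))).

Section Calderon.
Variables (W : ModuleSpace C_AbsRing) (N0 N1 : W -> R).

Definition sum_norm (w : W) : R :=
  Inf (fun r => exists a b, plus a b = w /\ r = N0 a + N1 b).

Definition closed_strip (z : C) : Prop := 0 <= Re z <= 1.
Definition open_strip (z : C) : Prop := 0 < Re z < 1.

Definition norm_cvg (N : W -> R) (T : Type) (F : (T -> Prop) -> Prop)
    (f : T -> W) (w : W) : Prop :=
  filterlim (fun t => N (minus (f t) w)) F (locally 0).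

(* The couple consists of two norms on the same space W, so that W is also the sum
   of the couple, normed by [sum_norm]. Functions are total on C, but only their
   values on the closed strip matter. Boundedness on the boundary lines is required
   rather than decay at infinity; both variants give the same interpolation norm. *)
Record calderon_fun (f : C -> W) : Prop := IsCalderonFun {
  cal_bounded : exists M, forall z, closed_strip z -> sum_norm (f z) <= M;
  cal_continuous : forall z, closed_strip z ->
    norm_cvg sum_norm (within closed_strip (locally z)) f (f z);
  cal_analytic : forall z, open_strip z -> exists d : W,
    norm_cvg sum_norm (locally' z)
      (fun w => scal (Cinv (Cminus w z) : C_AbsRing) (minus (f w) (f z))) d;
  cal_bounded0 : exists M, forall t : R, N0 (f (0, t)) <= M;
  cal_continuous0 : forall t : R,
    norm_cvg N0 (locally t) (fun s : R => f (0, s)) (f (0, t));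
  cal_bounded1 : exists M, forall t : R, N1 (f (1, t)) <= M;
  cal_continuous1 : forall t : R,
    norm_cvg N1 (locally t) (fun s : R => f (1, s)) (f (1, t)) }.

Definition calderon_fun_norm (f : C -> W) : R :=
  Rmax (Sup (fun r => exists t : R, r = N0 (f (0, t))))
       (Sup (fun r => exists t : R, r = N1 (f (1, t)))).

Definition calderon_norm (theta : R) (w : W) : R :=
  Inf (fun r => exists f, calderon_fun f /\ f (RtoC theta) = w /\
                          r = calderon_fun_norm f).

End Calderon.

Record linear_isometry_onto (V W : ModuleSpace C_AbsRing) (nV : V -> R) (nW : W -> R)
    (phi : V -> W) : Prop := IsLinearIsometryOnto {
  iso_plus : forall x y, phi (plus x y) = plus (phi x) (phi y);
  iso_scal : forall (k : C_AbsRing) x, phi (scal k x) = scal k (phi x);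
  iso_norm : forall x, nW (phi x) = nV x;
  iso_onto : forall y, exists x, phi x = y }.

(* (X0, X1)_theta, where X1 is identified with X0 through [phi : X0 -> X1]. *)
Definition interp_os (X0 X1 : OpSpace) (phi : X0 -> X1) (theta : R) : OpSpace :=
  @MkOpSpace X0 (fun n x =>
    let N0 := os_mnorm X0 n in
    let N1 := fun y : Mn n X0 => os_mnorm X1 n (fun i j => phi (y i j)) in
    if Req_EM_T theta 0 then N0 x
    else if Req_EM_T theta 1 then N1 x
    else calderon_norm N0 N1 theta x).

(* Orthonormality in a Hilbertian operator space: for the inner product carried
   over from a Hilbert space to which the space is linearly isometric (it does not
   depend on the isometry, by polarization). *)
Definition orthonormal (X : OpSpace) (n : nat) (e : 'I_n -> X) : Prop :=
  exists (K : HilbertSpace) (U : X -> K),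
    linear_isometry_onto (@os_norm X) (fun y : K => norm y) U /\
    forall i j, inner (U (e i)) (U (e j)) = if i == j then RtoC 1 else RtoC 0.

Definition first_column (X : OpSpace) (n : nat) (e : 'I_n -> X) : Mn n X :=
  fun i j => if (j == 0%N :> nat) then e i else zero.

(* [is_kappa n X k] states that kappa_n(X) is defined (there are orthonormal
   n-families and all of them give the same value) and is equal to k. *)
Definition is_kappa (n : nat) (X : OpSpace) (k : R) : Prop :=
  (exists e : 'I_n -> X, orthonormal e) /\
  forall e : 'I_n -> X, orthonormal e -> os_mnorm X n (first_column e) = k.

(* Main.v *)
Require Import Defs.
From HB Require Import structures.
From Stdlib Require Import Reals Lra FunctionalExtensionality ClassicalEpsilon Classical.
From mathcomp Require Import ssreflect ssrbool ssrfun eqtype ssrnat fintype bigop.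
From Coquelicot Require Import Coquelicot.

Local Open Scope R_scope.

(** Let [e] be an orthonormal [n]-family, [x] the matrix with first column [e], and
    [lam = ln n / 2]. Let [N0] and [N1] be the norms of the n-by-n matrices over the two
    end spaces. Both couples have the same three features:
    - [N0 x <= 1] and [N1 x <= sqrt n = exp lam];
    - every entry of a matrix [w] has norm at most [N0 w];
    - every column of [w] has Hilbert-Schmidt norm at most [N1 w].
    The first one bounds the interpolation norm of [x] above by [exp (lam * theta)], by means
    of the function [z |-> exp (lam * (theta - z)) x]. The other two concern the functional
    [psi w = (1 / n) sum_i <w_i0, e_i>]: it satisfies [|psi| <= N0] since it is an average of
    entries paired with unit vectors, [exp lam |psi| <= N1] by the Cauchy-Schwarz inequality
    for sums of [n] terms, and [psi x = 1]. For an admissible function [f] with value [x]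
    at [theta], the three lines theorem for [psi o f] gives the bound from below, again
    [exp (lam * theta) = n ^ (theta / 2)]. These two bounds are [calderon_norm_le] and
    [calderon_norm_ge], and [kappa_interp] combines them. Used for 1-by-1 matrices and
    [lam = 0], they also show that the interpolation space is isometric to the end spaces,
    so that its orthonormal families are, by polarization, those of the first end space.

    The three lines theorem is proved for functions that are merely complex differentiable at
    every point, with no continuity of the derivative. Goursat's bisection argument
    ([goursat]) is carried out for a real differential form [P dx + Q dy]; applied in
    logarithmic polar coordinates, it gives the mean value property on circles
    ([mean_value]) without any Cauchy integral. The maximum principle follows by comparing
    a maximum of a strictly subharmonic perturbation of [|g|] with its means over a small
    circle.

    For the four spaces, the features above come from two facts. Bessel's inequality for a
    bounded functional, [sum_i |phi (e i)| ^ 2 <= |phi| ^ 2] ([bessel]), bounds the columns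
    over the row space and over the minimal structure. The column operators
    [h |-> h_0 x] are the elements of the column space and, as [x] varies, a contraction into
    the bounded operators that is available in the definition of the maximal structure;
    evaluating them at the first basis vector recovers [x], hence the Hilbert-Schmidt bound. *)

(** * Bisection of rectangles *)

Lemma nested_intervals (a b : nat -> R) :
  (forall k, a k <= a k.+1) -> (forall k, b k.+1 <= b k) ->
  (forall k, a k <= b k) -> exists p, forall k, a k <= p <= b k.
Proof.
move=> ha hb hab.
have ma j k : a j <= a (k + j)%N.
  by elim: k => [|k IH]; [rewrite add0n; lra | rewrite addSn; have := ha (k + j)%N; lra].
have mb j k : b (k + j)%N <= b j.
  by elim: k => [|k IH]; [rewrite add0n; lra | rewrite addSn; have := hb (k + j)%N; lra].
have key j k : a j <= b k.
  by have := ma j k; have := mb k j; have := hab (k + j)%N; rewrite addnC; lra.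
have [||p [hub hlub]] := completeness (fun r => exists k, r = a k).
- by exists (b 0%N) => r [k ->]; exact: key.
- by exists (a 0%N), 0%N.
exists p => k; split; first by apply: hub; exists k.
by apply: hlub => r [j ->].
Qed.

(** The descent behind both Goursat's lemma and the attainment of maxima: a property of
    rectangles that always passes to one of the four quarters holds for arbitrarily small
    rectangles around some point. *)
Lemma quad_bisection (P : R -> R -> R -> R -> Prop) (a b c d : R) :
  a <= b -> c <= d -> P a b c d ->
  (forall a b c d, a <= b -> c <= d -> P a b c d ->
     [\/ P a ((a + b) / 2) c ((c + d) / 2), P ((a + b) / 2) b c ((c + d) / 2),
         P a ((a + b) / 2) ((c + d) / 2) d | P ((a + b) / 2) b ((c + d) / 2) d]) ->
  exists p q : R, a <= p <= b /\ c <= q <= d /\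
  forall delta : posreal, exists a' b' c' d' : R,
    P a' b' c' d' /\ a <= a' <= p /\ p <= b' <= b /\ c <= c' <= q /\ q <= d' <= d /\
    b' - a' < delta /\ d' - c' < delta.
Proof.
move=> hab hcd h0 hstep.
pose step (s : (R * R) * (R * R)) :=
  let: ((a, b), (c, d)) := s in let p := (a + b) / 2 in let q := (c + d) / 2 in
  if excluded_middle_informative (P a p c q) then ((a, p), (c, q)) else
  if excluded_middle_informative (P p b c q) then ((p, b), (c, q)) else
  if excluded_middle_informative (P a p q d) then ((a, p), (q, d)) else ((p, b), (q, d)).
pose s k := iter k step ((a, b), (c, d)).
have inv k : let: ((a', b'), (c', d')) := s k in
    P a' b' c' d' /\ (a <= a' <= b' /\ b' <= b) /\ (c <= c' <= d' /\ d' <= d) /\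
    b' - a' = (b - a) / 2 ^ k /\ d' - c' = (d - c) / 2 ^ k.
  elim: k => [|k]; first by rewrite /s /=; repeat split => //; lra.
  rewrite /s iterS -/(s k); case: (s k) => [[a' b'] [c' d']] [hP [ha [hc [ea ec]]]].
  have hp : 0 < 2 ^ k by apply: pow_lt; lra.
  have -> : 2 ^ k.+1 = 2 * 2 ^ k by [].
  have -> : (b - a) / (2 * 2 ^ k) = (b' - a') / 2 by rewrite ea; field; lra.
  have -> : (d - c) / (2 * 2 ^ k) = (d' - c') / 2 by rewrite ec; field; lra.
  rewrite /step.
  case: excluded_middle_informative => [hh|n1]; first by repeat split => //; lra.
  case: excluded_middle_informative => [hh|n2]; first by repeat split => //; lra.
  case: excluded_middle_informative => [hh|n3]; first by repeat split => //; lra.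
  have hh : P ((a' + b') / 2) b' ((c' + d') / 2) d'.
    by case: (hstep a' b' c' d' _ _ hP) => //; lra.
  by repeat split => //; lra.
have mono k : let: ((a1, b1), (c1, d1)) := s k in let: ((a2, b2), (c2, d2)) := s k.+1 in
    a1 <= a2 /\ b2 <= b1 /\ c1 <= c2 /\ d2 <= d1.
  have := inv k; rewrite /s iterS -/(s k).
  case: (s k) => [[a' b'] [c' d']] [_ [ha [hc _]]]; rewrite /step.
  by do 3?case: excluded_middle_informative => ? /=; lra.
clearbody s.
have [p hp] : exists p, forall k, (s k).1.1 <= p <= (s k).1.2.
  apply: nested_intervals => k; have := mono k; have := inv k.
  - by case: (s k) => [[? ?] [? ?]]; case: (s k.+1) => [[? ?] [? ?]] /=; lra.
  - by case: (s k) => [[? ?] [? ?]]; case: (s k.+1) => [[? ?] [? ?]] /=; lra.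
  - by case: (s k) => [[? ?] [? ?]] /= hh _; lra.
have [q hq] : exists q, forall k, (s k).2.1 <= q <= (s k).2.2.
  apply: nested_intervals => k; have := mono k; have := inv k.
  - by case: (s k) => [[? ?] [? ?]]; case: (s k.+1) => [[? ?] [? ?]] /=; lra.
  - by case: (s k) => [[? ?] [? ?]]; case: (s k.+1) => [[? ?] [? ?]] /=; lra.
  - by case: (s k) => [[? ?] [? ?]] /= hh _; lra.
exists p, q; split; first by have := hp 0%N; have := inv 0%N; case: (s 0%N) => [[? ?] [? ?]] /=; lra.
split; first by have := hq 0%N; have := inv 0%N; case: (s 0%N) => [[? ?] [? ?]] /=; lra.
move=> delta.
have hlarge : exists k, (b - a) + (d - c) < delta * 2 ^ k.
  have hdel := cond_pos delta.
  have [k hk] := Pow_x_infinity 2 ltac:(rewrite Rabs_pos_eq; lra) (((b - a) + (d - c) + 1) / delta).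
  exists k; have := hk k (le_n _); rewrite Rabs_pos_eq; last by apply: pow_le; lra.
  move=> h.
  have : ((b - a) + (d - c) + 1) / delta * delta <= 2 ^ k * delta.
    by apply: Rmult_le_compat_r; lra.
  have -> : ((b - a) + (d - c) + 1) / delta * delta = (b - a) + (d - c) + 1 by field; lra.
  lra.
have [k hk] := hlarge; have := inv k; have := hp k; have := hq k.
case: (s k) => [[a' b'] [c' d']] /= hq' hp' [hP [ha [hc [ea ec]]]].
exists a', b', c', d'; do 5!(split=> //; try lra).
have h2 : 0 < 2 ^ k by apply: pow_lt; lra.
have hlt x : x < delta * 2 ^ k -> x / 2 ^ k < delta.
  by move=> hx; apply/Rlt_div_l.
by rewrite ea ec; split; apply: hlt; lra.
Qed.

(** Being as good as the whole rectangle for the values of [F] passes to a quarter, so it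
    concentrates at a point, where upper semicontinuity makes [F] maximal. *)
Lemma rectangle_max (F : R -> R -> R) (a b c d : R) : a <= b -> c <= d ->
  (forall x y, a <= x <= b -> c <= y <= d -> forall eta, 0 < eta -> exists delta : posreal,
     forall x' y', a <= x' <= b -> c <= y' <= d ->
       Rabs (x' - x) < delta -> Rabs (y' - y) < delta -> F x' y' < F x y + eta) ->
  exists p q, a <= p <= b /\ c <= q <= d /\
    forall x y, a <= x <= b -> c <= y <= d -> F x y <= F p q.
Proof.
move=> hab hcd husc.
pose good a' b' c' d' := forall x y, a <= x <= b -> c <= y <= d ->
  exists x' y', (a' <= x' <= b' /\ c' <= y' <= d') /\ F x y <= F x' y'.
have bad a' b' c' d' : ~ good a' b' c' d' -> exists x y, a <= x <= b /\ c <= y <= d /\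
    forall x' y', a' <= x' <= b' -> c' <= y' <= d' -> F x' y' < F x y.
  move=> h; apply: NNPP => h'; apply: h => x y hx hy; apply: NNPP => h2; apply: h'.
  exists x, y; split=> //; split=> // x' y' hx' hy'.
  by apply: Rnot_le_lt => hle; apply: h2; exists x', y'.
have dominate x1 y1 x2 y2 : a <= x1 <= b -> c <= y1 <= d -> a <= x2 <= b -> c <= y2 <= d ->
    exists x y, a <= x <= b /\ c <= y <= d /\ F x1 y1 <= F x y /\ F x2 y2 <= F x y.
  move=> *; case: (Rle_lt_dec (F x1 y1) (F x2 y2)) => h.
    by exists x2, y2; do 3!split => //; lra.
  by exists x1, y1; do 3!split => //; lra.
have [|a' b' c' d' ab cd hg|p [q [hp [hq hloc]]]] := quad_bisection good a b c d hab hcd.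
- by move=> x y hx hy; exists x, y; split=> //; lra.
- apply: NNPP => hno.
  have [|x1 [y1 [i1 [j1 k1]]]] := bad a' ((a' + b') / 2) c' ((c' + d') / 2).
    by move=> h; apply: hno; apply: Or41.
  have [|x2 [y2 [i2 [j2 k2]]]] := bad ((a' + b') / 2) b' c' ((c' + d') / 2).
    by move=> h; apply: hno; apply: Or42.
  have [|x3 [y3 [i3 [j3 k3]]]] := bad a' ((a' + b') / 2) ((c' + d') / 2) d'.
    by move=> h; apply: hno; apply: Or43.
  have [|x4 [y4 [i4 [j4 k4]]]] := bad ((a' + b') / 2) b' ((c' + d') / 2) d'.
    by move=> h; apply: hno; apply: Or44.
  have [x5 [y5 [i5 [j5 [m1 m2]]]]] := dominate _ _ _ _ i1 j1 i2 j2.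
  have [x6 [y6 [i6 [j6 [m3 m4]]]]] := dominate _ _ _ _ i3 j3 i4 j4.
  have [x7 [y7 [i7 [j7 [m5 m6]]]]] := dominate _ _ _ _ i5 j5 i6 j6.
  have [x [y [[hx hy] hF]]] := hg x7 y7 i7 j7.
  case: (Rle_lt_dec x ((a' + b') / 2)) => cx; case: (Rle_lt_dec y ((c' + d') / 2)) => cy.
  + by have := k1 x y ltac:(lra) ltac:(lra); lra.
  + by have := k3 x y ltac:(lra) ltac:(lra); lra.
  + by have := k2 x y ltac:(lra) ltac:(lra); lra.
  + by have := k4 x y ltac:(lra) ltac:(lra); lra.
exists p, q; split=> //; split=> // x y hx hy.
apply: Rnot_lt_le => hlt.
have [dl hdl] := husc p q hp hq (F x y - F p q) ltac:(lra).
have [a' [b' [c' [d' [hg [ha [hb [hc [hd' [w1 w2]]]]]]]]]] := hloc dl.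
have [x' [y' [[hx' hy'] hF]]] := hg x y hx hy.
have := hdl x' y' ltac:(lra) ltac:(lra) ltac:(apply: Rabs_def1; lra) ltac:(apply: Rabs_def1; lra).
lra.
Qed.

(** * Goursat's lemma *)

Lemma differentiable_continuous_l (f : R -> R -> R) (x y l m : R) :
  differentiable_pt_lim f x y l m -> continuous (fun t => f t y) x.
Proof.
move=> h; apply/continuity_pt_filterlim/derivable_continuous_pt.
exists (l * 1 + m * 0); apply: (derivable_pt_lim_comp_2d f id (fun _ => y)) => //.
  exact: derivable_pt_lim_id.
exact: derivable_pt_lim_const.
Qed.

Lemma differentiable_continuous_r (f : R -> R -> R) (x y l m : R) :
  differentiable_pt_lim f x y l m -> continuous (f x) y.
Proof.
move=> h; apply/continuity_pt_filterlim/derivable_continuous_pt.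
exists (l * 0 + m * 1); apply: (derivable_pt_lim_comp_2d f (fun _ => x) id) => //.
  exact: derivable_pt_lim_const.
exact: derivable_pt_lim_id.
Qed.

(** The boundary integral of [P dx + Q dy], with opposite sides already paired: in this form
    a common affine part of [P] and [Q] cancels under the integral signs. *)
Definition circulation (P Q : R -> R -> R) (a b c d : R) : R :=
  RInt (fun x => P x c - P x d) a b + RInt (fun y => Q b y - Q a y) c d.

Definition continuous_on_segment (f : R -> R) (a b : R) :=
  forall x, a <= x <= b -> continuous f x.

Lemma continuous_segment_ex_RInt (f : R -> R) a b :
  a <= b -> continuous_on_segment f a b -> ex_RInt f a b.
Proof. by move=> hab hf; apply: ex_RInt_continuous => x; rewrite Rmin_left // Rmax_right //; exact: hf. Qed.

Section Goursat.
Variables (P Q : R -> R -> R) (a b c d : R).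
Hypotheses (hab : a <= b) (hcd : c <= d).
Hypothesis hP : forall y, c <= y <= d -> continuous_on_segment (fun x => P x y) a b.
Hypothesis hQ : forall x, a <= x <= b -> continuous_on_segment (Q x) c d.

Lemma ex_RInt_horizontal y1 y2 u v : c <= y1 <= d -> c <= y2 <= d -> a <= u -> u <= v -> v <= b ->
  ex_RInt (fun x => P x y1 - P x y2) u v.
Proof.
move=> h1 h2 au uv vb; apply: (ex_RInt_minus (fun x => P x y1) (fun x => P x y2)).
- by apply: continuous_segment_ex_RInt => // x hx; apply: hP => //; lra.
- by apply: continuous_segment_ex_RInt => // x hx; apply: hP => //; lra.
Qed.

Lemma ex_RInt_vertical x1 x2 u v : a <= x1 <= b -> a <= x2 <= b -> c <= u -> u <= v -> v <= d ->
  ex_RInt (fun y => Q x1 y - Q x2 y) u v.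
Proof.
move=> h1 h2 au uv vb; apply: (ex_RInt_minus (Q x1) (Q x2)).
- by apply: continuous_segment_ex_RInt => // x hx; apply: hQ => //; lra.
- by apply: continuous_segment_ex_RInt => // x hx; apply: hQ => //; lra.
Qed.

Lemma circulation_quarters p q : a <= p <= b -> c <= q <= d ->
  circulation P Q a b c d =
  circulation P Q a p c q + circulation P Q p b c q
  + (circulation P Q a p q d + circulation P Q p b q d).
Proof.
move=> hp hq; rewrite /circulation.
rewrite -(RInt_Chasles (fun x => P x c - P x d) a p b); try by apply: ex_RInt_horizontal; lra.
rewrite -(RInt_Chasles (fun y => Q b y - Q a y) c q d); try by apply: ex_RInt_vertical; lra.
have splitP u v : a <= u -> u <= v -> v <= b -> RInt (fun x => P x c - P x d) u v =
    RInt (fun x => P x c - P x q) u v + RInt (fun x => P x q - P x d) u v.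
  move=> au uv vb.
  rewrite -[RHS](RInt_plus (V := R_CompleteNormedModule) (fun x => P x c - P x q) (fun x => P x q - P x d)); try by apply: ex_RInt_horizontal; lra.
  by apply: RInt_ext => x _; rewrite /plus /=; ring.
have splitQ u v : c <= u -> u <= v -> v <= d -> RInt (fun y => Q b y - Q a y) u v =
    RInt (fun y => Q b y - Q p y) u v + RInt (fun y => Q p y - Q a y) u v.
  move=> au uv vb.
  rewrite -[RHS](RInt_plus (V := R_CompleteNormedModule) (fun x => Q b x - Q p x) (fun x => Q p x - Q a x)); try by apply: ex_RInt_vertical; lra.
  by apply: RInt_ext => x _; rewrite /plus /=; ring.
rewrite !splitP ?splitQ; try lra.
rewrite /plus /=; ring.
Qed.

(** To first order [P] contributes [m (c - d) (b - a)] and [Q] contributes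
    [m (b - a) (d - c)], where [m] is the common value of [dP/dy] and [dQ/dx]. *)
Lemma circulation_le m eta : 0 <= eta ->
  (forall x, a <= x <= b -> Rabs (P x c - P x d - m * (c - d)) <= eta) ->
  (forall y, c <= y <= d -> Rabs (Q b y - Q a y - m * (b - a)) <= eta) ->
  Rabs (circulation P Q a b c d) <= eta * ((b - a) + (d - c)).
Proof.
move=> eta0 h1 h2.
have e1 : RInt (fun x => P x c - P x d - m * (c - d)) a b
    = RInt (fun x => P x c - P x d) a b - (b - a) * (m * (c - d)).
  rewrite (RInt_minus (V := R_CompleteNormedModule) (fun x => P x c - P x d)).
  + by rewrite RInt_const.
  + by apply: ex_RInt_horizontal; lra.
  + exact: ex_RInt_const.
have e2 : RInt (fun y => Q b y - Q a y - m * (b - a)) c d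
    = RInt (fun y => Q b y - Q a y) c d - (d - c) * (m * (b - a)).
  rewrite (RInt_minus (V := R_CompleteNormedModule) (fun y => Q b y - Q a y)).
  + by rewrite RInt_const.
  + by apply: ex_RInt_vertical; lra.
  + exact: ex_RInt_const.
have b1 := abs_RInt_le_const (fun x => P x c - P x d - m * (c - d)) a b eta hab.
have b2 := abs_RInt_le_const (fun y => Q b y - Q a y - m * (b - a)) c d eta hcd.
have -> : circulation P Q a b c d =
   RInt (fun x => P x c - P x d - m * (c - d)) a b
   + RInt (fun y => Q b y - Q a y - m * (b - a)) c d.
  by rewrite e1 e2 /circulation; ring.
apply: Rle_trans (Rabs_triang _ _) _.
have := b1 _ h1; have := b2 _ h2.
have x1 : ex_RInt (fun x => P x c - P x d - m * (c - d)) a b.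
  apply: (ex_RInt_minus (fun x => P x c - P x d)); last exact: ex_RInt_const.
  by apply: ex_RInt_horizontal; lra.
have x2 : ex_RInt (fun y => Q b y - Q a y - m * (b - a)) c d.
  apply: (ex_RInt_minus (fun y => Q b y - Q a y)); last exact: ex_RInt_const.
  by apply: ex_RInt_vertical; lra.
move=> /(_ x2) r1 /(_ x1) r2; lra.
Qed.

End Goursat.

(** A circulation larger than [eps] times the squared semiperimeter passes to a quarter,
    because semiperimeters halve. Near the limit point, differentiability bounds the
    circulation by that same quantity. *)
Lemma goursat (P Q : R -> R -> R) (a b c d : R) : a <= b -> c <= d ->
  (forall x y, a <= x <= b -> c <= y <= d -> exists l m k : R,
     differentiable_pt_lim P x y l m /\ differentiable_pt_lim Q x y m k) ->
  circulation P Q a b c d = 0.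
Proof.
move=> hab hcd hd.
have hP a' b' c' d' : a <= a' -> b' <= b -> c <= c' -> d' <= d ->
    forall y, c' <= y <= d' -> continuous_on_segment (fun x => P x y) a' b'.
  move=> ha hb hc hd' y hy x hx; have [||l [m [k [h _]]]] := hd x y; try lra.
  exact: (differentiable_continuous_l _ _ _ _ _ h).
have hQ a' b' c' d' : a <= a' -> b' <= b -> c <= c' -> d' <= d ->
    forall x, a' <= x <= b' -> continuous_on_segment (Q x) c' d'.
  move=> ha hb hc hd' x hx y hy; have [||l [m [k [_ h]]]] := hd x y; try lra.
  exact: (differentiable_continuous_r _ _ _ _ _ h).
apply: Rabs_eq_0; apply: Rle_antisym; last exact: Rabs_pos.
set S := (b - a) + (d - c).
suff key eps : 0 < eps -> Rabs (circulation P Q a b c d) <= eps * S ^ 2.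
  case: (Rle_lt_dec (Rabs (circulation P Q a b c d)) 0) => // hpos.
  have := pow2_ge_0 S; set A := Rabs _ in key hpos *; move=> hS.
  have := key (A / 2 / (S ^ 2 + 1)) ltac:(apply: Rdiv_lt_0_compat; lra).
  have : A / 2 / (S ^ 2 + 1) * S ^ 2 <= A / 2 / (S ^ 2 + 1) * (S ^ 2 + 1).
    by apply: Rmult_le_compat_l; [apply: Rlt_le; apply: Rdiv_lt_0_compat; lra | lra].
  have -> : A / 2 / (S ^ 2 + 1) * (S ^ 2 + 1) = A / 2 by field; lra.
  lra.
move=> eps0; case: (Rle_lt_dec (Rabs (circulation P Q a b c d)) (eps * S ^ 2)) => // hgt.
(* The squared semiperimeter replaces the area, so that flat rectangles need no care. *)
pose bad a' b' c' d' := a <= a' /\ b' <= b /\ c <= c' /\ d' <= d /\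
  eps * ((b' - a') + (d' - c')) ^ 2 < Rabs (circulation P Q a' b' c' d').
have [|a' b' c' d' ab cd [ha [hb [hc [hd' hbad]]]]|p [q [hp [hq hloc]]]] :=
    quad_bisection bad a b c d hab hcd.
- by do 4!(split; first lra).
- have [mx my] : a' <= (a' + b') / 2 <= b' /\ c' <= (c' + d') / 2 <= d' by lra.
  rewrite (circulation_quarters P Q a' b' c' d' ab cd (hP _ _ _ _ ha hb hc hd') (hQ _ _ _ _ ha hb hc hd') _ _ mx my) in hbad.
  set x := (a' + b') / 2 in mx hbad *; set y := (c' + d') / 2 in my hbad *.
  set I1 := circulation P Q a' x c' y in hbad *; set I2 := circulation P Q x b' c' y in hbad *.
  set I3 := circulation P Q a' x y d' in hbad *; set I4 := circulation P Q x b' y d' in hbad *.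
  have t1 := Rabs_triang I1 I2; have t2 := Rabs_triang I3 I4.
  have t3 := Rabs_triang (I1 + I2) (I3 + I4).
  have quarter w h : w = (b' - a') / 2 -> h = (d' - c') / 2 ->
    eps * (w + h) ^ 2 = eps * ((b' - a') + (d' - c')) ^ 2 / 4 by move=> -> ->; field.
  have q1 := quarter (x - a') (y - c') ltac:(rewrite /x; lra) ltac:(rewrite /y; lra).
  have q2 := quarter (b' - x) (y - c') ltac:(rewrite /x; lra) ltac:(rewrite /y; lra).
  have q3 := quarter (x - a') (d' - y) ltac:(rewrite /x; lra) ltac:(rewrite /y; lra).
  have q4 := quarter (b' - x) (d' - y) ltac:(rewrite /x; lra) ltac:(rewrite /y; lra).
  case: (Rlt_le_dec (eps * ((x - a') + (y - c')) ^ 2) (Rabs I1)) => n1.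
    by apply: Or41; do 4!(split; first lra).
  case: (Rlt_le_dec (eps * ((b' - x) + (y - c')) ^ 2) (Rabs I2)) => n2.
    by apply: Or42; do 4!(split; first lra).
  case: (Rlt_le_dec (eps * ((x - a') + (d' - y)) ^ 2) (Rabs I3)) => n3.
    by apply: Or43; do 4!(split; first lra).
  case: (Rlt_le_dec (eps * ((b' - x) + (d' - y)) ^ 2) (Rabs I4)) => n4.
    by apply: Or44; do 4!(split; first lra).
  lra.
have [l [m [k [dP dQ]]]] := hd p q hp hq.
have he : 0 < eps / 2 by lra.
have [dl1 h1] := dP (mkposreal _ he); have [dl2 h2] := dQ (mkposreal _ he).
have [a' [b' [c' [d' [[_ [_ [_ [_ hbad]]]] [ha [hb [hc [hd' [w1 w2]]]]]]]]]] :=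
  hloc (mkposreal _ (Rmin_stable_in_posreal dl1 dl2)).
have := Rmin_l dl1 dl2; have := Rmin_r dl1 dl2; move: w1 w2 => /= w1 w2 m1 m2.
set s := (b' - a') + (d' - c') in hbad.
have near x y : a' <= x <= b' -> c' <= y <= d' ->
    [/\ Rabs (x - p) < dl1, Rabs (y - q) < dl1, Rabs (x - p) < dl2, Rabs (y - q) < dl2
      & Rmax (Rabs (x - p)) (Rabs (y - q)) <= s].
  move=> hx hy; split; try (apply: Rabs_def1; lra).
  by apply: Rmax_lub; apply: Rabs_le; rewrite /s; lra.
have bound (f : R -> R -> R) g1 g2 x1 y1 x2 y2 (dl : posreal) :
    (forall u v, Rabs (u - p) < dl -> Rabs (v - q) < dl ->
       Rabs (f u v - f p q - (g1 * (u - p) + g2 * (v - q))) <=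
       eps / 2 * Rmax (Rabs (u - p)) (Rabs (v - q))) ->
    Rabs (x1 - p) < dl -> Rabs (y1 - q) < dl -> Rabs (x2 - p) < dl -> Rabs (y2 - q) < dl ->
    Rmax (Rabs (x1 - p)) (Rabs (y1 - q)) <= s -> Rmax (Rabs (x2 - p)) (Rabs (y2 - q)) <= s ->
    Rabs (f x1 y1 - f x2 y2 - (g1 * (x1 - x2) + g2 * (y1 - y2))) <= eps * s.
  move=> h i1 i2 i3 i4 s1 s2; have := h _ _ i1 i2; have := h _ _ i3 i4.
  set e1 := f x1 y1 - _ - _; set e2 := f x2 y2 - _ - _ => r2 r1.
  have -> : f x1 y1 - f x2 y2 - (g1 * (x1 - x2) + g2 * (y1 - y2)) = e1 - e2.
    by rewrite /e1 /e2; ring.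
  have := Rabs_triang e1 (- e2); rewrite Rabs_Ropp -/(e1 - e2).
  have := Rmult_le_compat_l _ _ _ (Rlt_le _ _ he) s1.
  have := Rmult_le_compat_l _ _ _ (Rlt_le _ _ he) s2.
  lra.
have s0 : 0 <= s by rewrite /s; lra.
have := circulation_le P Q a' b' c' d' ltac:(lra) ltac:(lra)
  (hP a' b' c' d' ltac:(lra) ltac:(lra) ltac:(lra) ltac:(lra))
  (hQ a' b' c' d' ltac:(lra) ltac:(lra) ltac:(lra) ltac:(lra)) m (eps * s)
  ltac:(apply: Rmult_le_pos; lra).
move=> hle; exfalso; move: hbad; apply: Rle_not_lt.
have -> : eps * s ^ 2 = eps * s * ((b' - a') + (d' - c')) by rewrite /s; ring.
apply: hle => [x hx|y hy].
- have [i1 i2 _ _ i5] := near x c' hx ltac:(lra).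
  have [j1 j2 _ _ j5] := near x d' hx ltac:(lra).
  have := bound P l m x c' x d' dl1 h1 i1 i2 j1 j2 i5 j5.
  by have -> : l * (x - x) + m * (c' - d') = m * (c' - d') by ring.
- have [_ _ i1 i2 i5] := near b' y ltac:(lra) hy.
  have [_ _ j1 j2 j5] := near a' y ltac:(lra) hy.
  have := bound Q m k b' y a' y dl2 h2 i1 i2 j1 j2 i5 j5.
  by have -> : m * (b' - a') + k * (y - y) = m * (b' - a') by ring.
Qed.

(** * Mean values on circles *)

(** Differentiability of [u + i v] at [(x, y)], with derivative [p + i q]. *)
Definition cauchy_riemann (u v : R -> R -> R) (x y : R) : Prop :=
  exists p q, differentiable_pt_lim u x y p (- q) /\ differentiable_pt_lim v x y q p.

Lemma differentiable_separated (c : R) (f g : R -> R) (s t f' g' : R) :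
  is_derive f s f' -> is_derive g t g' ->
  differentiable_pt_lim (fun s t => c + f s * g t) s t (f' * g t) (f s * g').
Proof.
move=> hf hg; apply/filterdiff_differentiable_pt_lim.
apply: filterdiff_ext_lin.
  apply: (filterdiff_plus_fct (fun _ : R * R => c) (fun w : R * R => f (fst w) * g (snd w))).
    exact: filterdiff_const.
  apply: (filterdiff_mult_fct (fun w : R * R => f (fst w)) (fun w => g (snd w))).
  - exact: Rmult_comm.
  - apply: (filterdiff_comp' (fun w : R * R => fst w) f); last exact: hf.
    exact: filterdiff_linear is_linear_fst.
  - apply: (filterdiff_comp' (fun w : R * R => snd w) g); last exact: hg.
    exact: filterdiff_linear is_linear_snd.
by move=> [y1 y2]; rewrite /plus /mult /zero /scal /= /mult /=; ring.
Qed.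

Lemma sum_sq_polar r t : (r * cos t) ^ 2 + (r * sin t) ^ 2 = r ^ 2.
Proof. have := sin2_cos2 t; rewrite /Rsqr => h; transitivity (r ^ 2 * (sin t * sin t + cos t * cos t)); [ring | rewrite h; ring]. Qed.

Section MeanValue.
Variables (u v : R -> R -> R) (x0 y0 rho : R).
Hypothesis rho_gt0 : 0 < rho.
Hypothesis hCR : forall x y, (x - x0) ^ 2 + (y - y0) ^ 2 <= rho ^ 2 -> cauchy_riemann u v x y.

(* Pulling back by [w |-> z0 + exp w] turns circles into vertical segments of length
   [2 pi], and [Im (G dw)] into the form [v ds + u dt]. *)
Let circle_pt (f : R -> R -> R) s t := f (x0 + exp s * cos t) (y0 + exp s * sin t).

Lemma circle_pt_differentiable s t : s <= ln rho -> exists l m k,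
  differentiable_pt_lim (circle_pt v) s t l m /\ differentiable_pt_lim (circle_pt u) s t m k.
Proof.
move=> hs.
have es : exp s <= rho.
  by rewrite -(exp_ln rho) //; case: hs => [h|->]; [left; apply: exp_increasing | right].
have [|p [q [hu hv]]] := hCR (x0 + exp s * cos t) (y0 + exp s * sin t).
  rewrite !(Rplus_comm _ (exp s * _)) /Rminus !Rplus_assoc !Rplus_opp_r !Rplus_0_r sum_sq_polar.
  by apply: pow_incr; have := exp_pos s; lra.
have hX := differentiable_separated x0 exp cos s t _ _ (is_derive_exp s) (is_derive_cos t).
have hY := differentiable_separated y0 exp sin s t _ _ (is_derive_exp s) (is_derive_sin t).
have dv := differentiable_pt_lim_comp _ _ _ _ _ _ _ _ _ _ _ hv hX hY.
have du := differentiable_pt_lim_comp _ _ _ _ _ _ _ _ _ _ _ hu hX hY.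
exists (q * (exp s * cos t) + p * (exp s * sin t)), (p * (exp s * cos t) + - q * (exp s * sin t)),
  (p * (exp s * - sin t) + - q * (exp s * cos t)); split => //.
by move: dv; have -> : q * (exp s * - sin t) + p * (exp s * cos t)
  = p * (exp s * cos t) + - q * (exp s * sin t) by ring.
Qed.

Lemma circle_ex_RInt s : s <= ln rho -> ex_RInt (circle_pt u s) 0 (2 * PI).
Proof.
move=> hs; apply: ex_RInt_continuous => t _.
have [l [m [k [_ h]]]] := circle_pt_differentiable s t hs.
exact: differentiable_continuous_r h.
Qed.

(** Periodicity in [t] makes the two horizontal sides cancel in the circulation. *)
Lemma circle_mean_indep s : s <= ln rho ->
  RInt (circle_pt u (ln rho)) 0 (2 * PI) = RInt (circle_pt u s) 0 (2 * PI).
Proof.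
move=> hs; have hpi := PI_RGT_0.
have := goursat (circle_pt v) (circle_pt u) s (ln rho) 0 (2 * PI) hs ltac:(lra)
  (fun x y hx _ => circle_pt_differentiable x y (proj2 hx)).
rewrite /circulation (RInt_ext _ (fun _ => 0)); last first.
  by move=> x _; rewrite /circle_pt cos_2PI sin_2PI cos_0 sin_0; rewrite ?/minus; lra.
rewrite RInt_const scal_zero_r.
rewrite (RInt_minus (V := R_CompleteNormedModule)); try by apply: circle_ex_RInt; lra.
by rewrite /minus /plus /opp /zero /=; lra.
Qed.

(** The circular means do not depend on the radius, and tend to the central value. *)
Lemma circle_mean : RInt (circle_pt u (ln rho)) 0 (2 * PI) = 2 * PI * u x0 y0.
Proof.
have hpi := PI_RGT_0.
set A := RInt _ _ _.
suff key eps : 0 < eps -> Rabs (A - 2 * PI * u x0 y0) <= 2 * PI * eps.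
  apply: Rminus_diag_uniq; apply: Rabs_eq_0; apply: Rle_antisym; last exact: Rabs_pos.
  set B := Rabs _ in key *; case: (Rle_lt_dec B 0) => // hpos.
  have := key (B / 2 / (2 * PI)) ltac:(repeat apply: Rdiv_lt_0_compat; lra).
  have -> : 2 * PI * (B / 2 / (2 * PI)) = B / 2 by field; lra.
  lra.
move=> eps0.
have [|p [q [hu _]]] := hCR x0 y0.
  by rewrite !Rminus_eq_0 /=; have := pow_lt _ 2 rho_gt0; rewrite /=; lra.
have [dl hdl] := differentiable_continuity_pt u x0 y0
  (ex_intro _ _ (ex_intro _ _ hu)) (mkposreal _ eps0).
have hd := cond_pos dl.
pose r := Rmin rho (dl / 2).
have r0 : 0 < r by apply: Rmin_pos; lra.
have rrho : r <= rho by exact: Rmin_l.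
have rdl : r <= dl / 2 by exact: Rmin_r.
have hs : ln r <= ln rho by case: rrho => [h|->]; [left; apply: ln_increasing | right].
rewrite /A (circle_mean_indep (ln r) hs).
have hex := circle_ex_RInt _ hs.
have -> : RInt (circle_pt u (ln r)) 0 (2 * PI) - 2 * PI * u x0 y0 =
    RInt (fun t => circle_pt u (ln r) t - u x0 y0) 0 (2 * PI).
  rewrite (RInt_minus (V := R_CompleteNormedModule)) //; last exact: ex_RInt_const.
  by rewrite RInt_const /minus /plus /opp /scal /= /mult /=; ring.
have -> : 2 * PI * eps = (2 * PI - 0) * eps by ring.
apply: abs_RInt_le_const; first lra.
  by apply: (ex_RInt_minus (V := R_NormedModule) (circle_pt u (ln r))) => //; exact: ex_RInt_const.
move=> t _; left; apply: hdl; rewrite /circle_pt exp_ln //.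
- have -> : x0 + r * cos t - x0 = r * cos t by ring.
  rewrite Rabs_mult (Rabs_pos_eq r); last lra.
  have : Rabs (cos t) <= 1 by apply: Rabs_le; exact: COS_bound.
  by have := Rabs_pos (cos t); nra.
- have -> : y0 + r * sin t - y0 = r * sin t by ring.
  rewrite Rabs_mult (Rabs_pos_eq r); last lra.
  have : Rabs (sin t) <= 1 by apply: Rabs_le; exact: SIN_bound.
  by have := Rabs_pos (sin t); nra.
Qed.

End MeanValue.

(** Applied to [g] rotated so that its central value is nonnegative, this yields the submean
    inequality for [|g|]. *)
Lemma mean_value (u v : R -> R -> R) (x0 y0 rho : R) : 0 < rho ->
  (forall x y, (x - x0) ^ 2 + (y - y0) ^ 2 <= rho ^ 2 -> cauchy_riemann u v x y) ->
  is_RInt (fun t => u (x0 + rho * cos t) (y0 + rho * sin t)) 0 (2 * PI) (2 * PI * u x0 y0).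
Proof.
move=> h0 hCR; have := circle_mean u v x0 y0 rho h0 hCR; rewrite exp_ln // => <-.
apply: RInt_correct; have := circle_ex_RInt u v x0 y0 rho h0 hCR (ln rho) (Rle_refl _).
by rewrite exp_ln.
Qed.

(** * Complex differentiability *)

Local Notation is_C_derive := (is_derive (K := C_AbsRing) (V := C_NormedModule)).

(** The derivative over the complex field uses the balls of the modulus, whereas limits of
    functions of [C] use the product balls; this passes from the former to the latter. *)
Lemma is_C_derive_locally (g : C -> C) (z d : C) :
  is_C_derive g z d <->
  (forall eps : posreal, locally (T := C_UniformSpace) z (fun w : C =>
     Cmod (Cminus (Cminus (g w) (g z)) (Cmult (Cminus w z) d)) <= eps * Cmod (Cminus w z))).
Proof.
split=> [[_ h] eps|h].
  by have := h z ltac:(by move=> P hP) eps; move/locally_C.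
split; first exact: is_linear_scal_l.
move=> x hx; have -> : x = z by apply: sym_eq; exact: (is_filter_lim_locally_unique (V := AbsRing_NormedModule C_AbsRing) _ _ hx).
by move=> eps; apply/locally_C; exact: h.
Qed.

Lemma C_box_locally (z : C) (P : C -> Prop) :
  locally (T := C_UniformSpace) z P <->
  locally_2d (fun x y => P (x, y)) (Re z) (Im z).
Proof.
by rewrite locally_2d_locally; case: z => x y; split; apply: filter_imp => -[].
Qed.

Lemma Cmod_le_max (z : C) : Cmod z <= 2 * Rmax (Rabs (Re z)) (Rabs (Im z)).
Proof.
apply: Rle_trans (Cmod_2Rmax z) _; apply: Rmult_le_compat_r.
  exact: Rle_trans (Rabs_pos _) (Rmax_l _ _).
by apply: Rsqr_incr_0_var; rewrite ?Rsqr_sqrt /Rsqr; lra.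
Qed.

Lemma is_C_derive_cauchy_riemann (g : C -> C) (z d : C) :
  is_C_derive g z d <->
  differentiable_pt_lim (fun x y => Re (g (x, y))) (Re z) (Im z) (Re d) (- Im d) /\
  differentiable_pt_lim (fun x y => Im (g (x, y))) (Re z) (Im z) (Im d) (Re d).
Proof.
case: z d => [zx zy] [d1 d2]; rewrite is_C_derive_locally; split=> [h|[hr hi] eps].
- have he (eps : posreal) : 0 < eps / 2 by have := cond_pos eps; lra.
  split=> eps; have := h (mkposreal _ (he eps)); move/C_box_locally; apply: locally_2d_impl;
    apply: locally_2d_forall => x y /= hw.
  + set r := (X in Rabs X <= _); set c := Cminus (Cminus _ _) _ in hw.
    have -> : r = Re c by rewrite /r /c /Re /Im /=; ring.
    apply: Rle_trans (re_le_Cmod _) (Rle_trans _ _ _ hw _).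
    have := Cmod_le_max (Cminus (x, y) (zx, zy)); rewrite /=; have := he eps; rewrite /Rminus; nra.
  + set r := (X in Rabs X <= _); set c := Cminus (Cminus _ _) _ in hw.
    have -> : r = Im c by rewrite /r /c /Re /Im /=; ring.
    apply: Rle_trans (Rle_trans _ _ _ (Rmax_r _ _) (Rmax_Cmod _)) (Rle_trans _ _ _ hw _).
    have := Cmod_le_max (Cminus (x, y) (zx, zy)); rewrite /=; have := he eps; rewrite /Rminus; nra.
- have he : 0 < eps / 2 by have := cond_pos eps; lra.
  apply/C_box_locally.
  apply: locally_2d_impl (locally_2d_and _ _ _ _ (hr (mkposreal _ he)) (hi (mkposreal _ he))).
  apply: locally_2d_forall => x y /= [h1 h2].
  set c := Cminus (Cminus _ _) _.
  have e1 : Re c = Re (g (x, y)) - Re (g (zx, zy)) - (d1 * (x - zx) + - d2 * (y - zy)).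
    by rewrite /c /Re /Im /=; ring.
  have e2 : Im c = Im (g (x, y)) - Im (g (zx, zy)) - (d2 * (x - zx) + d1 * (y - zy)).
    by rewrite /c /Re /Im /=; ring.
  rewrite -e1 in h1; rewrite -e2 in h2.
  apply: Rle_trans (Cmod_le_max c) _.
  have hm : Rmax (Rabs (Re c)) (Rabs (Im c)) <= eps / 2 * Rmax (Rabs (x - zx)) (Rabs (y - zy)).
    exact: Rmax_lub.
  have hk : Rmax (Rabs (x - zx)) (Rabs (y - zy)) <= Cmod (Cminus (x, y) (zx, zy)) by exact: (Rmax_Cmod (Cminus (x, y) (zx, zy))).
  by have := Rmult_le_compat_l _ _ _ (Rlt_le _ _ he) hk; lra.
Qed.

(** Analyticity of vector valued functions is given by difference quotients, to which a
    functional can be applied. *)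
Lemma is_C_derive_quotient (g : C -> C) (z d : C) :
  is_C_derive g z d <->
  (forall eps : posreal, locally' (T := C_UniformSpace) z (fun w : C =>
     Cmod (Cminus (Cmult (Cinv (Cminus w z)) (Cminus (g w) (g z))) d) <= eps)).
Proof.
rewrite is_C_derive_locally.
have key w (eps : R) : w <> z ->
    Cmod (Cminus (Cmult (Cinv (Cminus w z)) (Cminus (g w) (g z))) d) <= eps <->
    Cmod (Cminus (Cminus (g w) (g z)) (Cmult (Cminus w z) d)) <= eps * Cmod (Cminus w z).
  move=> hw; have hne : Cminus w z <> RtoC 0 by move=> e; apply: hw; transitivity (Cplus (Cminus w z) z); [ring | rewrite e; ring].
  have hpos := proj1 (Cmod_gt_0 _) hne.
  have -> : Cminus (Cminus (g w) (g z)) (Cmult (Cminus w z) d) =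
     Cmult (Cminus (Cmult (Cinv (Cminus w z)) (Cminus (g w) (g z))) d) (Cminus w z) by field.
  rewrite Cmod_mult; split=> h; first by apply: Rmult_le_compat_r => //; lra.
  exact: Rmult_le_reg_r h.
split=> h eps; have := h eps; rewrite /locally' /within; apply: filter_imp => w hw.
- by move=> hne; apply/key.
- case: (classic (w = z)) => [->|hne]; last by apply/key => //; exact: hw.
  have -> : Cminus (Cminus (g z) (g z)) (Cmult (Cminus z z) d) = RtoC 0 by ring.
  rewrite Cmod_0; apply: Rmult_le_pos; [exact: Rlt_le (cond_pos eps) | exact: Cmod_ge_0].
Qed.

Lemma is_C_derive_mult (f g : C -> C) (z df dg : C) :
  is_C_derive f z df ->
  is_C_derive g z dg ->
  is_C_derive (fun w => Cmult (f w) (g w)) z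
    (Cplus (Cmult df (g z)) (Cmult (f z) dg)).
Proof.
have conv (h : C -> C) d : is_C_derive h z d <->
    is_derive (K := C_AbsRing) (V := AbsRing_NormedModule C_AbsRing) h z d.
  split=> -[_ hh]; (split; first exact: is_linear_scal_l); exact: hh.
move=> /conv hf /conv hg; apply/conv.
exact: (is_derive_mult (K := C_AbsRing) f g z df dg hf hg Cmult_comm).
Qed.

Lemma is_C_derive_scal (c : C) (g : C -> C) (z d : C) :
  is_C_derive g z d ->
  is_C_derive (fun w => Cmult c (g w)) z (Cmult c d).
Proof.
move=> h; have -> : Cmult c d = Cplus (Cmult (RtoC 0) (g z)) (Cmult c d) by ring.
apply: (is_C_derive_mult (fun _ => c)) => //.
exact: (is_derive_const (K := C_AbsRing) (V := C_NormedModule)).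
Qed.

Lemma locally_Cmod (z : C) (eps : posreal) :
  locally (T := C_UniformSpace) z (fun w => Cmod (Cminus w z) < eps).
Proof.
have he : 0 < eps / 2 by have := cond_pos eps; lra.
apply/C_box_locally; exists (mkposreal _ he) => x y hx hy.
apply: Rle_lt_trans (Cmod_le_max _) _.
have := Rmax_lub_lt _ _ _ hx hy; rewrite /= /Re /Im /Rminus; lra.
Qed.

Lemma is_C_derive_continuous (g : C -> C) (z d : C) (eps : posreal) :
  is_C_derive g z d ->
  locally (T := C_UniformSpace) z (fun w => Cmod (Cminus (g w) (g z)) < eps).
Proof.
move=> /is_C_derive_locally /(_ (mkposreal 1 Rlt_0_1)) h.
have hd := Cmod_ge_0 d; have he := cond_pos eps.
have hr : 0 < eps / (1 + Cmod d) by apply: Rdiv_lt_0_compat; lra.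
apply: filter_imp (filter_and _ _ h (locally_Cmod z (mkposreal _ hr))) => w /= [h1 h2].
have -> : Cminus (g w) (g z) =
  Cplus (Cminus (Cminus (g w) (g z)) (Cmult (Cminus w z) d)) (Cmult (Cminus w z) d) by ring.
apply: Rle_lt_trans (Cmod_triangle _ _) _; rewrite Cmod_mult.
have -> : (eps : R) = (1 + Cmod d) * (eps / (1 + Cmod d)) by field; lra.
have := Rmult_lt_compat_l _ _ _ (ltac:(lra) : 0 < 1 + Cmod d) h2; lra.
Qed.

(** The function [exp (a z)], for a real [a]. *)
Definition Cexp_scaled (a : R) (z : C) : C :=
  (exp (a * Re z) * cos (a * Im z), exp (a * Re z) * sin (a * Im z)).

Lemma Cmod_Cexp_scaled a z : Cmod (Cexp_scaled a z) = exp (a * Re z).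
Proof.
rewrite /Cmod -[RHS](sqrt_pow2 (exp (a * Re z))); last exact: Rlt_le (exp_pos _).
by rewrite -[in RHS](sum_sq_polar _ (a * Im z)).
Qed.

Lemma is_derive_Cexp_scaled a z :
  is_C_derive (Cexp_scaled a) z
    (Cmult (RtoC a) (Cexp_scaled a z)).
Proof.
apply/is_C_derive_cauchy_riemann.
have he : is_derive (fun x => exp (a * x)) (Re z) (a * exp (a * Re z)) by auto_derive => //; ring.
have hc : is_derive (fun x => cos (a * x)) (Im z) (- a * sin (a * Im z)) by auto_derive => //; ring.
have hs : is_derive (fun x => sin (a * x)) (Im z) (a * cos (a * Im z)) by auto_derive => //; ring.
split.
- have := differentiable_separated 0 _ _ _ _ _ _ he hc; rewrite /Cexp_scaled /=.
  have -> : a * (exp (a * Re z) * cos (a * Im z)) - 0 * (exp (a * Re z) * sin (a * Im z))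
    = a * exp (a * Re z) * cos (a * Im z) by ring.
  have -> : - (a * (exp (a * Re z) * sin (a * Im z)) + 0 * (exp (a * Re z) * cos (a * Im z)))
    = exp (a * Re z) * (- a * sin (a * Im z)) by ring.
  by apply: differentiable_pt_lim_ext; apply: locally_2d_forall => x y; rewrite Rplus_0_l.
- have := differentiable_separated 0 _ _ _ _ _ _ he hs; rewrite /Cexp_scaled /=.
  have -> : a * (exp (a * Re z) * cos (a * Im z)) - 0 * (exp (a * Re z) * sin (a * Im z))
    = exp (a * Re z) * (a * cos (a * Im z)) by ring.
  have -> : (a * (exp (a * Re z) * sin (a * Im z)) + 0 * (exp (a * Re z) * cos (a * Im z)))
    = a * exp (a * Re z) * sin (a * Im z) by ring.
  by apply: differentiable_pt_lim_ext; apply: locally_2d_forall => x y; rewrite Rplus_0_l.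
Qed.

(** * The three lines theorem *)

Lemma phase (w : C) : exists c : C, Cmod c = 1 /\ Re (Cmult c w) = Cmod w.
Proof.
case: (Req_dec (Cmod w) 0) => hw.
  exists (RtoC 1); split; first exact: Cmod_1.
  by rewrite (Cmod_eq_0 _ hw) Cmult_0_r Cmod_0.
have h0 := Cmod_ge_0 w.
exists (Cmult (RtoC (/ Cmod w)) (Cconj w)); split.
  rewrite Cmod_mult Cmod_conj Cmod_R Rabs_pos_eq; first by field.
  by apply: Rlt_le; apply: Rinv_0_lt_compat; lra.
have := Cmod2_alt w; case: w hw h0 => x y hw h0; rewrite /Re /Im /= => h.
have -> : (/ Cmod (x, y) * x - 0 * - y) * x - (/ Cmod (x, y) * - y + 0 * x) * y =
  (x * (x * 1) + y * (y * 1)) / Cmod (x, y) by field.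
by rewrite -h; field.
Qed.

Lemma circle_integral_quadratic (al be x0 y0 rho : R) :
  is_RInt (fun t => al * (x0 + rho * cos t) ^ 2 + be * (y0 + rho * sin t) ^ 2) 0 (2 * PI)
    (2 * PI * (al * x0 ^ 2 + be * y0 ^ 2) + PI * (al + be) * rho ^ 2).
Proof.
pose K t := (al * x0 ^ 2 + be * y0 ^ 2) * t + 2 * rho * (al * x0 * sin t - be * y0 * cos t)
  + rho ^ 2 / 2 * (al * (t + sin t * cos t) + be * (t - sin t * cos t)).
have -> : 2 * PI * (al * x0 ^ 2 + be * y0 ^ 2) + PI * (al + be) * rho ^ 2 = minus (K (2 * PI)) (K 0).
  by rewrite /K cos_2PI sin_2PI cos_0 sin_0 /minus /plus /opp /=; field.
apply: is_RInt_derive => t _.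
- rewrite /K; auto_derive => //.
  have := sin2_cos2 t; rewrite /Rsqr => h.
  have e : forall A B, A - B = (al + be) * (rho * rho) / 2 * (1 - (sin t * sin t + cos t * cos t)) -> A = B.
    by move=> A B hAB; apply: Rminus_diag_uniq; rewrite hAB h; ring.
  by apply: e; field.
- by apply: (ex_derive_continuous (V := R_NormedModule)); auto_derive.
Qed.

(** If [|g|] exceeded [M] in the strip, then [|g| + eps x^2 - eps y^2 / 2] would, for a small
    [eps], attain an interior maximum. Its means over small circles would be larger than this
    maximum, by [eps / 4] times the squared radius. The term in [x] makes the inequality
    strict, and the term in [y] keeps the maximum in a bounded part of the strip. *)
Lemma strip_maximum_principle (g : C -> C) (M B : R) :
  (forall z, closed_strip z -> Cmod (g z) <= B) ->
  (forall z, closed_strip z -> forall eps : posreal,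
     within closed_strip (locally z) (fun w => Cmod (Cminus (g w) (g z)) < eps)) ->
  (forall z, open_strip z -> exists d, is_C_derive g z d) ->
  (forall t, Cmod (g (0, t)) <= M) -> (forall t, Cmod (g (1, t)) <= M) ->
  forall z, closed_strip z -> Cmod (g z) <= M.
Proof.
move=> hB hcont hder h0 h1 [x1 y1] hz.
suff key eps : 0 < eps -> Cmod (g (x1, y1)) + eps * x1 ^ 2 - eps / 2 * y1 ^ 2 <= M + eps.
  apply: Rle_plus_epsilon => e he.
  have hy := pow2_ge_0 y1; have hx := pow2_ge_0 x1.
  have := key (e / (1 + y1 ^ 2)) ltac:(apply: Rdiv_lt_0_compat; lra).
  have : e / (1 + y1 ^ 2) * (1 + y1 ^ 2) = e by field; lra.
  set k := e / _ => hk; have : 0 < k by apply: Rdiv_lt_0_compat; lra.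
  by move=> k0; have := Rmult_le_pos _ _ (Rlt_le _ _ k0) hx; nra.
move=> eps0; apply: Rnot_lt_le => hgt.
pose F x y := Cmod (g (x, y)) + eps * x ^ 2 - eps / 2 * y ^ 2.
have sq1 x : 0 <= x <= 1 -> eps * x ^ 2 <= eps.
  move=> hx; have hx2 : x ^ 2 <= 1 by nra.
  nra.
have sq2 y : 0 <= eps / 2 * y ^ 2.
  by apply: Rmult_le_pos; [lra | exact: pow2_ge_0].
have BM : M <= B.
  by have := hB _ hz; have := sq1 _ hz; have := sq2 y1; rewrite /=; lra.
(* At height [T] the term in [y] outweighs the bound [B], so the maximum lies below. *)
pose T := Rabs y1 + (B - M) / eps + 2.
have hT1 : 0 <= (B - M) / eps by apply: Rmult_le_pos; [lra | apply: Rlt_le; exact: Rinv_0_lt_compat].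
have T2 : 2 <= T by rewrite /T; have := Rabs_pos y1; lra.
have hT : B + eps - eps / 2 * T ^ 2 < M + eps.
  have : B - M < eps * T.
    have -> : B - M = eps * ((B - M) / eps) by field; lra.
    by apply: Rmult_lt_compat_l => //; rewrite /T; have := Rabs_pos y1; lra.
  by have := Rmult_le_compat_l (eps / 2 * T) _ _ ltac:(nra) T2; lra.
have [||x y hx hy eta eta0|p [q [hp [hq hmax]]]] := rectangle_max F 0 1 (- T) T; try lra.
  have hg := hcont (x, y) hx (mkposreal (eta / 2) ltac:(lra)).
  have hpoly : continuity_2d_pt (fun x y => eps * x ^ 2 - eps / 2 * y ^ 2) x y.
    apply: continuity_2d_pt_minus.
      apply: continuity_2d_pt_mult; first exact: continuity_2d_pt_const.
      by apply: (continuity_1d_2d_pt_comp (fun x => x ^ 2)); [reg | exact: continuity_2d_pt_id1].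
    apply: continuity_2d_pt_mult; first exact: continuity_2d_pt_const.
    by apply: (continuity_1d_2d_pt_comp (fun x => x ^ 2)); [reg | exact: continuity_2d_pt_id2].
  have := locally_2d_and _ _ _ _ (hpoly (mkposreal (eta / 2) ltac:(lra))) (proj1 (C_box_locally (x, y) _) hg).
  move=> [dl hdl]; exists dl => x' y' hx' hy' dx dy.
  have [/= e1 e2] := hdl x' y' dx dy.
  have := e2 hx'; have := Cmod_triangle (Cminus (g (x', y')) (g (x, y))) (g (x, y)).
  have -> : Cplus (Cminus (g (x', y')) (g (x, y))) (g (x, y)) = g (x', y') by ring.
  by move: e1 => /Rabs_def2; rewrite /F /=; lra.
have hFp : M + eps < F p q.
  apply: Rlt_le_trans hgt (hmax x1 y1 hz _).
  by rewrite /T; have := Rabs_le_between y1 (Rabs y1); have := Rle_refl (Rabs y1); lra.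
have hpp := pow2_ge_0 p; have hqq := pow2_ge_0 q.
have p0 : 0 < p.
  by case: (Req_dec p 0) => [e|]; [move: hFp; rewrite /F e; have := h0 q; nra | lra].
have p1 : p < 1.
  by case: (Req_dec p 1) => [e|]; [move: hFp; rewrite /F e; have := h1 q; nra | lra].
have hpB : Cmod (g (p, q)) <= B by apply: hB; rewrite /closed_strip /=; lra.
have qT : q <> T.
  by move=> e; have := sq1 p hp; move: hFp; rewrite /F e; rewrite e in hpB; lra.
have qT' : q <> - T.
  move=> e; have := sq1 p hp; move: hFp; rewrite /F e; rewrite e in hpB.
  have -> : (- T) ^ 2 = T ^ 2 by ring.
  lra.
(* Half the distance to the sides: the closed disc must lie in the open strip. *)
pose rho := Rmin (Rmin p (1 - p)) (Rmin (T - q) (T + q)) / 2.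
have rho0 : 0 < rho by rewrite /rho; have : 0 < Rmin (Rmin p (1 - p)) (Rmin (T - q) (T + q)); [repeat apply: Rmin_glb_lt; lra | lra].
have [r1 [r2 [r3 r4]]] : 2 * rho <= p /\ 2 * rho <= 1 - p /\ 2 * rho <= T - q /\ 2 * rho <= T + q.
  have -> : 2 * rho = Rmin (Rmin p (1 - p)) (Rmin (T - q) (T + q)) by rewrite /rho; field.
  have := Rmin_l (Rmin p (1 - p)) (Rmin (T - q) (T + q)).
  have := Rmin_r (Rmin p (1 - p)) (Rmin (T - q) (T + q)).
  have := Rmin_l p (1 - p); have := Rmin_r p (1 - p).
  have := Rmin_l (T - q) (T + q); have := Rmin_r (T - q) (T + q); lra.
have [c [hc1 hc2]] := phase (g (p, q)).
pose u x y := Re (Cmult c (g (x, y))).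
have hCR x y : (x - p) ^ 2 + (y - q) ^ 2 <= rho ^ 2 ->
    cauchy_riemann u (fun x y => Im (Cmult c (g (x, y)))) x y.
  move=> hxy.
  have hx : - rho <= x - p <= rho by have := pow2_ge_0 (y - q); split; nra.
  have [|d hd] := hder (x, y); first by rewrite /open_strip /=; lra.
  exists (Re (Cmult c d)), (Im (Cmult c d)).
  exact: (proj1 (is_C_derive_cauchy_riemann _ (x, y) _) (is_C_derive_scal c g (x, y) d hd)).
have hmean := mean_value _ _ p q rho rho0 hCR.
have hquad := circle_integral_quadratic eps (- (eps / 2)) p q rho.
have htot := is_RInt_plus _ _ _ _ _ _ hmean hquad.
have hpi := PI_RGT_0.
have hle : 2 * PI * Re (Cmult c (g (p, q)))
    + (2 * PI * (eps * p ^ 2 + - (eps / 2) * q ^ 2) + PI * (eps + - (eps / 2)) * rho ^ 2) <= (2 * PI - 0) * F p q.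
  apply: (is_RInt_le _ (fun _ => F p q) 0 (2 * PI)); [lra | exact: htot | exact: is_RInt_const |].
  move=> t _; rewrite /u /plus /=.
  have := COS_bound t; have := SIN_bound t; move=> hs hc.
  have := hmax (p + rho * cos t) (q + rho * sin t) ltac:(nra) ltac:(nra).
  set w := g _; have := re_le_Cmod (Cmult c w); rewrite Cmod_mult hc1 Rmult_1_l /F.
  have := Rle_abs (Re (Cmult c w)); rewrite -/w /=; lra.
have gain : 0 < PI * eps * rho ^ 2 by exact: (Rmult_lt_0_compat _ _ (Rmult_lt_0_compat _ _ hpi eps0) (pow_lt _ 2 rho0)).
by move: hle; rewrite hc2 /F; lra.
Qed.

(** The maximum principle for [exp (lam z) g], which has the same bound on both lines. *)
Lemma three_lines (g : C -> C) (lam M B : R) :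
  (forall z, closed_strip z -> Cmod (g z) <= B) ->
  (forall z, closed_strip z -> forall eps : posreal,
     within closed_strip (locally z) (fun w => Cmod (Cminus (g w) (g z)) < eps)) ->
  (forall z, open_strip z -> exists d, is_C_derive g z d) ->
  (forall t, Cmod (g (0, t)) <= M) -> (forall t, exp lam * Cmod (g (1, t)) <= M) ->
  forall z, closed_strip z -> exp (lam * Re z) * Cmod (g z) <= M.
Proof.
move=> hB hcont hder h0 h1 z hz.
have -> : exp (lam * Re z) * Cmod (g z) = Cmod (Cmult (Cexp_scaled lam z) (g z)).
  by rewrite Cmod_mult Cmod_Cexp_scaled.
have B0 : 0 <= B by apply: Rle_trans (hB z hz); exact: Cmod_ge_0.
have hexp w : closed_strip w -> exp (lam * Re w) <= exp (Rabs lam).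
  rewrite /closed_strip => hw.
  have : lam * Re w <= Rabs lam by have := Rle_abs lam; have := Rabs_pos lam; nra.
  by case=> [h|->]; [left; exact: exp_increasing | right].
apply: (strip_maximum_principle (fun z => Cmult (Cexp_scaled lam z) (g z)) M (exp (Rabs lam) * B)) hz.
- move=> w hw; rewrite Cmod_mult Cmod_Cexp_scaled.
  apply: Rmult_le_compat; [exact: Rlt_le (exp_pos _) | exact: Cmod_ge_0 | exact: hexp | exact: hB].
- move=> w hw eps.
  have hK := exp_pos (Rabs lam); set K := exp _ in hK *.
  have he := cond_pos eps; have hgw := Cmod_ge_0 (g w).
  have e1 : 0 < eps / 2 / K by repeat apply: Rdiv_lt_0_compat; lra.
  have e2 : 0 < eps / 2 / (Cmod (g w) + 1) by repeat apply: Rdiv_lt_0_compat; lra.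
  have c1 := hcont w hw (mkposreal _ e1).
  have c2 := is_C_derive_continuous _ _ _ (mkposreal _ e2) (is_derive_Cexp_scaled lam w).
  rewrite /within in c1 *; apply: filter_imp (filter_and _ _ c1 c2) => x /= [h2 h3] hx; have {}h2 := h2 hx.
  have -> : Cminus (Cmult (Cexp_scaled lam x) (g x)) (Cmult (Cexp_scaled lam w) (g w)) =
    Cplus (Cmult (Cexp_scaled lam x) (Cminus (g x) (g w)))
          (Cmult (Cminus (Cexp_scaled lam x) (Cexp_scaled lam w)) (g w)) by ring.
  apply: Rle_lt_trans (Cmod_triangle _ _) _; rewrite !Cmod_mult Cmod_Cexp_scaled.
  have t1 : exp (lam * Re x) * Cmod (Cminus (g x) (g w)) <= K * (eps / 2 / K).
    by apply: Rmult_le_compat; [exact: Rlt_le (exp_pos _) | exact: Cmod_ge_0 | exact: hexp | lra].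
  have t2 : Cmod (Cminus (Cexp_scaled lam x) (Cexp_scaled lam w)) * Cmod (g w) <=
      eps / 2 / (Cmod (g w) + 1) * Cmod (g w) by apply: Rmult_le_compat_r; lra.
  have t3 : K * (eps / 2 / K) = eps / 2 by field; lra.
  have t4 : eps / 2 / (Cmod (g w) + 1) * (Cmod (g w) + 1) = eps / 2 by field; lra.
  lra.
- move=> w hw; have [d hd] := hder w hw.
  exists (Cplus (Cmult (Cmult (RtoC lam) (Cexp_scaled lam w)) (g w)) (Cmult (Cexp_scaled lam w) d)).
  exact: is_C_derive_mult (is_derive_Cexp_scaled lam w) hd.
- by move=> t; rewrite Cmod_mult Cmod_Cexp_scaled /Re /= Rmult_0_r exp_0 Rmult_1_l.
- by move=> t; rewrite Cmod_mult Cmod_Cexp_scaled /Re /= Rmult_1_r.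
Qed.

(** * Two-sided bounds for the Calderon norm *)

Lemma Sup_ub (E : R -> Prop) B r : (forall r, E r -> r <= B) -> E r -> r <= Sup E.
Proof.
move=> hB hr; rewrite /Sup; have [hub hlub] := Lub_Rbar_correct E.
have h1 := hub _ hr; have h2 : Rbar_le (Lub_Rbar E) B by apply: hlub => s /hB.
by case: (Lub_Rbar E) h1 h2.
Qed.

Lemma Sup_le (E : R -> Prop) B : (exists r, E r) -> (forall r, E r -> r <= B) -> Sup E <= B.
Proof.
move=> [r hr] hB; rewrite /Sup; have [hub hlub] := Lub_Rbar_correct E.
have h1 := hub _ hr; have h2 : Rbar_le (Lub_Rbar E) B by apply: hlub => s /hB.
by case: (Lub_Rbar E) h1 h2.
Qed.

Lemma Inf_lb (E : R -> Prop) m r : (forall r, E r -> m <= r) -> E r -> Inf E <= r.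
Proof.
move=> hm hr; rewrite /Inf; have [hlb hglb] := Glb_Rbar_correct E.
have h1 := hlb _ hr; have h2 : Rbar_le m (Glb_Rbar E) by apply: hglb => s /hm.
by case: (Glb_Rbar E) h1 h2.
Qed.

Lemma Inf_ge (E : R -> Prop) m : (exists r, E r) -> (forall r, E r -> m <= r) -> m <= Inf E.
Proof.
move=> [r hr] hm; rewrite /Inf; have [hlb hglb] := Glb_Rbar_correct E.
have h1 := hlb _ hr; have h2 : Rbar_le m (Glb_Rbar E) by apply: hglb => s /hm.
by case: (Glb_Rbar E) h1 h2.
Qed.

(** What the interpolation argument uses of a matrix norm. *)
Definition prenorm {W : ModuleSpace C_AbsRing} (N : W -> R) : Prop :=
  (forall w, 0 <= N w) /\ (forall (k : C) w, N (scal (k : C_AbsRing) w) <= Cmod k * N w).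

Lemma prenorm_zero {W : ModuleSpace C_AbsRing} (N : W -> R) : prenorm N -> N zero = 0.
Proof.
move=> [h0 hs]; apply: Rle_antisym (h0 _).
by have := hs (RtoC 0) zero; rewrite Cmod_0 Rmult_0_l scal_zero_r.
Qed.

(** Scalar functions times a fixed vector inherit limits for every norm at hand; this
    settles all the conditions on [calderon_exp] at once. *)
Lemma norm_cvg_scal (W : ModuleSpace C_AbsRing) (N : W -> R) (x : W) (A : R)
    (T : Type) (F : (T -> Prop) -> Prop) (c : T -> C) (c0 : C) :
  (forall w, 0 <= N w) -> (forall k : C, N (scal (k : C_AbsRing) x) <= Cmod k * A) ->
  Filter F -> (forall eps : posreal, F (fun t => Cmod (Cminus (c t) c0) <= eps)) ->
  norm_cvg N F (fun t => scal (c t : C_AbsRing) x) (scal (c0 : C_AbsRing) x).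
Proof.
move=> h0 hA hF hc; apply/filterlim_locally => eps.
have A0 : 0 <= A by have := hA (RtoC 1); have := h0 (scal (RtoC 1 : C_AbsRing) x); rewrite Cmod_1; lra.
have he : 0 < eps / (A + 1) by apply: Rdiv_lt_0_compat; [exact: cond_pos | lra].
apply: filter_imp (hc (mkposreal _ he)) => t /= ht.
change (Rabs (N (minus (scal (c t : C_AbsRing) x) (scal (c0 : C_AbsRing) x)) - 0) < eps).
rewrite -scal_minus_distr_r Rminus_0_r Rabs_pos_eq //.
apply: Rle_lt_trans (hA _) _.
have : Cmod (Cminus (c t) c0) * A <= eps / (A + 1) * A by apply: Rmult_le_compat_r.
have : eps / (A + 1) * (A + 1) = eps by field; lra.
by change (minus (c t : C_AbsRing) c0) with (Cminus (c t) c0); lra.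
Qed.

Lemma locally_vertical (r t : R) (P : C -> Prop) :
  locally (T := C_UniformSpace) (r, t) P -> locally t (fun s => P (r, s)).
Proof.
move=> [dl h]; exists dl => s hs; apply: h; split=> //; exact: ball_center.
Qed.

Section CalderonBounds.
Variables (W : ModuleSpace C_AbsRing) (N0 N1 : W -> R) (lam theta : R).
Hypotheses (hN0 : prenorm N0) (hN1 : prenorm N1).

Lemma sum_norm_set_ge0 w r : (exists a b, plus a b = w /\ r = N0 a + N1 b) -> 0 <= r.
Proof. by move=> [a [b [_ ->]]]; have := proj1 hN0 a; have := proj1 hN1 b; lra. Qed.

Lemma sum_norm_ge0 w : 0 <= sum_norm N0 N1 w.
Proof.
apply: Inf_ge; last exact: sum_norm_set_ge0.
by exists (N0 w + N1 zero), w, zero; rewrite plus_zero_r.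
Qed.

Lemma sum_norm_le w : sum_norm N0 N1 w <= N0 w.
Proof.
apply: Inf_lb (@sum_norm_set_ge0 w) _.
by exists w, zero; rewrite plus_zero_r prenorm_zero // Rplus_0_r.
Qed.

Lemma calderon_fun_norm_ge f : calderon_fun N0 N1 f ->
  (forall t : R, N0 (f (0, t)) <= calderon_fun_norm N0 N1 f) /\
  (forall t : R, N1 (f (1, t)) <= calderon_fun_norm N0 N1 f).
Proof.
case=> _ _ _ [M0 h0] _ [M1 h1] _; split=> t.
- apply: Rle_trans (Rmax_l _ _); apply: (Sup_ub _ M0); last by exists t.
  by move=> r [s ->].
- apply: Rle_trans (Rmax_r _ _); apply: (Sup_ub _ M1); last by exists t.
  by move=> r [s ->].
Qed.

Lemma calderon_fun_norm_set_ge0 x r :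
  (exists f, calderon_fun N0 N1 f /\ f (RtoC theta) = x /\ r = calderon_fun_norm N0 N1 f) -> 0 <= r.
Proof.
move=> [f [hf [_ ->]]]; apply: Rle_trans (proj1 (calderon_fun_norm_ge _ hf) 0).
exact: (proj1 hN0).
Qed.

(** The function [exp (lam * (theta - z)) x], which balances the two boundary norms. *)
Definition calderon_exp (x : W) (z : C) : W :=
  scal (Cmult (RtoC (exp (lam * theta))) (Cexp_scaled (- lam) z) : C_AbsRing) x.

Lemma calderon_exp_fun x : calderon_fun N0 N1 (calderon_exp x).
Proof.
pose c z := Cmult (RtoC (exp (lam * theta))) (Cexp_scaled (- lam) z).
have hc z : is_C_derive c z
    (Cmult (RtoC (exp (lam * theta))) (Cmult (RtoC (- lam)) (Cexp_scaled (- lam) z))).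
  exact/is_C_derive_scal/is_derive_Cexp_scaled.
have hcont z (eps : posreal) : locally (T := C_UniformSpace) z (fun w => Cmod (Cminus (c w) (c z)) <= eps).
  by apply: filter_imp (is_C_derive_continuous _ _ _ eps (hc z)) => w; lra.
have hmod z : Cmod (c z) = exp (lam * theta) * exp (- lam * Re z).
  by rewrite /c Cmod_mult Cmod_Cexp_scaled Cmod_R Rabs_pos_eq //; exact: Rlt_le (exp_pos _).
have hsum k : sum_norm N0 N1 (scal (k : C_AbsRing) x) <= Cmod k * N0 x.
  exact: Rle_trans (sum_norm_le _) (proj2 hN0 _ _).
split.
- exists (exp (lam * theta) * exp (Rabs lam) * N0 x) => z hz.
  apply: Rle_trans (hsum (c z)) _; rewrite hmod.
  apply: Rmult_le_compat_r; first exact: (proj1 hN0).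
  apply: Rmult_le_compat_l; first exact: Rlt_le (exp_pos _).
  have : - lam * Re z <= Rabs lam.
    by rewrite -Rabs_Ropp; have := Rle_abs (- lam); have := Rabs_pos (- lam); move: hz; rewrite /closed_strip; nra.
  by case=> [h|->]; [left; exact: exp_increasing | right].
- move=> z _; apply: (norm_cvg_scal _ _ x (N0 x)) => //; first exact: sum_norm_ge0.
  by move=> eps; apply: filter_le_within; exact: hcont.
- move=> z _; exists (scal (Cmult (RtoC (exp (lam * theta))) (Cmult (RtoC (- lam)) (Cexp_scaled (- lam) z)) : C_AbsRing) x).
  apply: (eq_ind _ (fun F => norm_cvg _ _ F _) (norm_cvg_scal _ _ x (N0 x) _ _ _ _ sum_norm_ge0 hsum _
    (proj1 (is_C_derive_quotient _ _ _) (hc z)))).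
  by apply: functional_extensionality => w; rewrite -scal_assoc scal_minus_distr_r.
- exists (exp (lam * theta) * N0 x) => t; apply: Rle_trans (proj2 hN0 (c (0, t)) _) _.
  by rewrite hmod /Re /= Rmult_0_r exp_0 Rmult_1_r; lra.
- move=> t; apply: (norm_cvg_scal _ _ x (N0 x)); [exact: (proj1 hN0) | by move=> k; exact: (proj2 hN0) |].
  by move=> eps; exact: (locally_vertical 0 t _ (hcont (0, t) eps)).
- exists (exp (lam * theta) * exp (- lam) * N1 x) => t; apply: Rle_trans (proj2 hN1 (c (1, t)) _) _.
  by rewrite hmod /Re /= Rmult_1_r; lra.
- move=> t; apply: (norm_cvg_scal _ _ x (N1 x)); [exact: (proj1 hN1) | by move=> k; exact: (proj2 hN1) |].
  by move=> eps; exact: (locally_vertical 1 t _ (hcont (1, t) eps)).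
Qed.

Lemma calderon_exp_theta x : calderon_exp x (RtoC theta) = x.
Proof.
rewrite /calderon_exp /Cexp_scaled /= Rmult_0_r cos_0 sin_0 Rmult_0_r Rmult_1_r.
rewrite -/(RtoC _) -RtoC_mult -exp_plus.
have -> : lam * theta + - lam * theta = 0 by ring.
by rewrite exp_0; exact: scal_one.
Qed.

Lemma calderon_norm_le x m : N0 x <= m -> N1 x <= exp lam * m ->
  calderon_norm N0 N1 theta x <= exp (lam * theta) * m.
Proof.
move=> h0 h1.
have hmod z : Cmod (Cmult (RtoC (exp (lam * theta))) (Cexp_scaled (- lam) z)) =
    exp (lam * theta) * exp (- lam * Re z).
  by rewrite Cmod_mult Cmod_Cexp_scaled Cmod_R Rabs_pos_eq //; exact: Rlt_le (exp_pos _).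
apply: (Rle_trans _ (calderon_fun_norm N0 N1 (calderon_exp x))).
  apply: Inf_lb (@calderon_fun_norm_set_ge0 x) _.
  by exists (calderon_exp x); split; [exact: calderon_exp_fun | split; first exact: calderon_exp_theta].
have he := exp_pos (lam * theta).
apply: Rmax_lub; apply: Sup_le; try by [eexists; exists 0].
- move=> r [t ->]; apply: Rle_trans (proj2 hN0 _ _) _.
  by rewrite hmod /Re /= Rmult_0_r exp_0 Rmult_1_r; apply: Rmult_le_compat_l; lra.
- move=> r [t ->]; apply: Rle_trans (proj2 hN1 _ _) _.
  rewrite hmod /Re /= Rmult_1_r Rmult_assoc; apply: Rmult_le_compat_l; first lra.
  have -> : m = exp (- lam) * (exp lam * m) by rewrite -Rmult_assoc -exp_plus Rplus_opp_l exp_0; ring.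
  by apply: Rmult_le_compat_l => //; exact: Rlt_le (exp_pos _).
Qed.

(** A functional bounded for both norms is bounded for the norm of the sum, so it turns an
    admissible function into a scalar one, to which the three lines theorem applies. *)
Lemma calderon_norm_ge (psi : W -> C) x : 0 <= theta <= 1 ->
  (forall v w, psi (plus v w) = Cplus (psi v) (psi w)) ->
  (forall (k : C) w, psi (scal (k : C_AbsRing) w) = Cmult k (psi w)) ->
  (forall w, Cmod (psi w) <= N0 w) -> (forall w, exp lam * Cmod (psi w) <= N1 w) ->
  exp (lam * theta) * Cmod (psi x) <= calderon_norm N0 N1 theta x.
Proof.
move=> htheta psiD psiZ psi0 psi1.
have psiB v w : psi (minus v w) = Cminus (psi v) (psi w).
  rewrite /minus psiD -scal_opp_one; change (opp one : C_AbsRing) with (Copp (RtoC 1)).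
  by rewrite psiZ /Cminus; ring.
(* [psi] is bounded with constant 1 for [N0] and [exp (- lam)] for [N1]; [K] exceeds both. *)
pose K := 1 + exp (- lam).
have hl := exp_pos (- lam).
have psi_sum w : Cmod (psi w) <= K * sum_norm N0 N1 w.
  have hle : Cmod (psi w) / K <= sum_norm N0 N1 w.
    apply: Inf_ge; first by exists (N0 w + N1 zero), w, zero; rewrite plus_zero_r.
    move=> r [a [b [<- ->]]]; apply/Rle_div_l; first by rewrite /K; lra.
    rewrite psiD; apply: Rle_trans (Cmod_triangle _ _) _.
    have hb : Cmod (psi b) <= exp (- lam) * N1 b.
      have -> : Cmod (psi b) = exp (- lam) * (exp lam * Cmod (psi b)).
        by rewrite -Rmult_assoc -exp_plus Rplus_opp_l exp_0; ring.
      by apply: Rmult_le_compat_l => //; lra.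
    by have := psi0 a; have := proj1 hN0 a; have := proj1 hN1 b; rewrite /K; nra.
  by move/Rle_div_l: hle => /(_ ltac:(rewrite /K; lra)); lra.
have psi_cvg (T : Type) (F : (T -> Prop) -> Prop) (f : T -> W) w : Filter F ->
    norm_cvg (sum_norm N0 N1) F f w ->
    forall eps : posreal, F (fun t => Cmod (Cminus (psi (f t)) (psi w)) < eps).
  move=> hF hf eps.
  have he : 0 < eps / K by apply: Rdiv_lt_0_compat; [exact: cond_pos | rewrite /K; lra].
  move/filterlim_locally: hf => /(_ (mkposreal _ he)); apply: filter_imp => t ht.
  have {}ht : sum_norm N0 N1 (minus (f t) w) < eps / K.
    by apply: Rle_lt_trans (Rle_abs _) _; move: ht; rewrite /ball /= /AbsRing_ball /abs /minus /plus /opp /= Ropp_0 Rplus_0_r.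
  rewrite -psiB; apply: Rle_lt_trans (psi_sum _) _.
  have -> : (eps : R) = K * (eps / K) by field; rewrite /K; lra.
  by apply: Rmult_lt_compat_l => //; rewrite /K; lra.
apply: Inf_ge.
  exists (calderon_fun_norm N0 N1 (calderon_exp x)), (calderon_exp x).
  by split; [exact: calderon_exp_fun | split; first exact: calderon_exp_theta].
move=> r [f [hf [hx ->]]].
have [b0 b1] := calderon_fun_norm_ge _ hf.
case: hf => -[M hM] hc hd _ _ _ _.
rewrite -hx.
apply: (three_lines (fun z => psi (f z)) lam (calderon_fun_norm N0 N1 f) (K * M) _ _ _ _ _ (RtoC theta)).
- move=> z hz; apply: Rle_trans (psi_sum _) _.
  by apply: Rmult_le_compat_l; [rewrite /K; lra | exact: hM].
- by move=> z hz; apply: psi_cvg; exact: hc.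
- move=> z hz; have [d hdz] := hd z hz; exists (psi d).
  apply/is_C_derive_quotient => eps.
  apply: filter_imp (psi_cvg _ _ _ _ _ hdz eps) => w.
  rewrite psiZ psiB => h; exact: Rlt_le h.
- by move=> t; exact: Rle_trans (psi0 _) (b0 t).
- by move=> t; exact: Rle_trans (psi1 _) (b1 t).
- by rewrite /closed_strip.
Qed.

End CalderonBounds.

(** * Finite sums *)

HB.instance Definition _ := Monoid.isComLaw.Build R 0 Rplus
  (fun x y z => esym (Rplus_assoc x y z)) Rplus_comm Rplus_0_l.
HB.instance Definition _ := Monoid.isComLaw.Build C (RtoC 0) Cplus Cplus_assoc Cplus_comm Cplus_0_l.
HB.instance Definition _ (G : AbelianMonoid) :=
  Monoid.isComLaw.Build G zero plus plus_assoc plus_comm plus_zero_l.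

Lemma big_Rplus_ge0 (n : nat) (F : 'I_n -> R) : (forall i, 0 <= F i) -> 0 <= \big[Rplus/0]_(i < n) F i.
Proof. by move=> h; apply: (big_ind (fun r => 0 <= r)) => [|x y|i _]; [lra | lra |]. Qed.

Lemma big_Rplus_le (n : nat) (F G : 'I_n -> R) : (forall i, F i <= G i) ->
  \big[Rplus/0]_(i < n) F i <= \big[Rplus/0]_(i < n) G i.
Proof. by move=> h; apply: (big_ind2 (fun r s => r <= s)) => [|*|i _]; [lra | lra |]. Qed.

Lemma big_Rplus_term (n : nat) (F : 'I_n -> R) (j : 'I_n) : (forall i, 0 <= F i) ->
  F j <= \big[Rplus/0]_(i < n) F i.
Proof.
move=> h; rewrite (bigD1 j) //=.
rewrite -[X in X <= _]Rplus_0_r; apply: Rplus_le_compat_l.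
by apply: (big_ind (fun r => 0 <= r)) => [|x y|i _]; [lra | lra |].
Qed.

Lemma big_Rplus_scal (n : nat) (c : R) (F : 'I_n -> R) :
  \big[Rplus/0]_(i < n) (c * F i) = c * \big[Rplus/0]_(i < n) F i.
Proof. by symmetry; apply: (big_morph (Rmult c)) => [x y|]; ring. Qed.

Lemma big_Rplus_const (n : nat) (c : R) : \big[Rplus/0]_(i < n) c = INR n * c.
Proof.
elim: n => [|n IH]; first by rewrite big_ord0 Rmult_0_l.
by rewrite big_ord_recr IH S_INR /=; ring.
Qed.

Lemma big_norm_le (V : NormedModule C_AbsRing) (n : nat) (F : 'I_n -> V) :
  norm (\big[plus/zero]_(i < n) F i) <= \big[Rplus/0]_(i < n) norm (F i).
Proof.
apply: (big_ind2 (fun (v : V) r => norm v <= r)) => [|v r w s hv hw|i _]; last lra.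
  by rewrite norm_zero; lra.
by apply: Rle_trans (norm_triangle _ _) _; apply: Rplus_le_compat.
Qed.

Lemma big_Cmod_le (n : nat) (F : 'I_n -> C) :
  Cmod (\big[Cplus/RtoC 0]_(i < n) F i) <= \big[Rplus/0]_(i < n) Cmod (F i).
Proof.
apply: (big_ind2 (fun v r => Cmod v <= r)) => [|v r w s hv hw|i _]; last lra.
  by rewrite Cmod_0; lra.
by apply: Rle_trans (Cmod_triangle _ _) _; apply: Rplus_le_compat.
Qed.

(** The discriminant argument, with the real parameter [t] at the mean value of the [a i]. *)
Lemma sum_sq_le (n : nat) (a : 'I_n -> R) :
  \big[Rplus/0]_(i < n) a i <= sqrt (INR n) * sqrt (\big[Rplus/0]_(i < n) a i ^ 2).
Proof.
case: n a => [|n] a; first by rewrite !big_ord0 sqrt_0; lra.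
set A := \big[Rplus/0]_(i < _) a i; set Q := \big[Rplus/0]_(i < _) a i ^ 2.
have hn : 0 < INR n.+1 by apply: lt_0_INR; apply/ltP.
have hQ : 0 <= Q by apply: big_Rplus_ge0 => i; exact: pow2_ge_0.
rewrite -sqrt_mult //; last lra.
apply: Rle_trans (Rle_abs _) _.
rewrite -sqrt_Rsqr_abs; apply: sqrt_le_1_alt; rewrite Rsqr_pow2.
have key t : 0 <= Q - 2 * t * A + INR n.+1 * t ^ 2.
  have -> : Q - 2 * t * A + INR n.+1 * t ^ 2 = \big[Rplus/0]_(i < n.+1) (a i - t) ^ 2.
    rewrite -big_Rplus_const /A /Q /Rminus Ropp_mult_distr_l -big_Rplus_scal -!big_split /=.
    by apply: eq_bigr => i _; ring.
  by apply: big_Rplus_ge0 => i; exact: pow2_ge_0.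
have := key (A / INR n.+1).
have -> : Q - 2 * (A / INR n.+1) * A + INR n.+1 * (A / INR n.+1) ^ 2 = Q - A ^ 2 / INR n.+1 by field; lra.
move=> h; have : A ^ 2 / INR n.+1 <= Q by lra.
by move/Rle_div_l => /(_ hn); lra.
Qed.

(** * Hilbert spaces *)

Section Hilbert.
Variable H : HilbertSpace.
Implicit Types x y z : H.

Lemma inner_plus_r x y z : inner x (plus y z) = Cplus (inner x y) (inner x z).
Proof. by rewrite (inner_conj (plus y z) x) inner_plus_l Cplus_conj -!inner_conj. Qed.

Lemma inner_scal_r (k : C) x y : inner x (scal (k : C_AbsRing) y) = Cmult (Cconj k) (inner x y).
Proof. by rewrite (inner_conj (scal (k : C_AbsRing) y) x) inner_scal_l Cmult_conj -inner_conj. Qed.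

Lemma inner_zero_l x : inner (zero : H) x = RtoC 0.
Proof. by rewrite -(scal_zero_l (K := C_AbsRing) (zero : H)) inner_scal_l; exact: Cmult_0_l. Qed.

Lemma norm_sq_inner x : norm x ^ 2 = Re (inner x x).
Proof. by rewrite inner_norm. Qed.

Lemma norm_sq_plus x y : norm (plus x y) ^ 2 = norm x ^ 2 + 2 * Re (inner x y) + norm y ^ 2.
Proof.
rewrite !norm_sq_inner inner_plus_l !inner_plus_r (inner_conj x y).
by case: (inner x y) => a b; rewrite /Re /=; ring.
Qed.

Lemma norm_sq_scal (k : C) x : norm (scal (k : C_AbsRing) x) ^ 2 = Cmod k ^ 2 * norm x ^ 2.
Proof.
rewrite norm_sq_inner inner_scal_l inner_scal_r inner_norm Cmod2_alt.
by case: k => a b; rewrite /Re /Im /=; ring.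
Qed.

(** Positivity of [|x - t <x, y> y| ^ 2] for every real [t]. *)
Lemma cauchy_schwarz x y : Cmod (inner x y) <= norm x * norm y.
Proof.
have hx := norm_ge_0 x; have hy := norm_ge_0 y.
have key (t : R) : 0 <= norm x ^ 2 - 2 * t * Cmod (inner x y) ^ 2
    + t ^ 2 * Cmod (inner x y) ^ 2 * norm y ^ 2.
  have := pow2_ge_0 (norm (plus x (scal (Cmult (RtoC (- t)) (inner x y) : C_AbsRing) y))).
  rewrite norm_sq_plus norm_sq_scal inner_scal_r Cmod_mult Cmod_R Rpow_mult_distr pow2_abs.
  rewrite (Cmod2_alt (inner x y)).
  by case: (inner x y) => a b; rewrite /Re /Im /= => h; nra.
have hi := Cmod_ge_0 (inner x y).
apply: Rsqr_incr_0_var; last exact: Rmult_le_pos.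
rewrite !Rsqr_pow2 Rpow_mult_distr.
set I := Cmod (inner x y) ^ 2 in key *.
have hI : 0 <= I by exact: pow2_ge_0.
case: (Req_dec (norm y) 0) => hy0.
  have hy1 := norm_eq_zero _ hy0.
  by rewrite /I hy1 inner_conj inner_zero_l Cmod_conj Cmod_0 norm_zero; lra.
have hy2 : 0 < norm y ^ 2 by apply: pow_lt; lra.
have := key (/ norm y ^ 2).
have -> : norm x ^ 2 - 2 * / norm y ^ 2 * I + (/ norm y ^ 2) ^ 2 * I * norm y ^ 2 = norm x ^ 2 - I / norm y ^ 2.
  by field.
move=> h; have : I / norm y ^ 2 <= norm x ^ 2 by lra.
by move/Rle_div_l => /(_ hy2).
Qed.

Definition orthonormal_family (n : nat) (e : 'I_n -> H) : Prop :=
  forall i j, inner (e i) (e j) = if i == j then RtoC 1 else RtoC 0.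

Lemma orthonormal_family_norm n (e : 'I_n -> H) i : orthonormal_family n e -> norm (e i) = 1.
Proof.
move=> he; have h : norm (e i) ^ 2 = 1 by rewrite norm_sq_inner he eqxx.
by have := norm_ge_0 (e i); nra.
Qed.

Lemma inner_sum_l n (F : 'I_n -> H) y :
  inner (\big[plus/zero]_(i < n) F i) y = \big[Cplus/RtoC 0]_(i < n) inner (F i) y.
Proof.
apply: (big_morph (fun v : H => inner v y)); last exact: inner_zero_l.
by move=> v w; exact: inner_plus_l.
Qed.

(** Evaluate [phi] at [a = sum_i conj (phi (e i)) e_i]: both [phi a] and [|a| ^ 2] are equal
    to the sum [S], so [S <= M * sqrt S]. *)
Lemma bessel n (e : 'I_n -> H) (phi : H -> C) (M : R) : orthonormal_family n e ->
  (forall x y, phi (plus x y) = Cplus (phi x) (phi y)) ->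
  (forall (k : C) x, phi (scal (k : C_AbsRing) x) = Cmult k (phi x)) ->
  (forall x, Cmod (phi x) <= M * norm x) ->
  \big[Rplus/0]_(i < n) Cmod (phi (e i)) ^ 2 <= M ^ 2.
Proof.
move=> he phiD phiZ phiM.
pose a := \big[plus/zero]_(i < n) scal (Cconj (phi (e i)) : C_AbsRing) (e i).
set S := \big[Rplus/0]_(i < n) _.
have sq (c : C) : Cmult (Cconj c) c = RtoC (Cmod c ^ 2).
  by rewrite Cmod2_alt; case: c => u v; rewrite /Cmult /RtoC /Re /Im /=; congr pair; ring.
have hae j : inner a (e j) = Cconj (phi (e j)).
  rewrite inner_sum_l (bigD1 j) //= big1 ?Cplus_0_r.
    by rewrite inner_scal_l he eqxx Cmult_1_r.
  by move=> i /negbTE hij; rewrite inner_scal_l he hij Cmult_0_r.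
have RtoC_sum (F : 'I_n -> R) : RtoC (\big[Rplus/0]_(i < n) F i) = \big[Cplus/RtoC 0]_(i < n) RtoC (F i).
  by apply: (big_morph RtoC) => // x y; rewrite RtoC_plus.
have haa : norm a ^ 2 = S.
  suff : inner a a = RtoC S by rewrite inner_norm; case.
  rewrite {1}/a inner_sum_l RtoC_sum; apply: eq_bigr => i _.
  by rewrite inner_scal_l inner_conj hae Cconj_conj sq.
have hphi : phi a = RtoC S.
  rewrite RtoC_sum (big_morph phi (id1 := RtoC 0) (op1 := Cplus)) => [|//|].
    by apply: eq_bigr => i _; rewrite phiZ sq.
  by rewrite -(scal_zero_l (K := C_AbsRing) (zero : H)) phiZ; exact: Cmult_0_l.
have hS : 0 <= S by rewrite -haa; exact: pow2_ge_0.
have := phiM a; rewrite hphi Cmod_R Rabs_pos_eq // => hM.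
have : S ^ 2 <= (M * norm a) ^ 2 by apply: pow_incr; lra.
rewrite Rpow_mult_distr haa => h2.
by have := pow2_ge_0 M; case: (Rle_lt_dec S 0); nra.
Qed.

End Hilbert.

Lemma polarization (X : ModuleSpace C_AbsRing) (H K : HilbertSpace) (A : X -> H) (B : X -> K) :
  (forall x y, A (plus x y) = plus (A x) (A y)) ->
  (forall (k : C_AbsRing) x, A (scal k x) = scal k (A x)) ->
  (forall x y, B (plus x y) = plus (B x) (B y)) ->
  (forall (k : C_AbsRing) x, B (scal k x) = scal k (B x)) ->
  (forall x, norm (A x) = norm (B x)) ->
  forall x y, inner (A x) (A y) = inner (B x) (B y).
Proof.
move=> AD AZ BD BZ hAB.
have hre x y : Re (inner (A x) (A y)) = Re (inner (B x) (B y)).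
  have := norm_sq_plus _ (A x) (A y); have := norm_sq_plus _ (B x) (B y).
  by rewrite -AD -BD !hAB; lra.
move=> x y; have := hre x y; have := hre (scal (Ci : C_AbsRing) x) y.
rewrite AZ BZ !inner_scal_l.
case: (inner (A x) (A y)) (inner (B x) (B y)) => [a b] [c d].
by rewrite /Re /= => h1 h2; congr pair; lra.
Qed.

(** * Coordinates in the space of square summable sequences *)

Lemma Series_single (a : nat -> R) (j : nat) : (forall k, k != j -> a k = 0) -> Series a = a j.
Proof.
move=> h; apply: is_series_unique; apply: (filterlim_ext_loc (fun _ => a j)); last exact: filterlim_const.
have hs n : sum_n a n = if (j <= n)%N then a j else 0.
  elim: n => [|n IH].
    by rewrite sum_O leqn0; case: eqP => [->//|/eqP hj]; apply: h; rewrite eq_sym.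
  rewrite sum_Sn IH [(j <= n.+1)%N]leq_eqVlt ltnS; case: eqP => [->|/eqP hj] /=.
    by rewrite ltnn /plus /= Rplus_0_l.
  by rewrite (h n.+1) ?/plus /= ?Rplus_0_r // eq_sym.
by exists j => n /leP hn; rewrite hs hn.
Qed.

Lemma inner_delta (x : ell2) (j : nat) : inner x (ell2_delta j) = ell2_coord x j.
Proof.
have hd k : ell2_coord (ell2_delta j) k = if k == j then RtoC 1 else RtoC 0 by [].
change (ell2_inner x (ell2_delta j) = ell2_coord x j); rewrite /ell2_inner.
rewrite (Series_single _ j) => [|k /negbTE hk]; last by rewrite hd hk /Re /=; ring.
rewrite (Series_single _ j) => [|k /negbTE hk]; last by rewrite hd hk /Im /=; ring.
by rewrite !hd eqxx; case: (ell2_coord x j) => a b; rewrite /Re /Im /=; congr pair; ring.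
Qed.

Lemma delta_orthonormal n : orthonormal_family ell2 n (fun i => ell2_delta i).
Proof.
move=> i j; rewrite inner_delta.
by change ((if (j == i :> nat) then RtoC 1 else RtoC 0) = if i == j then RtoC 1 else RtoC 0); rewrite eq_sym.
Qed.

Lemma norm_delta j : norm (ell2_delta j : ell2) = 1.
Proof.
have := orthonormal_family_norm ell2 j.+1 (fun i => ell2_delta i) ord_max (delta_orthonormal _).
by [].
Qed.

Lemma coord_le (h : ell2) k : Cmod (ell2_coord h k) <= norm h.
Proof. exact: ell2_coord_le. Qed.

(** * Columns in interpolation spaces *)

Section Interpolation.
Variables (X0 X1 : OpSpace) (phi : X0 -> X1) (theta : R).
Hypotheses (htheta : 0 <= theta <= 1)
  (phiZ : forall (k : C_AbsRing) x, phi (scal k x) = scal k (phi x))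
  (hp0 : forall n, prenorm (os_mnorm X0 n)) (hp1 : forall n, prenorm (os_mnorm X1 n)).

Let N1 n (y : Mn n X0) := os_mnorm X1 n (fun i j => phi (y i j)).

Lemma transported_prenorm n : prenorm (@N1 n).
Proof.
split=> [w|k w]; first exact: (proj1 (hp1 n)).
rewrite /N1; apply: Rle_trans (proj2 (hp1 n) k _); right; congr (os_mnorm X1 n _).
by do 2![apply: functional_extensionality => ?]; exact: phiZ.
Qed.

Lemma interp_norm_le n lam m (w : Mn n X0) :
  os_mnorm X0 n w <= m -> os_mnorm X1 n (fun i j => phi (w i j)) <= exp lam * m ->
  os_mnorm (interp_os phi theta) n w <= exp (lam * theta) * m.
Proof.
move=> h0 h1; rewrite /interp_os /=.
case: Req_EM_T => [e|_] /=; first by rewrite e Rmult_0_r exp_0 Rmult_1_l.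
case: Req_EM_T => [e|_] /=; first by rewrite e Rmult_1_r.
exact: (calderon_norm_le _ _ _ lam theta (hp0 n) (transported_prenorm n)).
Qed.

Lemma interp_norm_ge n lam (psi : Mn n X0 -> C) (w : Mn n X0) :
  (forall v w, psi (plus v w) = Cplus (psi v) (psi w)) ->
  (forall (k : C) w, psi (scal (k : C_AbsRing) w) = Cmult k (psi w)) ->
  (forall w, Cmod (psi w) <= os_mnorm X0 n w) ->
  (forall w, exp lam * Cmod (psi w) <= os_mnorm X1 n (fun i j => phi (w i j))) ->
  exp (lam * theta) * Cmod (psi w) <= os_mnorm (interp_os phi theta) n w.
Proof.
move=> psiD psiZ h0 h1; rewrite /interp_os /=.
case: Req_EM_T => [e|_] /=; first by rewrite e Rmult_0_r exp_0 Rmult_1_l.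
case: Req_EM_T => [e|_] /=; first by rewrite e Rmult_1_r.
exact: (calderon_norm_ge _ _ _ lam theta (hp0 n) (transported_prenorm n) psi w htheta psiD psiZ h0 h1).
Qed.

Variable V : X0 -> ell2.
Hypotheses (phi_iso : forall x, os_norm (phi x) = os_norm x)
  (V_iso : linear_isometry_onto (@os_norm X0) (fun y : ell2 => norm y) V).
Hypothesis entry_le : forall n (w : Mn n X0) i j, os_norm (w i j) <= os_mnorm X0 n w.
Hypothesis column_le : forall n (w : Mn n X1) j,
  \big[Rplus/0]_(i < n) os_norm (w i j) ^ 2 <= os_mnorm X1 n w ^ 2.

(** Both end norms of a 1-by-1 matrix are the Hilbert norm, and pairing with the normalized
    vector is a functional that attains it. Hence an orthonormal family of the interpolation
    space has the same meaning as one of the first end space. *)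
Lemma interp_os_norm x : os_norm (x : interp_os phi theta) = norm (V x).
Proof.
apply: Rle_antisym.
  have := @interp_norm_le 1%N 0 (norm (V x)) (fun _ _ => x).
  rewrite Rmult_0_l exp_0 !Rmult_1_l; apply; rewrite (iso_norm V_iso); first exact: Rle_refl.
  by rewrite -phi_iso; exact: Rle_refl.
case: (Req_dec (norm (V x)) 0) => hx.
  rewrite hx.
  have := @interp_norm_ge 1%N 0 (fun _ => RtoC 0) (fun _ _ => x).
  rewrite Rmult_0_l exp_0 Rmult_1_l Cmod_0; apply.
  - by move=> *; rewrite Cplus_0_r.
  - by move=> *; rewrite Cmult_0_r.
  - by move=> w; exact: (proj1 (hp0 1%N)).
  - by move=> w; rewrite ?Rmult_0_r ?Rmult_1_l; exact: (proj1 (hp1 1%N)).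
have hpos : 0 < norm (V x) by have := norm_ge_0 (V x); lra.
have r0 : 0 < / norm (V x) by exact: Rinv_0_lt_compat.
pose psi (w : Mn 1 X0) := Cmult (RtoC (/ norm (V x))) (inner (V (w ord0 ord0)) (V x)).
have hpsi w : Cmod (psi w) <= os_norm (w ord0 ord0).
  rewrite /psi Cmod_mult Cmod_R Rabs_pos_eq; last lra.
  have := Rmult_le_compat_l _ _ _ (Rlt_le _ _ r0) (cauchy_schwarz _ (V (w ord0 ord0)) (V x)).
  have -> : / norm (V x) * (norm (V (w ord0 ord0)) * norm (V x)) = norm (V (w ord0 ord0)) by field.
  by rewrite -(iso_norm V_iso (w ord0 ord0)).
have := @interp_norm_ge 1%N 0 psi (fun _ _ => x).
rewrite Rmult_0_l exp_0 Rmult_1_l /psi inner_norm Cmod_mult !Cmod_R Rabs_pos_eq; last lra.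
rewrite Rabs_pos_eq; last exact: pow2_ge_0.
have -> : / norm (V x) * norm (V x) ^ 2 = norm (V x) by field.
apply.
- move=> v w; change ((plus v w : Mn 1 X0) ord0 ord0) with (plus (v ord0 ord0) (w ord0 ord0)).
  by rewrite (iso_plus V_iso) inner_plus_l Cmult_plus_distr_l.
- move=> k w; change ((scal (k : C_AbsRing) w : Mn 1 X0) ord0 ord0) with (scal (k : C_AbsRing) (w ord0 ord0)).
  by rewrite (iso_scal V_iso) inner_scal_l; ring.
- by move=> w; exact: Rle_trans (hpsi w) (entry_le _ _ _ _).
- move=> w; rewrite Rmult_1_l; apply: Rle_trans (hpsi w) _.
  rewrite -phi_iso; have := column_le 1%N (fun i j => phi (w i j)) ord0.
  rewrite big_ord1 => h; apply: Rsqr_incr_0_var; last exact: (proj1 (hp1 1%N)).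
  by rewrite !Rsqr_pow2.
Qed.

(* The bounds for the column [e] come from orthonormality at the first end space, and from
   the norms of its entries alone at the second one. *)
Hypothesis orthonormal_column_le : forall n (e : 'I_n -> X0),
  orthonormal_family ell2 n (fun i => V (e i)) -> os_mnorm X0 n (first_column e) <= 1.
Hypothesis contractive_column_le : forall n (e : 'I_n -> X1),
  (forall i, os_norm (e i) <= 1) -> os_mnorm X1 n (first_column e) <= sqrt (INR n).

(** An orthonormal family for the interpolation space is one for [V], since both
    coordinate maps preserve the same norm; then the functional [psi] below and the column
    itself give matching bounds. *)
Theorem kappa_interp n : (0 < n)%N ->
  is_kappa n (interp_os phi theta) (Rpower (INR n) (theta / 2)).
Proof.
move=> hn; split.
  have hsurj (i : 'I_n) : exists x : X0, V x = ell2_delta i := iso_onto V_iso (ell2_delta i).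
  exists (fun i => proj1_sig (constructive_indefinite_description _ (hsurj i))).
  exists ell2, V; split.
    split; [exact: (iso_plus V_iso) | exact: (iso_scal V_iso) | | exact: (iso_onto V_iso)].
    by move=> x; rewrite interp_os_norm.
  move=> i j; case: constructive_indefinite_description => x /= ->.
  by case: constructive_indefinite_description => y /= ->; exact: delta_orthonormal.
move=> e [K [U [hU he]]].
have hVe : orthonormal_family ell2 n (fun i => V (e i)).
  move=> i j; rewrite -he; apply: sym_eq; apply: (polarization X0).
  - exact: (iso_plus hU).
  - exact: (iso_scal hU).
  - exact: (iso_plus V_iso).
  - exact: (iso_scal V_iso).
  - by move=> x; rewrite (iso_norm hU) interp_os_norm.
have hnR : 0 < INR n by apply: lt_0_INR; apply/ltP.
pose lam := ln (INR n) / 2.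
have hlam : exp lam = sqrt (INR n).
  have hh : exp lam ^ 2 = INR n.
    by rewrite /= Rmult_1_r -exp_plus /lam -[RHS]exp_ln //; congr exp; field.
  by rewrite -hh sqrt_pow2 //; exact: Rlt_le (exp_pos _).
have -> : Rpower (INR n) (theta / 2) = exp (lam * theta).
  by rewrite /Rpower /lam; congr exp; field.
have hV i : norm (V (e i)) = 1 by exact: orthonormal_family_norm hVe.
have phi0 : phi zero = zero by rewrite -(scal_zero_l (K := C_AbsRing) zero) phiZ scal_zero_l.
apply: Rle_antisym.
  rewrite -[X in _ <= X]Rmult_1_r; apply: interp_norm_le; first exact: orthonormal_column_le.
  rewrite hlam Rmult_1_r.
  have -> : (fun i j => phi (first_column (X := interp_os phi theta) e i j)) = first_column (fun i => phi (e i)).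
    do 2!apply: functional_extensionality => ?; rewrite /first_column.
    by case: ifP => // _; exact: phi0.
  by apply: contractive_column_le => i; rewrite phi_iso -(iso_norm V_iso) hV; lra.
pose j0 := Ordinal hn.
pose psi (w : Mn n X0) := Cmult (RtoC (/ INR n)) (\big[Cplus/RtoC 0]_(i < n) inner (V (w i j0)) (V (e i))).
have rn : 0 < / INR n by exact: Rinv_0_lt_compat.
have hpsi w : Cmod (psi w) <= / INR n * \big[Rplus/0]_(i < n) os_norm (w i j0).
  rewrite /psi Cmod_mult Cmod_R Rabs_pos_eq; last lra.
  apply: Rmult_le_compat_l; first lra.
  apply: Rle_trans (big_Cmod_le _ _) _; apply: big_Rplus_le => i.
  by apply: Rle_trans (cauchy_schwarz _ _ _) _; rewrite hV Rmult_1_r (iso_norm V_iso); lra.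
have -> : exp (lam * theta) = exp (lam * theta) * Cmod (psi (first_column (X := X0) e)).
  suff -> : psi (first_column (X := X0) e) = RtoC 1 by rewrite Cmod_1 Rmult_1_r.
  rewrite /psi (eq_bigr (fun _ => RtoC 1)); last first.
    by move=> i _; change (first_column (X := X0) e i j0) with (e i); rewrite inner_norm hV; congr RtoC; ring.
  have -> : \big[Cplus/RtoC 0]_(i < n) RtoC 1 = RtoC (INR n).
    rewrite -(Rmult_1_r (INR n)) -big_Rplus_const; symmetry.
    by apply: (big_morph RtoC) => // x y; rewrite RtoC_plus.
  by rewrite -RtoC_mult; congr RtoC; field; lra.
apply: interp_norm_ge.
- move=> v w; rewrite /psi -Cmult_plus_distr_l -big_split; congr Cmult; apply: eq_bigr => i _.
  change ((plus v w : Mn n X0) i j0) with (plus (v i j0) (w i j0)).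
  by rewrite (iso_plus V_iso) inner_plus_l.
- move=> k w; rewrite /psi Cmult_assoc (Cmult_comm k) -Cmult_assoc; congr Cmult.
  rewrite (big_morph (Cmult k) (id1 := RtoC 0) (op1 := Cplus)); last exact: Cmult_0_r.
    by apply: eq_bigr => i _; rewrite -inner_scal_l -(iso_scal V_iso).
  by move=> x y; exact: Cmult_plus_distr_l.
- move=> w; apply: Rle_trans (hpsi w) _.
  have : \big[Rplus/0]_(i < n) os_norm (w i j0) <= INR n * os_mnorm X0 n w.
    by rewrite -big_Rplus_const; apply: big_Rplus_le => i; exact: entry_le.
  move=> h; have := Rmult_le_compat_l _ _ _ (Rlt_le _ _ rn) h.
  by rewrite -Rmult_assoc Rinv_l ?Rmult_1_l //; lra.
- move=> w; rewrite hlam.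
  set M := os_mnorm X1 n _.
  have M0 : 0 <= M by exact: (proj1 (hp1 n)).
  have hs := sqrt_pos (INR n).
  have hsum : \big[Rplus/0]_(i < n) os_norm (w i j0) <= sqrt (INR n) * M.
    apply: Rle_trans (sum_sq_le _ _) _; apply: Rmult_le_compat_l => //.
    rewrite -(sqrt_pow2 M) //; apply: sqrt_le_1_alt.
    apply: Rle_trans (column_le n (fun i j => phi (w i j)) j0); right.
    by apply: eq_bigr => i _; rewrite phi_iso.
  have h1 := Rmult_le_compat_l _ _ _ hs (Rle_trans _ _ _ (hpsi w) (Rmult_le_compat_l _ _ _ (Rlt_le _ _ rn) hsum)).
  apply: Rle_trans h1 _; right.
  have -> : sqrt (INR n) * (/ INR n * (sqrt (INR n) * M)) = (sqrt (INR n) * sqrt (INR n)) * / INR n * M by ring.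
  by rewrite sqrt_sqrt; [field | ]; lra.
Qed.

End Interpolation.

(** * Norms of operator matrices *)

Lemma norm_normalize (V : NormedModule C_AbsRing) (x : V) : norm x <> 0 ->
  norm (scal (RtoC (/ norm x) : C_AbsRing) x) <= 1.
Proof.
move=> hx; have h0 := norm_ge_0 x.
apply: Rle_trans (norm_scal _ _) _; change (Cmod (RtoC (/ norm x)) * norm x <= 1).
rewrite Cmod_R Rabs_pos_eq; last by apply: Rlt_le; apply: Rinv_0_lt_compat; lra.
by rewrite Rinv_l //; lra.
Qed.

Lemma scal_normalize (V : ModuleSpace C_AbsRing) (r : R) (x : V) : r <> 0 ->
  scal (RtoC r : C_AbsRing) (scal (RtoC (/ r) : C_AbsRing) x) = x.
Proof.
move=> hr; rewrite scal_assoc; change (scal (Cmult (RtoC r) (RtoC (/ r)) : C_AbsRing) x = x).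
by rewrite -RtoC_mult Rinv_r //; exact: scal_one.
Qed.

Lemma opnorm_apply (U V : NormedModule C_AbsRing) (T : U -> V) (x : U) :
  is_linear T -> norm (T x) <= opnorm T * norm x.
Proof.
move=> hT; have [TD TZ [M [M0 hM]]] := hT.
case: (Req_dec (norm x) 0) => hx.
  by apply: Rle_trans (hM x) _; rewrite hx; lra.
have h0 := norm_ge_0 x.
rewrite -{1}(scal_normalize _ _ x hx) TZ; apply: Rle_trans (norm_scal _ _) _.
change (Cmod (RtoC (norm x)) * norm (T (scal (RtoC (/ norm x) : C_AbsRing) x)) <= opnorm T * norm x).
rewrite Cmod_R Rabs_pos_eq // Rmult_comm; apply: Rmult_le_compat_r => //.
apply: (Sup_ub _ M); last by exists (scal (RtoC (/ norm x) : C_AbsRing) x); split; first exact: norm_normalize.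
move=> r [y [hy ->]]; apply: Rle_trans (hM y) _.
by rewrite -{2}(Rmult_1_r M); apply: Rmult_le_compat_l; lra.
Qed.

Lemma op_fun_le (H : HilbertSpace) (T : bounded_op H) (x : H) :
  norm (op_fun T x) <= opnorm (op_fun T) * norm x.
Proof. exact: opnorm_apply (proj2_sig T). Qed.

Lemma opnorm_ge0 (H : HilbertSpace) (T : bounded_op H) : 0 <= opnorm (op_fun T).
Proof.
apply: Rle_trans (opnorm_ub (H := H) T (x := zero) _); first exact: norm_ge_0.
by rewrite norm_zero; lra.
Qed.

Section MatrixNorm.
Variables (V : NormedModule C_AbsRing) (n : nat).
Implicit Types (T : 'I_n -> 'I_n -> V -> V) (h : 'I_n -> V) (b : 'I_n -> 'I_n -> R).

(** The unit ball of the Hilbertian direct sum of [n] copies of [V]. *)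
Definition in_ball h : Prop := \big[Rplus/0]_(j < n) norm (h j) ^ 2 <= 1.

Definition mx_image_norm T h : R :=
  sqrt (\big[Rplus/0]_(i < n) norm (\big[plus/zero]_(j < n) T i j (h j)) ^ 2).

Definition entry_bounded T b : Prop := forall i j x, norm (T i j x) <= b i j * norm x.

(** A crude bound of the norm through bounds of the entries. It makes the suprema that define
    the matrix norms finite, so that each of them is an upper bound of its set. *)
Definition mx_bound b : R := sqrt (\big[Rplus/0]_(i < n) (\big[Rplus/0]_(j < n) Rabs (b i j)) ^ 2).

Lemma in_ball_coord h j : in_ball h -> norm (h j) <= 1.
Proof.
move=> hh; have := big_Rplus_term n (fun j => norm (h j) ^ 2) j (fun i => pow2_ge_0 _).
by have := norm_ge_0 (h j); move: hh; rewrite /in_ball; nra.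
Qed.

Lemma mx_image_norm_le T b h : entry_bounded T b -> in_ball h -> mx_image_norm T h <= mx_bound b.
Proof.
move=> hb hh; apply: sqrt_le_1_alt; apply: big_Rplus_le => i; apply: pow_incr.
split; first exact: norm_ge_0.
apply: Rle_trans (big_norm_le _ _ _) _; apply: big_Rplus_le => j.
apply: Rle_trans (hb i j (h j)) _.
have := in_ball_coord h j hh; have := norm_ge_0 (h j); have := Rle_abs (b i j); have := Rabs_pos (b i j); nra.
Qed.

Lemma in_ball_zero : in_ball (fun=> zero).
Proof. by rewrite /in_ball big1 => [|i _]; rewrite ?norm_zero /=; lra. Qed.

Lemma mx_opnorm_set_nonempty T : exists r, exists h, in_ball h /\ r = mx_image_norm T h.
Proof. by exists (mx_image_norm T (fun=> zero)), (fun=> zero); split; first exact: in_ball_zero. Qed.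

Lemma mx_opnorm_le T M : (forall h, in_ball h -> mx_image_norm T h <= M) -> mx_opnorm T <= M.
Proof.
move=> hM; apply: Sup_le; first exact: mx_opnorm_set_nonempty.
by move=> r [h [hh ->]]; exact: hM.
Qed.

Lemma mx_opnorm_ge T b h : entry_bounded T b -> in_ball h -> mx_image_norm T h <= mx_opnorm T.
Proof.
move=> hb hh; apply: (Sup_ub _ (mx_bound b)); last by exists h.
by move=> r [h' [hh' ->]]; exact: mx_image_norm_le.
Qed.

Lemma mx_opnorm_le_bound T b : entry_bounded T b -> mx_opnorm T <= mx_bound b.
Proof. by move=> hb; apply: mx_opnorm_le => h; exact: mx_image_norm_le. Qed.

Lemma mx_opnorm_ge0 T b : entry_bounded T b -> 0 <= mx_opnorm T.
Proof. by move=> hb; apply: Rle_trans (mx_opnorm_ge T b _ hb in_ball_zero); exact: sqrt_pos. Qed.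

Lemma mx_opnorm_scal T b (k : C) : entry_bounded T b ->
  mx_opnorm (fun i j x => scal (k : C_AbsRing) (T i j x)) <= Cmod k * mx_opnorm T.
Proof.
move=> hb; apply: mx_opnorm_le => h hh.
apply: Rle_trans (Rmult_le_compat_l _ _ _ (Cmod_ge_0 k) (mx_opnorm_ge T b h hb hh)).
rewrite -{1}(sqrt_pow2 (Cmod k)); last exact: Cmod_ge_0.
rewrite -sqrt_mult; [|exact: pow2_ge_0|by apply: big_Rplus_ge0 => i; exact: pow2_ge_0].
apply: sqrt_le_1_alt; rewrite -big_Rplus_scal; apply: big_Rplus_le => i.
rewrite -Rpow_mult_distr; apply: pow_incr; split; first exact: norm_ge_0.
rewrite -(big_morph (scal (k : C_AbsRing)) (scal_distr_l _) (scal_zero_r _)).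
exact: norm_scal.
Qed.

Definition at_index (j : 'I_n) (x : V) : 'I_n -> V := fun i => if i == j then x else zero.

Lemma in_ball_at_index j x : norm x <= 1 -> in_ball (at_index j x).
Proof.
move=> hx; rewrite /in_ball (bigD1 j) //= big1 => [|i /negbTE hi]; last first.
  by rewrite /at_index hi norm_zero /=; ring.
by rewrite /at_index eqxx; have := norm_ge_0 x; rewrite /=; nra.
Qed.

Lemma mx_column_ge T b (j : 'I_n) (x : V) : entry_bounded T b -> norm x <= 1 ->
  \big[Rplus/0]_(i < n) norm (T i j x) ^ 2 <= mx_opnorm T ^ 2.
Proof.
move=> hb hx.
have h0 : 0 <= \big[Rplus/0]_(i < n) norm (T i j x) ^ 2 by apply: big_Rplus_ge0 => i; exact: pow2_ge_0.
have := mx_opnorm_ge T b _ hb (in_ball_at_index j x hx); rewrite /mx_image_norm.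
have -> : \big[Rplus/0]_(i < n) norm (\big[plus/zero]_(k < n) T i k (at_index j x k)) ^ 2 =
    \big[Rplus/0]_(i < n) norm (T i j x) ^ 2.
  apply: eq_bigr => i _; rewrite (bigD1 j) //= big1 => [|k /negbTE hk].
    by rewrite plus_zero_r /at_index eqxx.
  rewrite /at_index hk; apply: norm_eq_zero; apply: Rle_antisym (norm_ge_0 _).
  by apply: Rle_trans (hb i k zero) _; rewrite norm_zero; lra.
by move=> h; rewrite -(pow2_sqrt _ h0); apply: pow_incr; split; first exact: sqrt_pos.
Qed.

Lemma mx_entry_ge T b (i j : 'I_n) (x : V) : entry_bounded T b -> norm x <= 1 ->
  norm (T i j x) <= mx_opnorm T.
Proof.
move=> hb hx; apply: Rsqr_incr_0_var; last exact: mx_opnorm_ge0 hb.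
rewrite !Rsqr_pow2; apply: Rle_trans (mx_column_ge T b j x hb hx).
exact: (big_Rplus_term n (fun i => norm (T i j x) ^ 2) i (fun i => pow2_ge_0 _)).
Qed.

End MatrixNorm.

Lemma mx_first_column_le (V : NormedModule C_AbsRing) (n : nat) (T : 'I_n -> 'I_n -> V -> V)
    (M : R) (t : 'I_n -> V -> V) :
  (forall i j x, T i j x = if (j == 0%N :> nat) then t i x else zero) ->
  (forall x, norm x <= 1 -> \big[Rplus/0]_(i < n) norm (t i x) ^ 2 <= M) ->
  mx_opnorm T <= sqrt M.
Proof.
move=> hT ht; apply: mx_opnorm_le => h hh; apply: sqrt_le_1_alt.
case: n T t hT ht h hh => [|m] T t hT ht h hh.
  by rewrite big_ord0; have := ht zero; rewrite big_ord0 norm_zero; apply; lra.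
apply: Rle_trans (ht (h ord0) _); last by apply: in_ball_coord.
right; apply: eq_bigr => i _; rewrite (bigD1 ord0) //= big1 => [|k hk].
  by rewrite plus_zero_r hT.
by rewrite hT; case: ifP => // h0; case/eqP: hk; apply: val_inj; apply/eqP.
Qed.

(** * Column operators *)

Lemma col_op_linear (x : ell2) : is_linear (fun h : ell2 => scal (ell2_coord h 0 : C_AbsRing) x).
Proof.
split=> [y z|k y|].
- exact: scal_distr_r.
- exact: (esym (scal_assoc _ _ _)).
- exists (norm x + 1); split; first by have := norm_ge_0 x; lra.
  move=> h; apply: Rle_trans (norm_scal _ _) _.
  change (Cmod (ell2_coord h 0) * norm x <= (norm x + 1) * norm h).
  by have := coord_le h 0; have := Cmod_ge_0 (ell2_coord h 0); have := norm_ge_0 x; nra.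
Qed.

Definition col_op (x : ell2) : bounded_op ell2 := exist _ _ (col_op_linear x).

Lemma opnorm_col_op_le x : opnorm (op_fun (col_op x)) <= norm x.
Proof.
apply: opnorm_lub => h hh; apply: Rle_trans (norm_scal _ _) _.
change (Cmod (ell2_coord h 0) * norm x <= norm x).
by have := coord_le h 0; have := Cmod_ge_0 (ell2_coord h 0); have := norm_ge_0 x; nra.
Qed.

Lemma col_op_delta x : op_fun (col_op x) (ell2_delta 0) = x.
Proof. exact: (scal_one (K := C_AbsRing)). Qed.

(** * The minimal structure *)

Section Min.
Variable n : nat.
Implicit Types (x : Mn n (min_os ell2)) (phi : ell2 -> C_NormedModule).

Definition contraction (phi : ell2 -> C_NormedModule) : Prop := is_linear phi /\ opnorm phi <= 1.

Lemma contraction_le phi y : contraction phi -> Cmod (phi y) <= norm y.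
Proof.
move=> [h1 h2]; apply: Rle_trans (opnorm_apply _ _ phi y h1) _.
by have := norm_ge_0 y; nra.
Qed.

Lemma contraction_intro phi : (forall y z, phi (plus y z) = plus (phi y) (phi z)) ->
  (forall k y, phi (scal k y) = scal k (phi y)) -> (forall y, Cmod (phi y) <= norm y) ->
  contraction phi.
Proof.
move=> hD hZ hle; split.
  by split=> //; exists 1; split; [lra | move=> y; rewrite Rmult_1_l; exact: hle].
apply: Sup_le; first by exists (norm (phi zero)), zero; rewrite norm_zero; split; first lra.
by move=> r [y [hy ->]]; apply: Rle_trans (hle y) hy.
Qed.

Definition apply_entries phi x : 'I_n -> 'I_n -> C_NormedModule -> C_NormedModule :=
  fun i j c => Cmult (phi (x i j)) c.

Lemma apply_entries_bounded phi x : contraction phi ->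
  entry_bounded _ n (apply_entries phi x) (fun i j => norm (x i j : ell2)).
Proof.
move=> hphi i j c; change (Cmod (Cmult (phi (x i j)) c) <= norm (x i j : ell2) * Cmod c).
by rewrite Cmod_mult; apply: Rmult_le_compat_r; [exact: Cmod_ge_0 | exact: contraction_le].
Qed.

Lemma min_norm_ge phi x : contraction phi -> mx_opnorm (apply_entries phi x) <= os_mnorm (min_os ell2) n x.
Proof.
move=> hphi; apply: (Sup_ub _ (mx_bound n (fun i j => norm (x i j : ell2)))).
  by move=> r [psi [h1 [h2 ->]]]; apply: mx_opnorm_le_bound; exact: apply_entries_bounded.
by exists phi; case: hphi.
Qed.

Lemma contraction_zero : contraction (fun _ => zero).
Proof.
apply: contraction_intro => [y z|k y|y]; rewrite ?plus_zero_r ?scal_zero_r //.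
by change (Cmod (RtoC 0) <= norm y); rewrite Cmod_0; exact: norm_ge_0.
Qed.

Lemma min_norm_le x M : (forall phi, contraction phi -> mx_opnorm (apply_entries phi x) <= M) ->
  os_mnorm (min_os ell2) n x <= M.
Proof.
move=> hM; apply: Sup_le.
  by have [h1 h2] := contraction_zero; eexists; exists (fun _ => zero).
by move=> r [phi [h1 [h2 ->]]]; apply: hM.
Qed.

Lemma min_prenorm : prenorm (os_mnorm (min_os ell2) n).
Proof.
split=> [x|k x].
  apply: Rle_trans (min_norm_ge _ x contraction_zero).
  exact: mx_opnorm_ge0 (apply_entries_bounded _ x contraction_zero).
apply: min_norm_le => phi hphi.
have -> : apply_entries phi (scal (k : C_AbsRing) x) = fun i j c => scal (k : C_AbsRing) (apply_entries phi x i j c).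
  do 3!apply: functional_extensionality => ?; rewrite /apply_entries.
  have [[_ hZ _] _] := hphi.
  by rewrite (hZ k); symmetry; exact: Cmult_assoc.
apply: Rle_trans (mx_opnorm_scal _ _ _ _ k (apply_entries_bounded _ x hphi)) _.
by apply: Rmult_le_compat_l; [exact: Cmod_ge_0 | exact: min_norm_ge].
Qed.

(** Test with the functional that norms the entry. *)
Lemma min_entry_le x i j : norm (x i j : ell2) <= os_mnorm (min_os ell2) n x.
Proof.
set y : ell2 := x i j.
case: (Req_dec (norm y) 0) => hy; first by rewrite hy; exact: (proj1 min_prenorm).
have hy0 : 0 < norm y by have := norm_ge_0 y; lra.
have r0 : 0 < / norm y by exact: Rinv_0_lt_compat.
pose phi (z : ell2) : C_NormedModule := Cmult (RtoC (/ norm y)) (inner z y).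
have hphi : contraction phi.
  apply: contraction_intro => [z w|k z|z]; rewrite /phi.
  - by rewrite inner_plus_l; exact: Cmult_plus_distr_l.
  - rewrite inner_scal_l; change (Cmult (RtoC (/ norm y)) (Cmult k (inner z y)) = Cmult k (Cmult (RtoC (/ norm y)) (inner z y))).
    by ring.
  - rewrite Cmod_mult Cmod_R Rabs_pos_eq; last lra.
    apply: Rle_trans (Rmult_le_compat_l _ _ _ (Rlt_le _ _ r0) (cauchy_schwarz _ z y)) _.
    by right; field.
apply: Rle_trans (min_norm_ge phi x hphi).
have := mx_entry_ge _ n _ _ i j (RtoC 1 : C_NormedModule) (apply_entries_bounded phi x hphi).
have -> : norm (apply_entries phi x i j (RtoC 1)) = norm y.
  rewrite /apply_entries /phi -/y inner_norm; change (Cmod (Cmult (Cmult (RtoC (/ norm y)) (RtoC (norm y ^ 2))) (RtoC 1)) = norm y).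
  rewrite -!RtoC_mult Cmod_R Rabs_pos_eq; first by field.
  by rewrite Rmult_1_r; apply: Rmult_le_pos; [lra | exact: pow2_ge_0].
by apply; change (Cmod (RtoC 1) <= 1); rewrite Cmod_1; lra.
Qed.

End Min.

Lemma min_os_norm (x : min_os ell2) : os_norm x = norm (x : ell2).
Proof.
apply: Rle_antisym; last exact: (min_entry_le 1 (fun _ _ => x) ord0 ord0).
apply: min_norm_le => phi hphi; apply: Rle_trans (mx_opnorm_le_bound _ _ _ _ (apply_entries_bounded _ phi _ hphi)) _.
rewrite /mx_bound !big_ord1 sqrt_pow2; last exact: Rabs_pos.
by rewrite Rabs_pos_eq; [lra | exact: norm_ge_0].
Qed.

(** For each contractive functional, this is Bessel's inequality. *)
Lemma min_orthonormal_column_le n (e : 'I_n -> min_os ell2) :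
  orthonormal_family ell2 n (fun i => e i) -> os_mnorm (min_os ell2) n (first_column e) <= 1.
Proof.
move=> he; apply: min_norm_le => phi hphi; rewrite -sqrt_1.
have [[hD hZ _] _] := hphi.
apply: (mx_first_column_le _ _ _ 1 (fun i c => Cmult (phi (e i)) c)).
  move=> i j c; rewrite /apply_entries /first_column; case: ifP => // _.
  have -> : phi zero = RtoC 0 by have := hZ zero zero; rewrite !scal_zero_l.
  exact: Cmult_0_l.
move=> c hc.
have hb : \big[Rplus/0]_(i < n) Cmod (phi (e i)) ^ 2 <= 1 ^ 2.
  by apply: (bessel ell2 n (fun i => e i) phi) => // y; rewrite Rmult_1_l; exact: contraction_le.
apply: Rle_trans (_ : _ <= norm c ^ 2 * 1 ^ 2) _; last by have := norm_ge_0 c; rewrite /=; nra.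
apply: Rle_trans (Rmult_le_compat_l _ _ _ (pow2_ge_0 _) hb); right.
rewrite -big_Rplus_scal; apply: eq_bigr => i _.
change (Cmod (Cmult (phi (e i)) c) ^ 2 = Cmod c ^ 2 * Cmod (phi (e i)) ^ 2).
by rewrite Cmod_mult; ring.
Qed.

(** * The maximal structure *)

Section Max.
Variable n : nat.
Implicit Types (x : Mn n (max_os ell2)).

Definition op_contraction (H : HilbertSpace) (u : ell2 -> bounded_op H) : Prop :=
  (forall a b, u (plus a b) = plus (u a) (u b)) /\
  (forall (k : C_AbsRing) a, u (scal k a) = scal k (u a)) /\
  (forall a, opnorm (op_fun (u a)) <= norm a).

Lemma op_contraction_bounded (H : HilbertSpace) (u : ell2 -> bounded_op H) x : op_contraction H u ->
  entry_bounded _ n (fun i j => op_fun (u (x i j))) (fun i j => norm (x i j : ell2)).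
Proof.
move=> [_ [_ hu]] i j h; apply: Rle_trans (op_fun_le _ _ _) _.
by apply: Rmult_le_compat_r; [exact: norm_ge_0 | exact: hu].
Qed.

Lemma max_norm_ge (H : HilbertSpace) (u : ell2 -> bounded_op H) x : op_contraction H u ->
  mx_opnorm (fun i j => op_fun (u (x i j))) <= os_mnorm (max_os ell2) n x.
Proof.
move=> hu; apply: (Sup_ub _ (mx_bound n (fun i j => norm (x i j : ell2)))).
  move=> r [K [v [v1 [v2 [v3 ->]]]]]; apply: mx_opnorm_le_bound.
  by apply: (op_contraction_bounded K v).
by exists H, u; case: hu => ? [].
Qed.

(** This contraction tests the maximal structure from below. *)
Lemma col_op_contraction : op_contraction ell2 col_op.
Proof.
split; [|split]; last exact: opnorm_col_op_le.
- move=> a b; apply: subspace_eq; apply: functional_extensionality => h.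
  exact: scal_distr_l.
- move=> k a; apply: subspace_eq; apply: functional_extensionality => h.
  change (scal (ell2_coord h 0 : C_AbsRing) (scal k a) = scal k (scal (ell2_coord h 0 : C_AbsRing) a)).
  by rewrite !scal_assoc; congr scal; exact: Cmult_comm.
Qed.

Lemma max_norm_le x M :
  (forall (H : HilbertSpace) (u : ell2 -> bounded_op H), op_contraction H u ->
     mx_opnorm (fun i j => op_fun (u (x i j))) <= M) ->
  os_mnorm (max_os ell2) n x <= M.
Proof.
move=> hM; apply: Sup_le.
  by have [h1 [h2 h3]] := col_op_contraction; eexists; exists ell2, col_op.
by move=> r [H [u [h1 [h2 [h3 ->]]]]]; apply: hM.
Qed.

Lemma max_prenorm : prenorm (os_mnorm (max_os ell2) n).
Proof.
split=> [x|k x].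
  apply: Rle_trans (max_norm_ge _ _ x col_op_contraction).
  exact: mx_opnorm_ge0 (op_contraction_bounded _ _ x col_op_contraction).
apply: max_norm_le => H u hu.
have -> : (fun i j => op_fun (u ((scal (k : C_AbsRing) x : Mn n (max_os ell2)) i j)))
    = fun i j h => scal (k : C_AbsRing) (op_fun (u (x i j)) h).
  do 3!apply: functional_extensionality => ?; have [_ [hZ _]] := hu.
  by rewrite hZ.
apply: Rle_trans (mx_opnorm_scal _ _ _ _ k (op_contraction_bounded _ _ x hu)) _.
by apply: Rmult_le_compat_l; [exact: Cmod_ge_0 | exact: max_norm_ge].
Qed.

Lemma max_contractive_column_le (e : 'I_n -> max_os ell2) :
  (forall i, norm (e i : ell2) <= 1) -> os_mnorm (max_os ell2) n (first_column e) <= sqrt (INR n).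
Proof.
move=> he; apply: max_norm_le => H u hu; have [hD [hZ hle]] := hu.
apply: (mx_first_column_le _ _ _ _ (fun i => op_fun (u (e i)))).
  move=> i j h; rewrite /first_column; case: ifP => // _.
  have -> : u zero = zero by have := hZ zero zero; rewrite !scal_zero_l.
  by [].
move=> h hh; rewrite -(Rmult_1_r (INR n)) -big_Rplus_const; apply: big_Rplus_le => i.
have := op_fun_le _ (u (e i)) h; have := hle (e i); have := he i.
have := norm_ge_0 (op_fun (u (e i)) h); have := opnorm_ge0 _ (u (e i)); have := norm_ge_0 h.
move=> a1 a2 a3 a4 a5 a6.
have : norm (op_fun (u (e i)) h) <= 1 by nra.
nra.
Qed.

End Max.

Lemma max_os_norm_le (x : max_os ell2) : os_norm x <= norm (x : ell2).
Proof.
apply: max_norm_le => H u hu; apply: Rle_trans (mx_opnorm_le_bound _ _ _ _ (op_contraction_bounded _ _ _ _ hu)) _.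
rewrite /mx_bound !big_ord1 sqrt_pow2; last exact: Rabs_pos.
by rewrite Rabs_pos_eq; [lra | exact: norm_ge_0].
Qed.

(** The column operators send a column of vectors to an operator matrix which, at the first
    basis vector, returns these vectors. *)
Lemma max_column_ge n (w : Mn n (max_os ell2)) j :
  \big[Rplus/0]_(i < n) norm (w i j : ell2) ^ 2 <= os_mnorm (max_os ell2) n w ^ 2.
Proof.
have hb := op_contraction_bounded n _ _ w col_op_contraction.
apply: Rle_trans (_ : _ <= mx_opnorm (fun i j => op_fun (col_op (w i j))) ^ 2) _.
  apply: Rle_trans (mx_column_ge _ _ _ _ j (ell2_delta 0) hb _); last by rewrite norm_delta; lra.
  by right; apply: eq_bigr => i _; rewrite col_op_delta.
apply: pow_incr; split; first exact: mx_opnorm_ge0 hb.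
exact: max_norm_ge col_op_contraction.
Qed.

(** * Spaces of operators *)

Lemma minus_plus_cancel (G : AbelianGroup) (a b c : G) : minus (plus a c) (plus b c) = minus a b.
Proof.
rewrite /minus opp_plus -plus_assoc; congr plus.
by rewrite (plus_comm (opp b)) plus_assoc plus_opp_r plus_zero_l.
Qed.

Lemma minus_eq0 (V : NormedModule C_AbsRing) (a b : V) : norm (minus a b) = 0 -> a = b.
Proof.
move=> /norm_eq_zero h; rewrite -(plus_zero_r a) -(plus_opp_l b) plus_assoc.
by rewrite -/(minus a b) h plus_zero_l.
Qed.

(** This reduces formulas for the elements of the row and column spaces to matrix units, both
    sides being bounded linear in the operator once a vector is fixed. *)
Lemma closed_span_agree (H : HilbertSpace) (S : bounded_op H -> Prop) (W : NormedModule C_AbsRing)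
    (A B : bounded_op H -> W) (K L : R) :
  (forall T T', A (plus T T') = plus (A T) (A T')) ->
  (forall T T', B (plus T T') = plus (B T) (B T')) ->
  (forall (k : C_AbsRing) T, A (scal k T) = scal k (A T)) ->
  (forall (k : C_AbsRing) T, B (scal k T) = scal k (B T)) ->
  (forall T, norm (A T) <= K * opnorm (op_fun T)) ->
  (forall T, norm (B T) <= L * opnorm (op_fun T)) ->
  (forall T, S T -> A T = B T) -> forall T, closed_span S T -> A T = B T.
Proof.
move=> AD BD AZ BZ AK BL hS T hT.
have hspan T' : lin_span S T' -> A T' = B T'.
  elim=> [x /hS //||x y _ hx _ hy|k x _ hx].
  - by have := AZ zero zero; have := BZ zero zero; rewrite !scal_zero_l => -> ->.
  - by rewrite AD BD hx hy.
  - by rewrite AZ BZ hx.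
apply: minus_eq0; apply: Rle_antisym (norm_ge_0 _); apply: Rle_plus_epsilon => eps eps0.
have hK : 0 < Rabs K + Rabs L + 1 by have := Rabs_pos K; have := Rabs_pos L; lra.
have [T' [hT' hclose]] := hT (mkposreal _ (Rdiv_lt_0_compat _ _ eps0 hK)).
have eT : T = plus (minus T T') T' by rewrite /minus -plus_assoc plus_opp_l plus_zero_r.
have -> : A T = plus (A (minus T T')) (A T') by rewrite -AD -eT.
have -> : B T = plus (B (minus T T')) (B T') by rewrite -BD -eT.
rewrite (hspan _ hT') minus_plus_cancel.
have h0 := opnorm_ge0 _ (minus T T').
apply: Rle_trans (norm_triangle _ _) _; rewrite norm_opp Rplus_0_l.
have h1 := AK (minus T T'); have h2 := BL (minus T T').
have -> : eps = (Rabs K + Rabs L + 1) * (eps / (Rabs K + Rabs L + 1)) by field; lra.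
apply: (Rle_trans _ ((Rabs K + Rabs L + 1) * opnorm (op_fun (minus T T')))).
  by have := Rle_abs K; have := Rle_abs L; nra.
by apply: Rmult_le_compat_l; [lra | exact: Rlt_le hclose].
Qed.

Section Concrete.
Variables (H : HilbertSpace) (P : bounded_op H -> Prop) (hP : is_subspace P).
Notation X := (concrete_os hP).

Definition op_of (x : X) : bounded_op H := proj1_sig x.

Lemma concrete_bounded n (w : Mn n X) :
  entry_bounded _ n (fun i j => op_fun (op_of (w i j))) (fun i j => opnorm (op_fun (op_of (w i j)))).
Proof. by move=> i j h; exact: op_fun_le. Qed.

Lemma concrete_prenorm n : prenorm (os_mnorm X n).
Proof.
split=> [w|k w]; first exact: mx_opnorm_ge0 (concrete_bounded n w).
exact: (mx_opnorm_scal _ _ _ _ k (concrete_bounded n w)).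
Qed.

Lemma concrete_os_norm (x : X) : os_norm x = opnorm (op_fun (op_of x)).
Proof.
have hb := concrete_bounded 1 (fun _ _ => x).
apply: Rle_antisym.
  apply: Rle_trans (mx_opnorm_le_bound _ _ _ _ hb) _.
  rewrite /mx_bound !big_ord1 sqrt_pow2; last exact: Rabs_pos.
  by rewrite Rabs_pos_eq; [lra | exact: opnorm_ge0].
apply: opnorm_lub => h hh.
exact: (mx_entry_ge _ 1 _ _ ord0 ord0 h hb hh).
Qed.

Lemma concrete_entry_le n (w : Mn n X) i j : os_norm (w i j) <= os_mnorm X n w.
Proof.
rewrite concrete_os_norm; apply: opnorm_lub => h hh.
exact: (mx_entry_ge _ n _ _ i j h (concrete_bounded n w) hh).
Qed.

Lemma concrete_first_column_le n (e : 'I_n -> X) (M : R) :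
  (forall h, norm h <= 1 -> \big[Rplus/0]_(i < n) norm (op_fun (op_of (e i)) h) ^ 2 <= M) ->
  os_mnorm X n (first_column e) <= sqrt M.
Proof.
move=> he; apply: (mx_first_column_le _ _ _ _ (fun i => op_fun (op_of (e i)))) => //.
by move=> i j h; rewrite /first_column; case: ifP.
Qed.

End Concrete.

Arguments op_of {H P hP} x.

(** * The column space *)

Lemma col_apply (T : col_os) (h : ell2) :
  op_fun (op_of T) h = scal (ell2_coord h 0 : C_AbsRing) (op_fun (op_of T) (ell2_delta 0)).
Proof.
apply: (closed_span_agree ell2 _ ell2 (fun T => op_fun T h)
  (fun T => scal (ell2_coord h 0 : C_AbsRing) (op_fun T (ell2_delta 0))) (norm h) (norm h)
  _ _ _ _ _ _ _ _ (proj2_sig T)).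
- by [].
- by move=> T1 T2; exact: scal_distr_l.
- by [].
- move=> k T1; change (scal (ell2_coord h 0 : C_AbsRing) (scal k (op_fun T1 (ell2_delta 0)))
    = scal k (scal (ell2_coord h 0 : C_AbsRing) (op_fun T1 (ell2_delta 0)))).
  by rewrite !scal_assoc; congr scal; exact: Cmult_comm.
- by move=> T1; rewrite Rmult_comm; exact: op_fun_le.
- move=> T1; apply: Rle_trans (norm_scal _ _) _.
  apply: Rmult_le_compat; [exact: Cmod_ge_0 | exact: norm_ge_0 | exact: coord_le |].
  by apply: Rle_trans (op_fun_le _ _ _) _; rewrite norm_delta Rmult_1_r; lra.
- move=> _ [i ->]; change (scal (ell2_coord h 0 : C_AbsRing) (ell2_delta i : ell2)
    = scal (ell2_coord h 0 : C_AbsRing) (scal (RtoC 1 : C_AbsRing) (ell2_delta i : ell2))).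
  by congr scal; symmetry; exact: (scal_one (K := C_AbsRing)).
Qed.

Lemma col_os_norm_le (T : col_os) : os_norm T <= norm (op_fun (op_of T) (ell2_delta 0)).
Proof.
rewrite concrete_os_norm; apply: opnorm_lub => h hh; rewrite col_apply.
apply: Rle_trans (norm_scal _ _) _.
change (Cmod (ell2_coord h 0) * norm (op_fun (op_of T) (ell2_delta 0)) <= norm (op_fun (op_of T) (ell2_delta 0))).
have := coord_le h 0; have := Cmod_ge_0 (ell2_coord h 0); have := norm_ge_0 (op_fun (op_of T) (ell2_delta 0)); nra.
Qed.

Lemma col_column_le n (w : Mn n col_os) j :
  \big[Rplus/0]_(i < n) os_norm (w i j) ^ 2 <= os_mnorm col_os n w ^ 2.
Proof.
apply: Rle_trans (mx_column_ge _ _ _ _ j (ell2_delta 0) (concrete_bounded _ _ _ n w) _); last first.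
  by rewrite norm_delta; lra.
apply: big_Rplus_le => i; apply: pow_incr; split; last exact: col_os_norm_le.
exact: (proj1 (concrete_prenorm _ _ _ 1)).
Qed.

Lemma col_contractive_column_le n (e : 'I_n -> col_os) :
  (forall i, os_norm (e i) <= 1) -> os_mnorm col_os n (first_column e) <= sqrt (INR n).
Proof.
move=> he; apply: concrete_first_column_le => h hh.
rewrite -(Rmult_1_r (INR n)) -big_Rplus_const; apply: big_Rplus_le => i.
have := he i; rewrite concrete_os_norm => hi.
have := op_fun_le _ (op_of (e i)) h; have := norm_ge_0 (op_fun (op_of (e i)) h).
have := opnorm_ge0 _ (op_of (e i)); have := norm_ge_0 h => a1 a2 a3 a4.
have : norm (op_fun (op_of (e i)) h) <= 1 by nra.
nra.
Qed.

(** * The row space *)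

Lemma conj_summable (x : ell2_module) : square_summable (fun k => Cconj (ell2_coord x k)).
Proof. by apply: ex_series_ext (ell2_summable x) => k; rewrite Cmod_conj. Qed.

Definition ell2_conj (x : ell2) : ell2 := exist _ _ (conj_summable x) : ell2_module.

Lemma ell2_ext (x y : ell2) : (forall k, ell2_coord x k = ell2_coord y k) -> x = y.
Proof. by move=> h; apply: subspace_eq; apply: functional_extensionality. Qed.

Lemma norm_ell2_conj x : norm (ell2_conj x) = norm x.
Proof.
change (ell2_norm (ell2_conj x) = ell2_norm x); rewrite /ell2_norm; congr sqrt.
by apply: Series_ext => k; rewrite Cmod_conj.
Qed.

Lemma ell2_conj_plus x y : ell2_conj (plus x y) = plus (ell2_conj x) (ell2_conj y).
Proof. by apply: ell2_ext => k; exact: Cplus_conj. Qed.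

Lemma ell2_conj_scal (k : C) x : ell2_conj (scal (k : C_AbsRing) x) = scal (Cconj k : C_AbsRing) (ell2_conj x).
Proof. by apply: ell2_ext => j; exact: Cmult_conj. Qed.

Lemma ell2_conj_delta j : ell2_conj (ell2_delta j) = ell2_delta j.
Proof.
apply: ell2_ext => k.
change (Cconj (if k == j then RtoC 1 else RtoC 0) = if k == j then RtoC 1 else RtoC 0).
by case: ifP => _; rewrite /Cconj /= Ropp_0.
Qed.

(** The bilinear pairing [sum_k x_k h_k]: the inner product would be antilinear in [h]. *)
Definition row_pairing (x h : ell2) : C := inner x (ell2_conj h).

Lemma row_pairing_le x h : Cmod (row_pairing x h) <= norm x * norm h.
Proof. by rewrite -(norm_ell2_conj h); exact: cauchy_schwarz. Qed.

Definition row_coef (T : bounded_op ell2) (k : nat) : C := ell2_coord (op_fun T (ell2_delta k)) 0.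

(** Bessel's inequality for the functional [h |-> (T h)_0] and the standard basis. *)
Lemma row_coef_sum_le (T : bounded_op ell2) n :
  sum_n (fun k => Cmod (row_coef T k) ^ 2) n <= opnorm (op_fun T) ^ 2.
Proof.
have -> : sum_n (fun k => Cmod (row_coef T k) ^ 2) n = \big[Rplus/0]_(i < n.+1) Cmod (row_coef T i) ^ 2.
  elim: n => [|n IH]; first by rewrite sum_O big_ord1.
  by rewrite sum_Sn IH [RHS]big_ord_recr; reflexivity.
have [TD TZ _] := proj2_sig T.
apply: (bessel ell2 n.+1 (fun i => ell2_delta i) (fun h => ell2_coord (op_fun T h) 0)).
- exact: delta_orthonormal.
- by move=> x y; rewrite /op_fun TD; reflexivity.
- by move=> k x; rewrite /op_fun TZ; reflexivity.
- by move=> x; apply: Rle_trans (coord_le _ 0) (op_fun_le _ _ _).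
Qed.

Lemma row_coef_summable (T : bounded_op ell2) : square_summable (row_coef T).
Proof. exact: (proj1 (ex_series_of_bounded (fun k => pow2_ge_0 _) (row_coef_sum_le T))). Qed.

Definition row_vec (T : bounded_op ell2) : ell2 := exist _ _ (row_coef_summable T) : ell2_module.

Lemma norm_row_vec_le T : norm (row_vec T) <= opnorm (op_fun T).
Proof.
apply: Rsqr_incr_0_var; last exact: opnorm_ge0.
rewrite !Rsqr_pow2; change (ell2_norm (row_vec T) ^ 2 <= opnorm (op_fun T) ^ 2); rewrite ell2_norm_sq.
exact: (proj2 (ex_series_of_bounded (fun k => pow2_ge_0 _) (row_coef_sum_le T))).
Qed.

Lemma row_vec_plus S T : row_vec (plus S T) = plus (row_vec S) (row_vec T).
Proof. exact: ell2_ext. Qed.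

Lemma row_vec_scal (k : C_AbsRing) T : row_vec (scal k T) = scal k (row_vec T).
Proof. exact: ell2_ext. Qed.

Lemma row_apply (T : row_os) (h : ell2) :
  op_fun (op_of T) h = scal (row_pairing (row_vec (op_of T)) h : C_AbsRing) (ell2_delta 0 : ell2).
Proof.
apply: (closed_span_agree ell2 _ ell2 (fun T => op_fun T h)
  (fun T => scal (row_pairing (row_vec T) h : C_AbsRing) (ell2_delta 0 : ell2)) (norm h) (norm h)
  _ _ _ _ _ _ _ _ (proj2_sig T)).
- by [].
- by move=> T1 T2; rewrite row_vec_plus /row_pairing inner_plus_l; exact: scal_distr_r.
- by [].
- by move=> k T1; rewrite row_vec_scal /row_pairing inner_scal_l scal_assoc.
- by move=> T1; rewrite Rmult_comm; exact: op_fun_le.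
- move=> T1; apply: Rle_trans (norm_scal _ _) _; rewrite norm_delta Rmult_1_r Rmult_comm.
  apply: Rle_trans (row_pairing_le _ _) _.
  by apply: Rmult_le_compat_r; [exact: norm_ge_0 | exact: norm_row_vec_le].
- move=> _ [j ->].
  have -> : row_vec (mat_unit 0 j) = ell2_delta j.
    apply: ell2_ext => k; change (Cmult (if j == k then RtoC 1 else RtoC 0) (RtoC 1) = if k == j then RtoC 1 else RtoC 0).
    by rewrite Cmult_1_r eq_sym.
  by rewrite /row_pairing inner_conj inner_delta; change (mat_unit_fun 0 j h = scal (Cconj (Cconj (ell2_coord h j)) : C_AbsRing) (ell2_delta 0 : ell2)); rewrite Cconj_conj.
Qed.

Lemma row_os_norm (T : row_os) : os_norm T = norm (row_vec (op_of T)).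
Proof.
rewrite concrete_os_norm; apply: Rle_antisym; last exact: norm_row_vec_le.
apply: opnorm_lub => h hh; rewrite row_apply.
apply: Rle_trans (norm_scal _ _) _; rewrite norm_delta Rmult_1_r.
apply: Rle_trans (row_pairing_le _ _) _.
by have := norm_ge_0 (row_vec (op_of T)); nra.
Qed.

(** At a fixed [h], the entries act through the functional [x |-> sum_k x_k h_k], so this
    is Bessel's inequality again. *)
Lemma row_orthonormal_column_le n (e : 'I_n -> row_os) :
  orthonormal_family ell2 n (fun i => row_vec (op_of (e i))) -> os_mnorm row_os n (first_column e) <= 1.
Proof.
move=> he; rewrite -sqrt_1; apply: concrete_first_column_le => h hh.
apply: (Rle_trans _ (norm h ^ 2)); last by have := norm_ge_0 h; nra.
apply: Rle_trans (bessel ell2 n _ (fun x => row_pairing x h) (norm h) he _ _ _).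
- apply: big_Rplus_le => i; rewrite row_apply; apply: pow_incr; split; first exact: norm_ge_0.
  by apply: Rle_trans (norm_scal _ _) _; rewrite norm_delta Rmult_1_r; right.
- by move=> x y; exact: inner_plus_l.
- by move=> k x; exact: inner_scal_l.
- by move=> x; rewrite Rmult_comm; exact: row_pairing_le.
Qed.

Lemma row_op_linear (x : ell2) :
  is_linear (fun h : ell2 => scal (row_pairing x h : C_AbsRing) (ell2_delta 0 : ell2)).
Proof.
split=> [g h|k h|].
- by rewrite /row_pairing ell2_conj_plus inner_plus_r; exact: scal_distr_r.
- by rewrite /row_pairing ell2_conj_scal inner_scal_r Cconj_conj; exact: (esym (scal_assoc _ _ _)).
- exists (norm x + 1); split; first by have := norm_ge_0 x; lra.
  move=> h; apply: Rle_trans (norm_scal _ _) _; rewrite norm_delta Rmult_1_r.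
  by apply: Rle_trans (row_pairing_le x h) _; have := norm_ge_0 h; nra.
Qed.

Definition row_op (x : ell2) : bounded_op ell2 := exist _ _ (row_op_linear x).

Lemma row_vec_row_op x : row_vec (row_op x) = x.
Proof.
apply: ell2_ext => k; change (Cmult (row_pairing x (ell2_delta k)) (RtoC 1) = ell2_coord x k).
by rewrite Cmult_1_r /row_pairing ell2_conj_delta inner_delta.
Qed.

Lemma opnorm_row_op_le x : opnorm (op_fun (row_op x)) <= norm x.
Proof.
apply: opnorm_lub => h hh; apply: Rle_trans (norm_scal _ _) _; rewrite norm_delta Rmult_1_r.
by apply: Rle_trans (row_pairing_le x h) _; have := norm_ge_0 x; nra.
Qed.

Lemma bounded_op_ext (H : HilbertSpace) (S T : bounded_op H) : (forall h, op_fun S h = op_fun T h) -> S = T.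
Proof. by move=> h; apply: subspace_eq; apply: functional_extensionality. Qed.

Lemma row_op_plus x y : row_op (plus x y) = plus (row_op x) (row_op y).
Proof.
apply: bounded_op_ext => h.
change (scal (row_pairing (plus x y) h : C_AbsRing) (ell2_delta 0 : ell2) =
  plus (scal (row_pairing x h : C_AbsRing) (ell2_delta 0 : ell2)) (scal (row_pairing y h : C_AbsRing) (ell2_delta 0 : ell2))).
by rewrite /row_pairing inner_plus_l; exact: scal_distr_r.
Qed.

Lemma row_op_scal (k : C_AbsRing) x : row_op (scal k x) = scal k (row_op x).
Proof.
apply: bounded_op_ext => h.
change (scal (row_pairing (scal k x) h : C_AbsRing) (ell2_delta 0 : ell2) =
  scal k (scal (row_pairing x h : C_AbsRing) (ell2_delta 0 : ell2))).
by rewrite /row_pairing inner_scal_l; exact: (esym (scal_assoc _ _ _)).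
Qed.

Lemma row_op_delta j : row_op (ell2_delta j) = mat_unit 0 j.
Proof.
apply: bounded_op_ext => h; change (scal (row_pairing (ell2_delta j) h : C_AbsRing) (ell2_delta 0 : ell2) = mat_unit_fun 0 j h).
rewrite /row_pairing inner_conj inner_delta.
change (scal (Cconj (Cconj (ell2_coord h j)) : C_AbsRing) (ell2_delta 0 : ell2) = mat_unit_fun 0 j h).
by rewrite Cconj_conj.
Qed.

Fixpoint truncation (x : ell2) (N : nat) : ell2 :=
  if N is N'.+1 then plus (truncation x N') (scal (ell2_coord x N' : C_AbsRing) (ell2_delta N' : ell2))
  else zero.

Lemma truncation_coord x N k : (N <= k)%N -> ell2_coord (truncation x N) k = RtoC 0.
Proof.
elim: N => [|N IH] hk //=.
change (Cplus (ell2_coord (truncation x N) k) (Cmult (ell2_coord x N) (if k == N then RtoC 1 else RtoC 0)) = RtoC 0).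
by rewrite IH ?(ltnW hk) // gtn_eqF // Cmult_0_r Cplus_0_r.
Qed.

(** Removing one coordinate of the remainder lowers its squared norm by the squared modulus
    of that coordinate. *)
Lemma truncation_remainder x N :
  norm (minus x (truncation x N)) ^ 2 + \big[Rplus/0]_(k < N) Cmod (ell2_coord x k) ^ 2 = norm x ^ 2.
Proof.
elim: N => [|N IH]; first by rewrite big_ord0 Rplus_0_r /= minus_zero_r.
rewrite big_ord_recr -IH.
change (truncation x N.+1) with (plus (truncation x N) (scal (ell2_coord x N : C_AbsRing) (ell2_delta N : ell2))).
set y := minus x (truncation x N).
have hy : ell2_coord y N = ell2_coord x N.
  change (Cplus (ell2_coord x N) (Copp (ell2_coord (truncation x N) N)) = ell2_coord x N).
  by rewrite truncation_coord // Copp_0 Cplus_0_r.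
have -> : minus x (plus (truncation x N) (scal (ell2_coord x N : C_AbsRing) (ell2_delta N : ell2))) =
    plus y (scal (Copp (ell2_coord y N) : C_AbsRing) (ell2_delta N : ell2)).
  by rewrite hy /y /minus opp_plus plus_assoc; congr plus; symmetry; exact: (scal_opp_l (K := C_AbsRing)).
have -> : norm (plus y (scal (Copp (ell2_coord y N) : C_AbsRing) (ell2_delta N : ell2))) ^ 2
    = norm y ^ 2 - Cmod (ell2_coord y N) ^ 2.
  rewrite norm_sq_plus norm_sq_scal inner_scal_r inner_delta norm_delta Cmod_opp (Cmod2_alt (ell2_coord y N)).
  by case: (ell2_coord y N) => a b; rewrite /Re /Im /=; ring.
by rewrite hy; set a := _ ^ 2; set b := _ ^ 2; set c := bigop _ _ _; change (a - b + (c + b) = a + c); ring.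
Qed.

Lemma truncation_cvg x (eps : posreal) : exists N, norm (minus x (truncation x N)) < eps.
Proof.
have he := cond_pos eps.
have hs : is_series (fun k => Cmod (ell2_coord x k) ^ 2) (norm x ^ 2).
  have -> : norm x ^ 2 = Series (fun k => Cmod (ell2_coord x k) ^ 2) by exact: ell2_norm_sq.
  exact: Series_correct (ell2_summable x).
have [N hN] := proj1 (filterlim_locally _ _) hs (mkposreal _ (pow_lt _ 2 he)).
exists N.+1; apply: Rsqr_incrst_0; [|exact: norm_ge_0|lra].
rewrite !Rsqr_pow2; have := truncation_remainder x N.+1.
have <- : sum_n (fun k => Cmod (ell2_coord x k) ^ 2) N = \big[Rplus/0]_(k < N.+1) Cmod (ell2_coord x k) ^ 2.
  elim: (N) => [|n IH]; first by rewrite sum_O big_ord1.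
  by rewrite sum_Sn IH [RHS]big_ord_recr; reflexivity.
have /Rabs_def2 : Rabs (sum_n (fun k => Cmod (ell2_coord x k) ^ 2) N - norm x ^ 2) < eps ^ 2 by exact: (hN N (le_n _)).
lra.
Qed.

(** The operators of the truncations are combinations of matrix units, and the operator norm
    is at most the norm of the sequence. *)
Lemma row_op_closed_span x : closed_span (fun T => exists j, T = mat_unit 0 j) (row_op x).
Proof.
move=> eps; have [N hN] := truncation_cvg x eps.
exists (row_op (truncation x N)); split.
  elim: N {hN} => [|N IH] /=.
    have -> : row_op zero = zero by have := row_op_scal zero zero; rewrite !scal_zero_l.
    exact: span_zero.
  rewrite row_op_plus row_op_scal row_op_delta; apply: span_plus => //; apply: span_scal; apply: span_gen.
  by exists N.
have -> : minus (row_op x) (row_op (truncation x N)) = row_op (minus x (truncation x N)).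
  by rewrite /minus row_op_plus -(scal_opp_one (truncation x N)) row_op_scal scal_opp_one.
exact: Rle_lt_trans (opnorm_row_op_le _) hN.
Qed.

Lemma row_isometry : linear_isometry_onto (@os_norm row_os) (fun y : ell2 => norm y)
  (fun T : row_os => row_vec (op_of T)).
Proof.
split.
- by move=> S T; exact: row_vec_plus.
- by move=> k T; exact: row_vec_scal.
- by move=> T; rewrite row_os_norm.
- by move=> y; exists (exist _ _ (row_op_closed_span y)); exact: row_vec_row_op.
Qed.

(** * The value of kappa *)

Theorem corollary4p4 (theta : R) (n : nat) (htheta : 0 <= theta <= 1)
    (hn : (0 < n)%N) :
  (forall phi : row_os -> col_os,
     linear_isometry_onto (@os_norm row_os) (@os_norm col_os) phi ->
     is_kappa n (interp_os phi theta) (Rpower (INR n) (theta / 2))) /\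
  (forall phi : min_os ell2 -> max_os ell2,
     linear_isometry_onto (@os_norm (min_os ell2)) (@os_norm (max_os ell2)) phi ->
     is_kappa n (interp_os phi theta) (Rpower (INR n) (theta / 2))).
Proof.
have max_norm (x : max_os ell2) : os_norm x = norm (x : ell2).
  apply: Rle_antisym; first exact: max_os_norm_le.
  have := max_column_ge 1 (fun _ _ => x) ord0; rewrite big_ord1 => h.
  by apply: Rsqr_incr_0_var; rewrite ?Rsqr_pow2 //; exact: (proj1 (max_prenorm 1)).
split=> phi hphi.
- apply: (kappa_interp _ _ phi theta htheta (iso_scal hphi) _ _ (fun T : row_os => row_vec (op_of T))) => //.
  + by move=> m; exact: concrete_prenorm.
  + by move=> m; exact: concrete_prenorm.
  + exact: iso_norm hphi.
  + exact: row_isometry.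
  + by move=> m w i j; exact: concrete_entry_le.
  + exact: col_column_le.
  + exact: row_orthonormal_column_le.
  + exact: col_contractive_column_le.
- apply: (kappa_interp _ _ phi theta htheta (iso_scal hphi) _ _ (fun x : min_os ell2 => (x : ell2))) => //.
  + exact: min_prenorm.
  + exact: max_prenorm.
  + exact: iso_norm hphi.
  + by split=> // [x|y]; [rewrite min_os_norm | exists y].
  + by move=> m w i j; rewrite min_os_norm; exact: min_entry_le.
  + move=> m w j; apply: Rle_trans (max_column_ge m w j); right.
    by apply: eq_bigr => i _; rewrite max_norm.
  + exact: min_orthonormal_column_le.
  + by move=> m e he; apply: max_contractive_column_le => i; rewrite -max_norm.
Qed.
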